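(* Let $\mathcal{A}$ be the Hopf algebra of regular functions on a linear algebraic group, $(\mathcal{E},d)$ the classical bicovariant differential calculus on $\mathcal{A}$, and $\Omega$ a normalised dual $2$-cocycle on $\mathcal{A}$. Consider the bicovariant differential calculus $(\mathcal{E}_\Omega,d_\Omega)$ over the Hopf algebra $\mathcal{A}_\Omega$, with canonical braiding $\sigma_\Omega$, and let $g'$ be a left $\mathcal{A}_\Omega$-linear bi-invariant pseudo-Riemannian metric on $\mathcal{E}_\Omega$. Let $\nabla'$ be a bicovariant left connection on $\mathcal{E}_\Omega$. Then $\widetilde{{}_L\Pi_{g'}}(\nabla')=d_\Omega g'$ (i.e. $\nabla'$ is compatible with $g'$ in the sense of this paper) if and only if $$(\mathrm{id}\otimes g')(\nabla'\otimes\mathrm{id})+(g'\otimes\mathrm{id})(\mathrm{id}\otimes\sigma_\Omega)(\mathrm{id}\otimes\nabla')=0\quad\text{on }{}_0(\mathcal{E}_\Omega)\otimes_{\mathbb{C}}{}_0(\mathcal{E}_\Omega)$$ (i.e. $\nabla'$ is compatible with $g'$ in the sense of Heckenberger and Schmüdgen).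
   Context: The classical bicovariant differential calculus on $\mathcal{A}=\mathcal{O}(G)$ ($G$ over $\mathbb{C}$) is the module of (algebraic) differential one-forms on $G$ with left and right actions equal, together with the usual exterior derivative $d$. Cocycle deformation. All vector spaces are over $\mathbb{C}$. $\mathcal{A}$ has coproduct $\Delta$, counit $\epsilon$; Sweedler notation $\Delta(a)=a_{(1)}\otimes a_{(2)}$, left coactions $m\mapsto m_{(-1)}\otimes m_{(0)}$, right coactions $m\mapsto m_{(0)}\otimes m_{(1)}$. Let $\widehat{\mathcal{A}}$ be the restricted dual Hopf algebra of $\mathcal{A}$. A normalised dual $2$-cocycle is an invertible $\Omega=\sum_ih_i\otimes k_i\in\widehat{\mathcal{A}}\otimes\widehat{\mathcal{A}}$ with $(\widehat\epsilon\otimes\mathrm{id})(\Omega)=1=(\mathrm{id}\otimes\widehat\epsilon)(\Omega)$ and $(\Omega\otimes1)[(\widehat\Delta\otimes\mathrm{id})(\Omega)]=(1\otimes\Omega)[(\mathrm{id}\otimes\widehat\Delta)(\Omega)]$. Put $\gamma(a\otimes b)=\sum_ih_i(a)k_i(b)$, with convolution inverse $\overline\gamma$. $\mathcal{A}_\Omega$ is $\mathcal{A}$ with the same coproduct and product $a*_\Omega b=\gamma(a_{(1)}\otimes b_{(1)})a_{(2)}b_{(2)}\overline\gamma(a_{(3)}\otimes b_{(3)})$. For a bicovariant $\mathcal{A}$-bimodule $M$, $M_\Omega$ is the bicovariant $\mathcal{A}_\Omega$-bimodule with the same space and coactions and actions $a*_\Omega m=\gamma(a_{(1)}\otimes m_{(-1)})a_{(2)}m_{(0)}\overline\gamma(a_{(3)}\otimes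 m_{(1)})$, $m*_\Omega a=\gamma(m_{(-1)}\otimes a_{(1)})m_{(0)}a_{(2)}\overline\gamma(m_{(1)}\otimes a_{(3)})$. $(\mathcal{E}_\Omega,d_\Omega)$, with $d_\Omega=d$ as a linear map, is a bicovariant differential calculus over $\mathcal{A}_\Omega$; its canonical braiding satisfies $\sigma_\Omega^2=1$, so its restriction ${}_0(\sigma_\Omega)$ is diagonalisable. The following notions, written for a bicovariant calculus $(\mathcal{E},d)$ over a Hopf algebra $\mathcal{A}$ with finite-dimensional ${}_0\mathcal{E}$, $\mathcal{E}_0$, are applied to $(\mathcal{E}_\Omega,d_\Omega)$ over $\mathcal{A}_\Omega$. A left-covariant bimodule is a bimodule $M$ with a left comodule coaction $\Delta_M:M\to\mathcal{A}\otimes M$ such that $\Delta_M(am)=\Delta(a)\Delta_M(m)$, $\Delta_M(ma)=\Delta_M(m)\Delta(a)$; right-covariant bimodules are defined in the same way with ${}_M\Delta:M\to M\otimes\mathcal{A}$; bicovariant means both, with commuting coactions. A linear map is bicovariant if it intertwines both coactions. ${}_0M$, $M_0$ are the left-, right-coinvariants. $M\otimes_{\mathcal{A}}N$ carries the diagonal coactions; ${}_0(M\otimes_{\mathcal{A}}N)={}_0M\otimes_{\mathbb{C}}{}_0N$ and multiplication $\widetilde{v}^M:\mathcal{A}\otimes_{\mathbb{C}}{}_0M\to M$ is an isomorphism (recalled facts). A first order differential calculus is a bimodule $\mathcal{E}$ with a linear derivation $d:\mathcal{A}\to\mathcal{E}$ such that every element is of the form $\sum a_kdb_k$; it is bicovariant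 if $\mathcal{E}$ is a bicovariant bimodule with $\Delta_{\mathcal{E}}d=(\mathrm{id}\otimes d)\Delta$, ${}_{\mathcal{E}}\Delta d=(d\otimes\mathrm{id})\Delta$. The canonical braiding $\sigma$ is the unique bimodule endomorphism of $\mathcal{E}\otimes_{\mathcal{A}}\mathcal{E}$ with $\sigma(\omega\otimes\eta)=\eta\otimes\omega$ for $\omega\in{}_0\mathcal{E}$, $\eta\in\mathcal{E}_0$; ${}_0\sigma$ is its restriction to ${}_0\mathcal{E}\otimes_{\mathbb{C}}{}_0\mathcal{E}$. ${}_0P_{\mathrm{sym}}$ is the idempotent on ${}_0\mathcal{E}\otimes_{\mathbb{C}}{}_0\mathcal{E}$ with range $\mathrm{Ker}({}_0\sigma-1)$ and kernel the sum of the eigenspaces of ${}_0\sigma$ for eigenvalues $\neq1$. A left connection on $\mathcal{E}$ is a $\mathbb{C}$-linear map $\nabla:\mathcal{E}\to\mathcal{E}\otimes_{\mathcal{A}}\mathcal{E}$ with $\nabla(ae)=a\nabla(e)+da\otimes_{\mathcal{A}}e$; it is bicovariant if it is a bicovariant map. A left $\mathcal{A}$-linear pseudo-Riemannian metric is a left $\mathcal{A}$-linear map $g:\mathcal{E}\otimes_{\mathcal{A}}\mathcal{E}\to\mathcal{A}$ with $g\circ\sigma=g$ and such that $g(e\otimes f)=0$ for all $e$ implies $f=0$; it is bi-invariant if $(\mathrm{id}\otimes\epsilon g)\Delta_{\mathcal{E}\otimes_{\mathcal{A}}\mathcal{E}}=g$ and $(\epsilon g\otimes\mathrm{id}){}_{\mathcal{E}\otimes_{\mathcal{A}}\mathcal{E}}\Delta=g$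 (so $g$ is scalar-valued on ${}_0\mathcal{E}\otimes_{\mathbb{C}}{}_0\mathcal{E}$). Define $\widetilde{{}_L\Pi^0_g}(\nabla)=2(g\otimes\mathrm{id})(\mathrm{id}\otimes\sigma)(\mathrm{id}\otimes\nabla){}_0P_{\mathrm{sym}}:{}_0\mathcal{E}\otimes_{\mathbb{C}}{}_0\mathcal{E}\to{}_0\mathcal{E}$ and $\widetilde{{}_L\Pi_g}(\nabla):\mathcal{E}\otimes_{\mathcal{A}}\mathcal{E}\to\mathcal{E}$ by $\widetilde{{}_L\Pi_g}(\nabla)(a\,\omega_1\otimes\omega_2)=a\,\widetilde{{}_L\Pi^0_g}(\nabla)(\omega_1\otimes\omega_2)+(da)\,g(\omega_1\otimes\omega_2)$ for $a\in\mathcal{A}$, $\omega_1,\omega_2\in{}_0\mathcal{E}$. $dg$ denotes the map $e\otimes f\mapsto d(g(e\otimes f))$. *)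

(* Defs.v *)
From HB Require Import structures.
From mathcomp Require Import all_boot all_order all_algebra.
From mathcomp Require Import boolp classical_sets functions reals complex.
From mathcomp Require Import freeg.

Set Implicit Arguments.
Unset Strict Implicit.
Unset Printing Implicit Defensive.

Import Order.TTheory GRing.Theory Num.Theory.
Import Quotient.

Local Open Scope ring_scope.
Local Open Scope quotient_scope.

Section LinearSpan.
Variables (k : fieldType) (V : lmodType k) (S : set V).

Definition lin_span : {pred V} := fun v =>
  `[< exists2 s : seq (k * V), (forall p, p \in s -> S p.2) &
        v = \sum_(p <- s) p.1 *: p.2 >].

Lemma lin_span_closed : submod_closed lin_span.
Proof.
split=> [|c u v /asboolP[s Ss ->] /asboolP[t St ->]]; apply/asboolP.
  by exists [::] => //; rewrite big_nil.
exists ([seq (c * p.1, p.2) | p <- s] ++ t) => [p|].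
  by rewrite mem_cat => /orP[/mapP[q /Ss ? ->] //|/St].
rewrite big_cat big_map scaler_sumr; congr (_ + _).
by apply: eq_bigr => p _; rewrite scalerA.
Qed.

HB.instance Definition _ := GRing.isSubmodClosed.Build k V lin_span lin_span_closed.

Definition quot_scale (c : k) (x : {quot lin_span}) : {quot lin_span} :=
  \pi_{quot lin_span} (c *: repr x).

Lemma pi_scale c v :
  quot_scale c (\pi_{quot lin_span} v) = \pi_{quot lin_span} (c *: v).
Proof.
apply/eqP; rewrite piE equivE -scalerBr rpredZ // idealrBE.
by rewrite reprK.
Qed.

Let quot_scaleA a b x : quot_scale a (quot_scale b x) = quot_scale (a * b) x.
Proof. by elim/quotW: x => v; rewrite (pi_scale b v) !(pi_scale _ (_ *: _)) (pi_scale _ v) scalerA. Qed.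

Let quot_scale1 : left_id 1 quot_scale.
Proof. by move=> x; elim/quotW: x => v; rewrite (pi_scale 1 v) scale1r. Qed.

Let quot_scaleDr : right_distributive quot_scale +%R.
Proof.
move=> c x y; elim/quotW: x => u; elim/quotW: y => v.
by rewrite -raddfD (pi_scale c u) (pi_scale c v) (pi_scale c (u + v)) scalerDr raddfD.
Qed.

Let quot_scaleDl x : {morph quot_scale^~ x : a b / a + b}.
Proof. by elim/quotW: x => v a b; rewrite (pi_scale a v) (pi_scale b v) (pi_scale (a + b) v) scalerDl raddfD. Qed.

HB.instance Definition _ := GRing.Zmodule_isLmodule.Build k {quot lin_span}
  quot_scaleA quot_scale1 quot_scaleDr quot_scaleDl.
End LinearSpan.

Section BalancedTensor.
Variables (k : fieldType) (M N : lmodType k) (I : Type).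
Variables (ra : M -> I -> M) (la : I -> N -> N).

Let free := {freeg (M * N)%type / k}.
Let gen (m : M) (n : N) : free := << (m, n) >>.

Inductive tens_rel : free -> Prop :=
| TensDl m m' n : tens_rel (gen (m + m') n - gen m n - gen m' n)
| TensDr m n n' : tens_rel (gen m (n + n') - gen m n - gen m n')
| TensZl c m n : tens_rel (gen (c *: m) n - c *: gen m n)
| TensZr c m n : tens_rel (gen m (c *: n) - c *: gen m n)
| TensBal m a n : tens_rel (gen (ra m a) n - gen m (la a n)).

Definition btens := {quot (lin_span tens_rel)}.
HB.instance Definition _ := GRing.Lmodule.on btens.

Definition bpure (m : M) (n : N) : btens := \pi_(btens) (gen m n).

(* The linear map with [bpure m n |-> f m n], for [f] bilinear and balanced:
   see [btlift_pure] and [btlift_linear]. *)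
Definition btlift (W : lmodType k) (f : M -> N -> W) (x : btens) : W :=
  fglift (fun p : M * N => f p.1 p.2) (repr x).

Definition bilinear_map (W : lmodType k) (f : M -> N -> W) :=
  (forall n, linear (f^~ n)) /\ (forall m, linear (f m)).

Section Lift.
Variables (W : lmodType k) (f : M -> N -> W).

Let F : free -> W := fglift (fun p : M * N => f p.1 p.2).

Let F_gen m n : F (gen m n) = f m n.
Proof. by rewrite /F liftU scale1r. Qed.

Let FB x y : F (x - y) = F x - F y.
Proof. exact: lift_is_additive. Qed.

Let F0 : F 0 = 0.
Proof. by rewrite -[X in F X](subrr 0) FB subrr. Qed.

Let FD x y : F (x + y) = F x + F y.
Proof.
have -> : x + y = x - (0 - y) by rewrite sub0r opprK.
by rewrite !FB F0 sub0r opprK.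
Qed.

Let F_sum (J : Type) (r : seq J) (h : J -> free) :
  F (\sum_(j <- r) h j) = \sum_(j <- r) F (h j).
Proof. exact: (big_morph F FD F0). Qed.

Let FZ c x : F (c *: x) = c *: F x.
Proof.
rewrite -{2}[x]freeg_sumE [c *: x]/(fgscale c x) /fgscale !F_sum scaler_sumr.
by apply: eq_bigr => p _; rewrite /F !liftU scalerA.
Qed.

Hypothesis f_lin : bilinear_map f.
Hypothesis f_bal : forall m a n, f (ra m a) n = f m (la a n).

Let f_lin_l c m m' n : f (c *: m + m') n = c *: f m n + f m' n.
Proof. by case: f_lin => + _ => ->. Qed.

Let f_lin_r c m n n' : f m (c *: n + n') = c *: f m n + f m n'.
Proof. by case: f_lin => _ ->. Qed.

Let f0l n : f 0 n = 0.
Proof.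
have := f_lin_l 1 0 0 n; rewrite !scale1r addr0 => /eqP.
by rewrite -subr_eq subrr eq_sym => /eqP.
Qed.

Let f0r m : f m 0 = 0.
Proof.
have := f_lin_r 1 m 0 0; rewrite !scale1r addr0 => /eqP.
by rewrite -subr_eq subrr eq_sym => /eqP.
Qed.

Let F_rel x : tens_rel x -> F x = 0.
Proof.
case=> *; rewrite !FB ?FZ !F_gen.
- by rewrite -[X in f (X + _)]scale1r f_lin_l scale1r -addrA -opprD subrr.
- by rewrite -[X in f _ (X + _)]scale1r f_lin_r scale1r -addrA -opprD subrr.
- by rewrite -[X in f X]addr0 f_lin_l f0l addr0 subrr.
- by rewrite -[X in f _ X]addr0 f_lin_r f0r addr0 subrr.
- by rewrite f_bal subrr.
Qed.

Let F_repr x : F (repr (\pi_btens x)) = F x.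
Proof.
apply/eqP; rewrite -subr_eq0 -FB; apply/eqP.
have : repr (\pi_btens x) - x \in lin_span tens_rel.
  by rewrite idealrBE reprK.
move=> /asboolP[s Ss ->]; rewrite F_sum big_seq big1 // => p /Ss/F_rel.
by rewrite FZ => ->; rewrite scaler0.
Qed.

Lemma btlift_pure m n : btlift f (bpure m n) = f m n.
Proof. exact: etrans (F_repr _) (F_gen m n). Qed.

Lemma btlift_linear : linear (btlift f).
Proof.
move=> c x y; elim/quotW: x => x; elim/quotW: y => y.
rewrite (_ : c *: \pi_btens x + \pi_btens y = \pi_btens (c *: x + y)).
  by rewrite /btlift -!/F !F_repr FD FZ.
by rewrite raddfD /=; congr (_ + _); exact: pi_scale.
Qed.
End Lift.

Let bpure0 x : tens_rel x -> \pi_btens x = 0.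
Proof.
move=> rx; rewrite -[RHS](raddf0 \pi_btens) /=; apply/eqP.
rewrite -idealrBE subr0; apply/asboolP; exists [:: (1, x)].
  by move=> p; rewrite inE => /eqP ->.
by rewrite big_seq1 scale1r.
Qed.

Let piB x y : \pi_btens (x - y) = \pi_btens x - \pi_btens y.
Proof. exact: raddfB. Qed.

Let piZ c x : \pi_btens (c *: x) = c *: \pi_btens x.
Proof. by symmetry; exact: pi_scale. Qed.

Lemma bpure_bilinear : bilinear_map bpure.
Proof.
split=> [n c m m' | m c n n'].
  have /bpure0/eqP := TensDl (c *: m) m' n.
  rewrite !piB -addrA -opprD subr_eq0 => /eqP.
  have /bpure0/eqP := TensZl c m n.
  by rewrite !piB piZ subr_eq0 => /eqP <-.
have /bpure0/eqP := TensDr m (c *: n) n'.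
rewrite !piB -addrA -opprD subr_eq0 => /eqP.
have /bpure0/eqP := TensZr c m n.
by rewrite !piB piZ subr_eq0 => /eqP <-.
Qed.

Lemma bpure_bal m a n : bpure (ra m a) n = bpure m (la a n).
Proof. by apply/eqP; rewrite -subr_eq0 -piB bpure0 //; exact: TensBal. Qed.

Lemma btens_sum (x : btens) :
  exists s : seq (M * N), x = \sum_(p <- s) bpure p.1 p.2.
Proof.
elim/quotW: x => x; exists [seq (coeff p x *: p.1, p.2) | p <- dom x].
rewrite big_map -{1}[x]freeg_sumE raddf_sum; apply: eq_bigr => -[m n] _ /=.
have := bpure_bilinear.1 n (coeff (m, n) x) m 0.
have -> : bpure 0 n = 0.
  have := bpure_bilinear.1 n 1 0 0; rewrite !scale1r addr0 => /eqP.
  by rewrite -subr_eq subrr eq_sym => /eqP.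
rewrite !addr0 => ->; rewrite -piZ; congr (\pi_btens _).
by apply/eqP/freeg_eqP => y; rewrite coeffZ !coeffU mul1r.
Qed.
End BalancedTensor.

Arguments bpure {k M N I} ra la m n.
Arguments btlift {k M N I ra la W} f x.

Definition rscale (k : fieldType) (U : lmodType k) (u : U) (c : k) : U := c *: u.

Notation "U ⊗ V" :=
  (@btens _ U V _ (@rscale _ U) (fun c (v : V) => c *: v))
  (at level 40, left associativity) : type_scope.

Definition tpure (k : fieldType) (U V : lmodType k) (u : U) (v : V) :
  (U ⊗ V)%type := bpure _ _ u v.
Notation "u ⊗ v" := (tpure u v) (at level 40, left associativity) : ring_scope.

Section TensorFacts.
Variables (k : fieldType) (U V : lmodType k).

Lemma tpureDl (u u' : U) (v : V) : (u + u') ⊗ v = u ⊗ v + u' ⊗ v.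
Proof.
have := (bpure_bilinear (@rscale k U) (fun c (w : V) => c *: w)).1 v 1 u u'.
by rewrite !scale1r.
Qed.

Lemma tpureDr (u : U) (v v' : V) : u ⊗ (v + v') = u ⊗ v + u ⊗ v'.
Proof.
have := (bpure_bilinear (@rscale k U) (fun c (w : V) => c *: w)).2 u 1 v v'.
by rewrite !scale1r.
Qed.

Lemma tpure0l (v : V) : (0 : U) ⊗ v = 0.
Proof. by apply: (@addIr _ ((0 : U) ⊗ v)); rewrite -tpureDl !add0r. Qed.

Lemma tpure0r (u : U) : u ⊗ (0 : V) = 0.
Proof. by apply: (@addIr _ (u ⊗ (0 : V))); rewrite -tpureDr !add0r. Qed.

Lemma tpureZl c (u : U) (v : V) : (c *: u) ⊗ v = c *: (u ⊗ v).
Proof.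
have := (bpure_bilinear (@rscale k U) (fun c (w : V) => c *: w)).1 v c u 0.
by rewrite !addr0 -/(tpure 0 v) tpure0l addr0.
Qed.

Lemma tpureZr c (u : U) (v : V) : u ⊗ (c *: v) = c *: (u ⊗ v).
Proof.
have := (bpure_bilinear (@rscale k U) (fun c (w : V) => c *: w)).2 u c v 0.
by rewrite !addr0 -/(tpure u 0) tpure0r addr0.
Qed.

Lemma btlift_tpure (W : lmodType k) (f : U -> V -> W) u v :
  bilinear_map f -> btlift f (u ⊗ v) = f u v.
Proof.
move=> fl; apply: btlift_pure => // w c w'; rewrite /rscale.
have := fl.1 w' c w 0; have := fl.2 w c w' 0; rewrite !addr0 => -> ->.
have f0l : f 0 w' = 0.
  by have /eqP := fl.1 w' 1 0 0; rewrite !scale1r addr0 -subr_eq subrr eq_sym => /eqP.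
have f0r : f w 0 = 0.
  by have /eqP := fl.2 w 1 0 0; rewrite !scale1r addr0 -subr_eq subrr eq_sym => /eqP.
by rewrite f0l f0r.
Qed.

Lemma btlift_tlinear (W : lmodType k) (f : U -> V -> W) :
  bilinear_map f -> linear (btlift f : (U ⊗ V)%type -> W).
Proof.
move=> fl; apply: btlift_linear => // w c w'; rewrite /rscale.
have := fl.1 w' c w 0; have := fl.2 w c w' 0; rewrite !addr0 => -> ->.
have f0l : f 0 w' = 0.
  by have /eqP := fl.1 w' 1 0 0; rewrite !scale1r addr0 -subr_eq subrr eq_sym => /eqP.
have f0r : f w 0 = 0.
  by have /eqP := fl.2 w 1 0 0; rewrite !scale1r addr0 -subr_eq subrr eq_sym => /eqP.
by rewrite f0l f0r.
Qed.

Lemma tens_sum (x : (U ⊗ V)%type) :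
  exists s : seq (U * V), x = \sum_(p <- s) p.1 ⊗ p.2.
Proof. exact: btens_sum. Qed.

Lemma btlift_tsum (W : lmodType k) (f : U -> V -> W) (I : Type) (s : seq I)
    (u : I -> U) (v : I -> V) : bilinear_map f ->
  btlift f (\sum_(i <- s) u i ⊗ v i : (U ⊗ V)%type) = \sum_(i <- s) f (u i) (v i).
Proof.
move=> fl; have lf := btlift_tlinear fl.
have f0 : btlift f (0 : (U ⊗ V)%type) = 0.
  by have /eqP := lf 1 0 0; rewrite !scale1r addr0 -subr_eq subrr eq_sym => /eqP.
elim: s => [|i s IHs]; first by rewrite !big_nil.
by rewrite !big_cons -[X in X + _]scale1r lf scale1r btlift_tpure ?IHs.
Qed.

(* Every tensor is a finite sum with linearly independent left factors. *)
Lemma tens_free_sum (x : (U ⊗ V)%type) :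
  exists m, exists u : 'I_m -> U, exists2 v : 'I_m -> V,
    x = \sum_i u i ⊗ v i &
    forall c : 'I_m -> k, \sum_i c i *: u i = 0 -> forall i, c i = 0.
Proof.
have [s xE] := tens_sum x.
have : exists u : 'I_(size s) -> U, exists v : 'I_(size s) -> V,
    x = \sum_i u i ⊗ v i.
  exists (fun i => (tnth (in_tuple s) i).1), (fun i => (tnth (in_tuple s) i).2).
  by rewrite xE big_tnth.
move: (size s) => m; clear s xE; elim: m => [|m IHm] [u [v xE]].
  by exists 0, u, v => // c _ [].
have [fr|] := pselect (forall c : 'I_m.+1 -> k,
    \sum_i c i *: u i = 0 -> forall i, c i = 0); first by exists m.+1, u, v.
move/existsNP => [c /not_implyP[c0 /existsNP[j /eqP cj]]]; apply: IHm.
exists (fun i => u (fintype.lift j i)).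
exists (fun i => v (fintype.lift j i) - (c (fintype.lift j i) / c j) *: v j).
have -> : x = u j ⊗ v j + \sum_i u (fintype.lift j i) ⊗ v (fintype.lift j i).
  by rewrite xE (bigD1_ord j).
have -> : u j = - \sum_i (c (fintype.lift j i) / c j) *: u (fintype.lift j i).
  move: c0; rewrite (bigD1_ord j) //= => /eqP; rewrite addr_eq0 => /eqP c0.
  rewrite -[u j](scalerK cj) c0 scalerN scaler_sumr; congr (- _).
  by apply: eq_bigr => i _; rewrite scalerA mulrC.
have -> : (- \sum_i (c (fintype.lift j i) / c j) *: u (fintype.lift j i)) ⊗ v j
   = - \sum_i (c (fintype.lift j i) / c j) *: (u (fintype.lift j i) ⊗ v j).
  rewrite -scaleN1r tpureZl scaleN1r; congr (- _).
  rewrite (big_morph (fun y => y ⊗ v j) (fun y z => tpureDl y z (v j)) (tpure0l _)).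
  by apply: eq_bigr => i _; rewrite tpureZl.
rewrite addrC -sumrN -big_split; apply: eq_bigr => i _ /=.
by rewrite tpureDr -!scaleNr tpureZr.
Qed.
End TensorFacts.

(* The operations of a Hopf algebra that enter the definitions below. The
   axioms are not part of the record: they hold for [OG], and for the cocycle
   deformation they are theorems. The antipode is determined by these data. *)
Record hopf (k : fieldType) := Hopf {
  hcar :> lmodType k;
  hmul : hcar -> hcar -> hcar;
  hone : hcar;
  hcop : hcar -> (hcar ⊗ hcar)%type;
  hcounit : hcar -> k }.
Arguments hmul {k h}.
Arguments hone {k h}.
Arguments hcop {k h}.
Arguments hcounit {k h}.

(* [sweedler a F] is $F(a_{(1)}, a_{(2)})$ and [sweedler3 a F] is
   $F(a_{(1)}, a_{(2)}, a_{(3)})$. *)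
Definition sweedler (k : fieldType) (A : hopf k) (W : lmodType k) (a : A)
  (F : A -> A -> W) : W := btlift F (hcop a).
Definition sweedler3 (k : fieldType) (A : hopf k) (W : lmodType k) (a : A)
  (F : A -> A -> A -> W) : W :=
  sweedler a (fun a1 a' => sweedler a' (fun a2 a3 => F a1 a2 a3)).

Section LinearAlgebraicGroup.
Variables (k : fieldType) (n : nat).

Inductive polynomial_fun : ('M[k]_n -> k) -> Prop :=
| PolyCst c : polynomial_fun (fun=> c)
| PolyCoord i j : polynomial_fun (fun x => x i j)
| PolyAdd p q : polynomial_fun p -> polynomial_fun q ->
    polynomial_fun (fun x => p x + q x)
| PolyMul p q : polynomial_fun p -> polynomial_fun q ->
    polynomial_fun (fun x => p x * q x).

Record linear_algebraic_group := LinearAlgebraicGroup {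
  lag_pts :> set 'M[k]_n;
  lag_closed : exists2 S : set ('M[k]_n -> k),
    (forall p, S p -> polynomial_fun p) &
    lag_pts = [set x | x \in unitmx /\ forall p, S p -> p x = 0]%classic;
  lag_one : lag_pts 1%:M;
  lag_mulP : forall x y, lag_pts x -> lag_pts y -> lag_pts (x *m y);
  lag_invP : forall x, lag_pts x -> lag_pts (invmx x) }.

Variable G : linear_algebraic_group.

Definition lag_pt := {x : 'M[k]_n | `[< lag_pts G x >]}.
Coercion lag_val (x : lag_pt) : 'M[k]_n := val x.

Definition lag_e : lag_pt := Sub 1%:M (asboolT (lag_one G)).
Definition lag_mul (x y : lag_pt) : lag_pt :=
  Sub (val x *m val y) (asboolT (lag_mulP (asboolW (valP x)) (asboolW (valP y)))).

(* The restrictions to G of the elements of k[x_ij, 1/det]. *)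
Inductive regular_fun : (lag_pt -> k^o) -> Prop :=
| RegCst c : regular_fun (fun=> c)
| RegCoord i j : regular_fun (fun x => lag_val x i j)
| RegDetV : regular_fun (fun x => (\det (lag_val x))^-1)
| RegAdd f h : regular_fun f -> regular_fun h -> regular_fun (f + h)
| RegMul f h : regular_fun f -> regular_fun h ->
    regular_fun (fun x => f x * h x).

Definition regular_funb : {pred (lag_pt -> k^o)} := fun f => `[< regular_fun f >].

Lemma regular_fun_closed : submod_closed regular_funb.
Proof.
split=> [|c f h /asboolP rf /asboolP rh]; apply/asboolP; first exact: RegCst.
exact/RegAdd/rh/(RegMul (RegCst c) rf).
Qed.
HB.instance Definition _ := GRing.isSubmodClosed.Build k (lag_pt -> k^o)
  regular_funb regular_fun_closed.

Record regular := Regular { regular_val :> lag_pt -> k^o;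
  regularP : regular_val \in regular_funb }.
HB.instance Definition _ := [isSub for regular_val].
HB.instance Definition _ := [Choice of regular by <:].
HB.instance Definition _ := [SubChoice_isSubLmodule of regular by <:].

Lemma regular_fun_mul (f h : regular) :
  (fun x => regular_val f x * regular_val h x) \in regular_funb.
Proof. by apply/asboolP/RegMul; apply/asboolP/regularP. Qed.
Definition regular_mul (f h : regular) : regular := Regular (regular_fun_mul f h).

Lemma regular_fun_one : (fun=> 1) \in regular_funb.
Proof. exact/asboolP/RegCst. Qed.
Definition regular_one : regular := Regular regular_fun_one.

(* The function on G x G defined by an element of O(G) ⊗ O(G). *)
Definition regular2 (t : (regular ⊗ regular)%type) (x y : lag_pt) : k^o :=
  btlift (fun f h : regular => regular_val f x * regular_val h y : k^o) t.

(* The unique such tensor: see [regular2_inj] and [regular_copE]. *)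
Definition regular_cop (f : regular) : (regular ⊗ regular)%type :=
  xget 0 [set t | forall x y, regular2 t x y = f (lag_mul x y)]%classic.

Definition OG : hopf k :=
  Hopf regular_mul regular_one regular_cop (fun f => f lag_e).
End LinearAlgebraicGroup.

Section RegularFacts.
Variables (k : fieldType) (n : nat) (G : linear_algebraic_group k n).
Local Notation O := (regular G).
Implicit Types (f h : O) (x y : lag_pt G) (t : (O ⊗ O)%type).

Lemma regular_val_linear c f h x : (c *: f + h : O) x = c * f x + h x.
Proof. by []. Qed.

Lemma regular_ext f h : (forall x, f x = h x) -> f = h.
Proof. by move=> fh; apply/val_inj/funext. Qed.

Lemma eval2_bilinear x y :
  bilinear_map (fun f h => f x * h y : k^o).
Proof.
split=> [h|f] c u v; rewrite regular_val_linear; first by rewrite mulrDl -mulrA.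
by rewrite mulrDr mulrCA.
Qed.

Lemma regular2_linear c t t' x y :
  regular2 (c *: t + t') x y = c * regular2 t x y + regular2 t' x y.
Proof. exact: (btlift_tlinear (eval2_bilinear x y)). Qed.

Lemma regular2_sum (I : Type) (s : seq I) (u v : I -> O) x y :
  regular2 (\sum_(i <- s) u i ⊗ v i) x y = \sum_(i <- s) u i x * v i y.
Proof. exact: (btlift_tsum _ _ _ (eval2_bilinear x y)). Qed.

Lemma regular2_inj t t' : (forall x y, regular2 t x y = regular2 t' x y) -> t = t'.
Proof.
move=> tt'; apply/eqP; rewrite -subr_eq0; apply/eqP.
have {tt'} : forall x y, regular2 (t - t') x y = 0.
  by move=> x y; rewrite addrC -scaleN1r regular2_linear tt' mulN1r addNr.
have [m [u [v -> fr]]] := tens_free_sum (t - t'); move=> t0.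
apply: big1 => i _; suff -> : v i = 0 by rewrite tpure0r.
apply: regular_ext => y; apply: (fr (fun i => v i y)).
apply: regular_ext => x; have := t0 x y; rewrite regular2_sum => E.
rewrite -[RHS]E; elim/big_rec2: _ => // j a b _ <-.
by rewrite regular_val_linear mulrC.
Qed.

Lemma regular_cop_ex (f : O) :
  exists t, forall x y, regular2 t x y = f (lag_mul x y).
Proof.
have mkreg (F : lag_pt G -> k^o) (rF : regular_fun F) :
  { h : O | regular_val h = F } by exists (Regular (asboolT rF)).
suff : exists s : seq (O * O), forall x y,
    \sum_(p <- s) p.1 x * p.2 y = f (lag_mul x y).
  by case=> s sE; exists (\sum_(p <- s) p.1 ⊗ p.2) => x y; rewrite regular2_sum.
case: f => F /= /asboolP; elim=> {F} [c|i j||F H _ [s sE] _ [t tE]|F H _ [s sE] _ [t tE]].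
- have [h hE] := mkreg _ (RegCst G c).
  exists [:: (h, regular_one G)] => x y.
  by rewrite big_seq1 hE /= mulr1.
- have h1 l := mkreg _ (RegCoord G i l); have h2 l := mkreg _ (RegCoord G l j).
  exists [seq (sval (h1 l), sval (h2 l)) | l <- index_enum 'I_n] => x y.
  rewrite big_map [RHS]mxE; apply: eq_bigr => l _ /=.
  by rewrite (svalP (h1 l)) (svalP (h2 l)).
- have [h hE] := mkreg _ (RegDetV G).
  by exists [:: (h, h)] => x y; rewrite big_seq1 /= hE det_mulmx invfM.
- by exists (s ++ t) => x y; rewrite big_cat /= sE tE.
- exists [seq (regular_mul p.1 q.1, regular_mul p.2 q.2) | p <- s, q <- t] => x y.
  rewrite big_allpairs_dep -sE -tE mulr_suml; apply: eq_bigr => p _.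
  rewrite mulr_sumr; apply: eq_bigr => q _ /=.
  by rewrite mulrACA.
Qed.

Lemma regular_copE f x y : regular2 (regular_cop f) x y = f (lag_mul x y).
Proof. by have /xgetPex := regular_cop_ex f; apply. Qed.
End RegularFacts.

Section RestrictedDual.
Variables (k : fieldType) (A : hopf k).

(* The linear functionals f with Δ(f) in A' ⊗ A', where Δ(f)(a ⊗ b) = f(ab). *)
Definition in_rdual (f : A -> k^o) : Prop :=
  linear f /\
  exists2 s : seq ((A -> k^o) * (A -> k^o)),
    forall p, p \in s -> linear p.1 /\ linear p.2 &
    forall a b, f (hmul a b) = \sum_(p <- s) p.1 a * p.2 b.

Definition rdual_pred : {pred (A -> k^o)} := fun f => `[< in_rdual f >].

Lemma rdual_closed : submod_closed rdual_pred.
Proof.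
split=> [|c f h /asboolP[lf [s ls fE]] /asboolP[lh [t lt hE]]]; apply/asboolP.
  split=> [c a b|]; first by rewrite scaler0 addr0.
  by exists [::] => // a b; rewrite big_nil.
split=> [d a b|].
  rewrite !fctE lf lh !scalerDr !scalerA [d * c]mulrC addrACA.
  by congr (_ + _ + _).
exists ([seq (c *: p.1, p.2) | p <- s] ++ t) => [p|a b].
  rewrite mem_cat => /orP[/mapP[q /ls[lq1 lq2] ->]|/lt//]; split=> // d a b.
  by rewrite /= !fctE lq1 scalerDr !scalerA mulrC.
rewrite !fctE fE hE big_cat big_map scaler_sumr; congr (_ + _).
by apply: eq_bigr => p _; rewrite /= fctE [LHS]mulrA.
Qed.
HB.instance Definition _ := GRing.isSubmodClosed.Build k (A -> k^o)
  rdual_pred rdual_closed.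

Record rdual := RDual { rdual_val :> A -> k^o; rdualP : rdual_val \in rdual_pred }.
HB.instance Definition _ := [isSub for rdual_val].
HB.instance Definition _ := [Choice of rdual by <:].
HB.instance Definition _ := [SubChoice_isSubLmodule of rdual by <:].

(* For A = O(G) the default 0 is not reached below: see [rdual_mulE] and
   [rdual_oneE]. *)
Definition mk_rdual (f : A -> k^o) : rdual := insubd 0 f.

Definition rdual_mul (f h : rdual) : rdual :=
  mk_rdual (fun a => sweedler a (fun a1 a2 => rdual_val f a1 * rdual_val h a2 : k^o)).
Definition rdual_one : rdual := mk_rdual hcounit.

Definition pairing2 (t : (rdual ⊗ rdual)%type) (a b : A) : k^o :=
  btlift (fun f h : rdual => rdual_val f a * rdual_val h b : k^o) t.

(* The transpose of the product: see [rdual_copE]. *)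
Definition rdual_cop (f : rdual) : (rdual ⊗ rdual)%type :=
  xget 0 [set t | forall a b, pairing2 t a b = f (hmul a b)]%classic.

Definition rdual_hopf : hopf k :=
  Hopf rdual_mul rdual_one rdual_cop (fun f => f hone).
End RestrictedDual.

Section RegularDualFacts.
Variables (k : fieldType) (n : nat) (G : linear_algebraic_group k n).
Local Notation A := (OG G).
Implicit Types (a b : A) (s t : seq (A * A)).

Let rep a s := forall x y, \sum_(p <- s) regular_val p.1 x * regular_val p.2 y
  = regular_val a (lag_mul x y).

Lemma rep_ex a : exists s, rep a s.
Proof.
have [s sE] := tens_sum (hcop a); exists s => x y.
by rewrite -regular2_sum -sE regular_copE.
Qed.

Lemma sweedler_rep (W : lmodType k) a s (F : A -> A -> W) :
  bilinear_map F -> rep a s -> sweedler a F = \sum_(p <- s) F p.1 p.2.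
Proof.
move=> lF sE; rewrite -(btlift_tsum _ _ _ lF); congr (btlift _ _).
by apply: regular2_inj => x y; rewrite regular_copE regular2_sum sE.
Qed.

Lemma rep_linear c a b s t : rep a s -> rep b t ->
  rep (c *: a + b) ([seq (c *: p.1, p.2) | p <- s] ++ t).
Proof.
move=> sE tE x y; rewrite (regular_val_linear c a b) big_cat big_map tE -sE.
rewrite mulr_sumr; congr (_ + _).
by apply: eq_bigr => p _; rewrite mulrA.
Qed.

Lemma rep_mul a b s t : rep a s -> rep b t ->
  rep (hmul a b) [seq (hmul p.1 q.1, hmul p.2 q.2) | p <- s, q <- t].
Proof.
move=> sE tE x y; rewrite big_allpairs_dep /= -sE -tE mulr_suml.
apply: eq_bigr => p _; rewrite mulr_sumr; apply: eq_bigr => q _ /=.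
by rewrite mulrACA.
Qed.

Let conv (f h : A -> k^o) a : k^o := sweedler a (fun a1 a2 => f a1 * h a2 : k^o).

Let conv_bil (f h : A -> k^o) : linear f -> linear h ->
  bilinear_map (fun a1 a2 => f a1 * h a2 : k^o).
Proof.
by move=> lf lh; split=> [u|u] c v w; rewrite (lf, lh) ?mulrDl ?mulrDr;
  congr (_ + _); rewrite -?[c *: _]/(c * _) -?mulrA // mulrCA.
Qed.

Let conv_linear (f h : A -> k^o) : linear f -> linear h -> linear (conv f h).
Proof.
move=> lf lh c a b; have [s sE] := rep_ex a; have [t tE] := rep_ex b.
have bl := conv_bil lf lh.
rewrite /conv (sweedler_rep bl (rep_linear c sE tE)) (sweedler_rep bl sE).
rewrite (sweedler_rep bl tE) big_cat big_map scaler_sumr; congr (_ + _).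
apply: eq_bigr => p _ /=; have := bl.1 p.2 c p.1 0; rewrite addr0 => ->.
by have /eqP := bl.1 p.2 1 0 0; rewrite !scale1r addr0 -subr_eq subrr
  => /eqP <-; rewrite addr0.
Qed.

Lemma rdual_mulE (f h : rdual A) a : rdual_mul f h a =
  sweedler a (fun a1 a2 => rdual_val f a1 * rdual_val h a2 : k^o).
Proof.
rewrite /rdual_mul /mk_rdual insubdK //; apply/asboolP.
have /asboolP[lf [s ls fE]] := rdualP f.
have /asboolP[lh [t lt hE]] := rdualP h.
split; first exact: conv_linear.
exists [seq (conv p.1 q.1, conv p.2 q.2) | p <- s, q <- t] => [p|b c].
  move=> /allpairsP[[q r] /= [/ls[? ?] /lt[? ?] ->]] /=.
  by split; exact: conv_linear.
have [u uE] := rep_ex b; have [v vE] := rep_ex c.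
have bl := conv_bil lf lh.
rewrite (sweedler_rep bl (rep_mul uE vE)) !big_allpairs_dep /=.
transitivity (\sum_(p <- u) \sum_(q <- v) \sum_(i <- s) \sum_(j <- t)
  (i.1 p.1 * i.2 q.1) * (j.1 p.2 * j.2 q.2)).
  apply: eq_bigr => p _; apply: eq_bigr => q _; rewrite fE hE mulr_suml.
  by apply: eq_bigr => i _; rewrite mulr_sumr.
apply: etrans; first by apply: eq_bigr => p _; exact: exchange_big.
apply: etrans; first exact: exchange_big.
apply: eq_big_seq => i /ls[l1 l2] /=.
apply: etrans; first by apply: eq_bigr => p _; exact: exchange_big.
apply: etrans; first exact: exchange_big.
apply: eq_big_seq => j /lt[l3 l4].
rewrite /conv (sweedler_rep (conv_bil l1 l3) uE) (sweedler_rep (conv_bil l2 l4) vE).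
rewrite mulr_suml; apply: eq_bigr => p _; rewrite mulr_sumr.
by apply: eq_bigr => q _; rewrite mulrACA.
Qed.

Lemma rdual_oneE a : rdual_one A a = hcounit a.
Proof.
rewrite /rdual_one /mk_rdual insubdK //; apply/asboolP; split=> //.
exists [:: (hcounit, hcounit)] => [p|b c]; last by rewrite big_seq1.
by rewrite inE => /eqP ->; split.
Qed.


Lemma rdual_cop_ex (f : rdual A) :
  exists z, forall a b, pairing2 z a b = f (hmul a b).
Proof.
have /asboolP[lf [s ls fE]] := rdualP f.
pose T b : A -> k^o := fun a => rdual_val f (hmul a b).
have mulA a b c : hmul (hmul a b) c = hmul a (hmul b c) :> A.
  by apply: regular_ext => x; rewrite /= mulrA.
have mullin_l b : linear (fun a : A => hmul a b : A).
  by move=> c a a'; apply: regular_ext => x; rewrite /= mulrDl -mulrA.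
have mullin_r a : linear (fun b : A => hmul a b : A).
  by move=> c b b'; apply: regular_ext => x; rewrite /= mulrDr mulrCA.
have Tlin b : linear (T b) by move=> c a a'; rewrite /T mullin_l lf.
pose fr r (b : 'I_r -> A) := forall c : 'I_r -> k,
  (forall a, \sum_i c i * T (b i) a = 0) -> forall i, c i = 0.
have exP : exists r, `[< exists b : 'I_r -> A, fr r b >].
  by exists 0; apply/asboolP; exists (fun=> 0) => c _ [].
have ubP r : `[< exists b : 'I_r -> A, fr r b >] -> (r <= size s)%N.
  move=> /asboolP[b frb]; rewrite leqNgt; apply/negP => ltr.
  pose M : 'M[k]_(r, size s) := \matrix_(i, j) (tnth (in_tuple s) j).2 (b i).
  have : kermx M != 0.
    rewrite -mxrank_eq0 mxrank_ker subn_eq0 -ltnNge.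
    exact: leq_ltn_trans (rank_leq_col M) ltr.
  move=> /rowV0Pn[c /sub_kermxP cM /negP]; apply; apply/eqP/rowP => i.
  rewrite mxE; apply: (frb (fun i => c 0 i)) => a.
  rewrite /T; under eq_bigr => l _ do rewrite fE big_tnth mulr_sumr.
  rewrite exchange_big big1 //= => j _.
  have /matrixP/(_ 0 j) := cM; rewrite !mxE => cMj.
  transitivity ((tnth (in_tuple s) j).1 a * \sum_l c 0 l * M l j).
    by rewrite mulr_sumr; apply: eq_bigr => l _; rewrite mxE mulrCA.
  by rewrite cMj mulr0.
have [r /asboolP[b frb] maxr] := ex_maxnP exP ubP.
have /choice[v vE] : forall c, exists v : 'I_r -> k, forall a,
    T c a = \sum_i v i * T (b i) a.
  move=> c; apply: contrapT => nv.
  suff : (r.+1 <= r)%N by rewrite ltnn.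
  apply: maxr; apply/asboolP.
  exists (fun i => if unlift ord0 i is Some j then b j else c) => d d0.
  have {}d0 a : d ord0 * T c a + \sum_i d (fintype.lift ord0 i) * T (b i) a = 0.
    rewrite -[RHS](d0 a) big_ord_recl unlift_none; congr (_ + _).
    by apply: eq_bigr => i _; rewrite liftK.
  have [d00|dn0] := eqVneq (d ord0) 0.
    have := frb (fun i => d (fintype.lift ord0 i)).
    move=> E i; case: (unliftP ord0 i) => [j ->|->//]; apply: E => a.
    by rewrite -[RHS](d0 a) d00 mul0r add0r.
  case: nv; exists (fun i => - (d ord0)^-1 * d (fintype.lift ord0 i)) => a.
  have /eqP := d0 a; rewrite addr_eq0 => /eqP E.
  rewrite -[LHS](mulKf dn0) E mulrN -mulNr mulr_sumr.
  by apply: eq_bigr => i _; rewrite mulrA.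
have vU (c c' : 'I_r -> k) :
    (forall a, \sum_i c i * T (b i) a = \sum_i c' i * T (b i) a) -> c =1 c'.
  move=> cc' i; apply/eqP; rewrite -subr_eq0; apply/eqP.
  apply: (frb (fun i => c i - c' i)) => a.
  by under eq_bigr => j _ do rewrite mulrBl; rewrite sumrB cc' subrr.
have vlin i : linear (fun c => v c i : k^o).
  move=> e c c'; rewrite -[RHS]/(e * v c i + v c' i).
  apply: (vU _ (fun i => e * v c i + v c' i)) => a.
  rewrite -vE /T mullin_r lf -/(T c a) -/(T c' a) !vE -[e *: _]/(e * _) mulr_sumr -big_split.
  by apply: eq_bigr => j _; rewrite /= mulrDl mulrA.
have vM c c' i : v (hmul c c') i = \sum_j v (hmul c (b j)) i * v c' j.
  apply: (vU _ (fun i => \sum_j v (hmul c (b j)) i * v c' j)) => a.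
  rewrite -vE {1}/T -mulA -/(T c' _) vE.
  under [RHS]eq_bigr => l _ do rewrite mulr_suml.
  rewrite exchange_big /=; apply: eq_bigr => j _.
  rewrite /T mulA -/(T _ a) vE mulr_sumr.
  by apply: eq_bigr => l _; rewrite mulrA [v c' j * _]mulrC.
have vR i : in_rdual (fun c => v c i : k^o).
  split; first exact: vlin.
  exists [seq ((fun c => v (hmul c (b j)) i : k^o), (fun c => v c j : k^o))
    | j <- index_enum 'I_r] => [p /mapP[j _ ->]|c c'] /=.
    split=> [e x y|]; last exact: vlin.
    exact: etrans (congr1 (v^~ i) (mullin_l (b j) e x y)) (vlin i e _ _).
  by rewrite big_map vM.
have TR i : in_rdual (T (b i)).
  split=> //; exists [seq (T (b j), (fun c => v (hmul c (b i)) j : k^o))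
    | j <- index_enum 'I_r] => [p /mapP[j _ ->]|c c'] /=.
    split=> [|e x y]; first exact: Tlin.
    exact: etrans (congr1 (v^~ j) (mullin_l (b i) e x y)) (vlin j e _ _).
  rewrite big_map /T mulA -/(T _ c) vE.
  by apply: eq_bigr => j _; rewrite mulrC.
exists (\sum_i RDual (asboolT (TR i)) ⊗ RDual (asboolT (vR i))) => a c.
rewrite /pairing2 btlift_tsum; last first.
  split=> [u|u] e x y.
    by rewrite -[rdual_val (e *: x + y) a]/(e * rdual_val x a + rdual_val y a)
      mulrDl -mulrA.
  by rewrite -[rdual_val (e *: x + y) c]/(e * rdual_val x c + rdual_val y c)
    mulrDr mulrCA.
by rewrite -/(T c a) vE; apply: eq_bigr => i _; rewrite /= mulrC.
Qed.

Lemma rdual_copE (f : rdual A) a b :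
  pairing2 (rdual_cop f) a b = f (hmul a b).
Proof. by have /xgetPex := rdual_cop_ex f; apply. Qed.
End RegularDualFacts.

(* The product of U ⊗ V, for products mU and mV on U and V. *)
Definition tens_mul (k : fieldType) (U V : lmodType k) (mU : U -> U -> U)
  (mV : V -> V -> V) (x y : (U ⊗ V)%type) : (U ⊗ V)%type :=
  btlift (fun u v => btlift (fun u' v' => mU u u' ⊗ mV v v') y) x.

Section DualCocycle.
Variables (k : fieldType) (A : hopf k).
Local Notation D := (rdual_hopf A).

Definition mul2 : (D ⊗ D)%type -> (D ⊗ D)%type -> (D ⊗ D)%type :=
  tens_mul (@hmul _ D) (@hmul _ D).
Definition mul3 : (D ⊗ (D ⊗ D))%type -> (D ⊗ (D ⊗ D))%type -> (D ⊗ (D ⊗ D))%type :=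
  tens_mul (@hmul _ D) mul2.

Record dual_cocycle := DualCocycle {
  dc_val :> (D ⊗ D)%type;
  dc_inv : (D ⊗ D)%type;
  dc_mulV : mul2 dc_val dc_inv = hone ⊗ hone;
  dc_mulVl : mul2 dc_inv dc_val = hone ⊗ hone;
  dc_unitl : btlift (fun h c : D => hcounit h *: c) dc_val = hone;
  dc_unitr : btlift (fun h c : D => hcounit c *: h) dc_val = hone;
  dc_cocycle :
    mul3 (btlift (fun h c : D => h ⊗ (c ⊗ hone)) dc_val)
         (btlift (fun h c : D => sweedler h (fun h1 h2 => h1 ⊗ (h2 ⊗ c))) dc_val)
    = mul3 (hone ⊗ dc_val)
           (btlift (fun h c : D => h ⊗ hcop c) dc_val) }.

Variable Om : dual_cocycle.

Definition cocycle (a b : A) : k := pairing2 (dc_val Om) a b.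
Definition cocycleV (a b : A) : k := pairing2 (dc_inv Om) a b.

Definition twist_mul (a b : A) : A :=
  sweedler3 a (fun a1 a2 a3 => sweedler3 b (fun b1 b2 b3 =>
    (cocycle a1 b1 * cocycleV a3 b3) *: hmul a2 b2)).

Definition twist_hopf : hopf k :=
  Hopf twist_mul hone (@hcop _ A) hcounit.
End DualCocycle.

Section Bimodules.
Variables (k : fieldType) (A : hopf k).

(* Operations only; the axioms are [is_bimodule], ..., [is_bicovariant]. *)
Record bimod := Bimod {
  mcar :> lmodType k;
  lact : A -> mcar -> mcar;
  ract : mcar -> A -> mcar;
  lcoact : {linear mcar -> (A ⊗ mcar)%type};
  rcoact : {linear mcar -> (mcar ⊗ A)%type} }.

Definition is_left_module (N : lmodType k) (la : A -> N -> N) : Prop :=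
  [/\ bilinear_map la,
      forall m, la hone m = m &
      forall a b m, la a (la b m) = la (hmul a b) m].

Definition is_bimodule (M : bimod) : Prop :=
  [/\ is_left_module (@lact M), bilinear_map (@ract M),
      forall m, ract m hone = m :> M,
      forall m a b, ract (ract m a) b = ract m (hmul a b) :> M &
      forall a m b, lact a (ract m b) = ract (lact a m) b :> M].

Definition is_left_comodule (M : bimod) : Prop :=
  (forall m : M, btlift (fun a m' => hcounit a *: m') (lcoact M m) = m) /\
  (forall m : M,
     btlift (fun a m' => sweedler a (fun a1 a2 => a1 ⊗ (a2 ⊗ m'))) (lcoact M m)
     = btlift (fun a m' => a ⊗ lcoact M m') (lcoact M m)).

Definition is_right_comodule (M : bimod) : Prop :=
  (forall m : M, btlift (fun m' a => hcounit a *: m') (rcoact M m) = m) /\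
  (forall m : M,
     btlift (fun m' a => sweedler a (fun a1 a2 => (m' ⊗ a1) ⊗ a2)) (rcoact M m)
     = btlift (fun m' a => rcoact M m' ⊗ a) (rcoact M m)).

Definition is_left_covariant (M : bimod) : Prop :=
  [/\ is_left_comodule M,
      forall a m, lcoact M (lact a m) = sweedler a (fun a1 a2 =>
        btlift (fun b m' => hmul a1 b ⊗ lact a2 m') (lcoact M m)) &
      forall m a, lcoact M (ract m a) = sweedler a (fun a1 a2 =>
        btlift (fun b m' => hmul b a1 ⊗ ract m' a2) (lcoact M m))].

Definition is_right_covariant (M : bimod) : Prop :=
  [/\ is_right_comodule M,
      forall a m, rcoact M (lact a m) = sweedler a (fun a1 a2 =>
        btlift (fun m' b => lact a1 m' ⊗ hmul a2 b) (rcoact M m)) &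
      forall m a, rcoact M (ract m a) = sweedler a (fun a1 a2 =>
        btlift (fun m' b => ract m' a1 ⊗ hmul b a2) (rcoact M m))].

Definition is_bicovariant (M : bimod) : Prop :=
  [/\ is_bimodule M, is_left_covariant M, is_right_covariant M &
      forall m : M, btlift (fun a m' => a ⊗ rcoact M m') (lcoact M m)
        = btlift (fun m' b => btlift (fun a m'' => a ⊗ (m'' ⊗ b)) (lcoact M m'))
            (rcoact M m)].

Record calculus := Calculus { ccar :> bimod; dif : {linear A -> ccar} }.

Definition is_first_order_calculus (E : calculus) : Prop :=
  [/\ is_bimodule E,
      forall a b, dif E (hmul a b) = lact a (dif E b) + ract (dif E a) b &
      forall e : E, exists s : seq (A * A),
        e = \sum_(p <- s) lact p.1 (dif E p.2)].

Definition is_bicovariant_calculus (E : calculus) : Prop :=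
  [/\ is_first_order_calculus E, is_bicovariant E,
      forall a, lcoact E (dif E a) = sweedler a (fun a1 a2 => a1 ⊗ dif E a2) &
      forall a, rcoact E (dif E a) = sweedler a (fun a1 a2 => dif E a1 ⊗ a2)].

(* For commutative A: the module of Kähler differentials, given by its
   universal property, with its bicovariant structure. *)
Definition is_classical_calculus (E : calculus) : Prop :=
  [/\ is_bicovariant_calculus E,
      forall (a : A) (e : E), ract e a = lact a e &
      forall (N : lmodType k) (la : A -> N -> N) (D : A -> N),
        is_left_module la -> linear D ->
        (forall a b, D (hmul a b) = la a (D b) + la b (D a)) ->
        exists! phi : E -> N, [/\ linear phi,
          forall a e, phi (lact a e) = la a (phi e) &
          forall a, phi (dif E a) = D a]].
End Bimodules.

Section TwistBimodule.
Variables (k : fieldType) (A : hopf k) (Om : dual_cocycle A).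

(* [bisweedler m F] is $F(m_{(-1)}, m_{(0)}, m_{(1)})$. *)
Definition bisweedler (M : bimod A) (W : lmodType k) (m : M)
  (F : A -> M -> A -> W) : W :=
  btlift (fun a m' => btlift (fun m0 b => F a m0 b) (rcoact M m')) (lcoact M m).

Variable M : bimod A.

Definition twist_lact (a : A) (m : M) : M :=
  sweedler3 a (fun a1 a2 a3 => bisweedler m (fun b1 m0 b2 =>
    (cocycle Om a1 b1 * cocycleV Om a3 b2) *: lact a2 m0)).

Definition twist_ract (m : M) (a : A) : M :=
  sweedler3 a (fun a1 a2 a3 => bisweedler m (fun b1 m0 b2 =>
    (cocycle Om b1 a1 * cocycleV Om b2 a3) *: ract m0 a2)).

Definition twist_bimod : bimod (twist_hopf Om) :=
  @Bimod _ (twist_hopf Om) M twist_lact twist_ract (lcoact M) (rcoact M).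
End TwistBimodule.

Definition twist_calculus (k : fieldType) (A : hopf k) (Om : dual_cocycle A)
  (E : calculus A) : calculus (twist_hopf Om) :=
  @Calculus _ (twist_hopf Om) (twist_bimod Om E) (dif E).

Section Calculus.
Variables (k : fieldType) (A : hopf k) (E : calculus A).

Definition tens2 := btens (@ract _ _ E) (@lact _ _ E).

Definition pure2 (e f : E) : tens2 := bpure _ _ e f.
Local Notation "e ⊗A f" := (pure2 e f) (at level 40).

Definition lact2 (a : A) (x : tens2) : tens2 :=
  btlift (fun e f => lact a e ⊗A f) x.
Definition ract2 (x : tens2) (a : A) : tens2 :=
  btlift (fun e f => e ⊗A ract f a) x.
Definition lcoact2 (x : tens2) : (A ⊗ tens2)%type :=
  btlift (fun e f => btlift (fun a e0 => btlift (fun b f0 =>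
    hmul a b ⊗ (e0 ⊗A f0)) (lcoact E f)) (lcoact E e)) x.
Definition rcoact2 (x : tens2) : (tens2 ⊗ A)%type :=
  btlift (fun e f => btlift (fun e0 a => btlift (fun f0 b =>
    (e0 ⊗A f0) ⊗ hmul a b) (rcoact E f)) (rcoact E e)) x.

Definition linv_pred : {pred E} := fun m => lcoact E m == hone ⊗ m.
Definition is_rinv (m : E) : Prop := rcoact E m = m ⊗ hone.

Lemma linv_closed : submod_closed linv_pred.
Proof.
split=> [|c m m' /eqP mE /eqP m'E]; apply/eqP.
  by rewrite linear0 tpure0r.
by rewrite linearP mE m'E tpureDr tpureZr.
Qed.
HB.instance Definition _ := GRing.isSubmodClosed.Build k E linv_pred linv_closed.

(* The space of left-coinvariants of E. *)
Record linv := LInv { linv_val :> E; linvP : linv_val \in linv_pred }.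
HB.instance Definition _ := [isSub for linv_val].
HB.instance Definition _ := [Choice of linv by <:].
HB.instance Definition _ := [SubChoice_isSubLmodule of linv by <:].

Definition linv2 := (linv ⊗ linv)%type.

(* The identification of linv2 with the left-coinvariants of tens2. *)
Definition incl2 (w : linv2) : tens2 :=
  btlift (fun v v' : linv => linv_val v ⊗A linv_val v') w.
Definition coinv2 (x : tens2) : linv2 := xget 0 [set w | incl2 w = x]%classic.

Definition is_braiding (s : tens2 -> tens2) : Prop :=
  [/\ linear s,
      forall a x, s (lact2 a x) = lact2 a (s x),
      forall x a, s (ract2 x a) = ract2 (s x) a &
      forall (v : linv) (f : E), is_rinv f -> s (linv_val v ⊗A f) = f ⊗A linv_val v].

(* Here, and in [symproj] and [Pi], xget picks the unique map with the stated
   properties. *)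
Definition braiding : tens2 -> tens2 := xget (@id tens2 : tens2 -> tens2) [set s | is_braiding s]%classic.

Definition braiding0 (w : linv2) : linv2 := coinv2 (braiding (incl2 w)).

Definition is_symproj (P : linv2 -> linv2) : Prop :=
  [/\ linear P,
      forall w, P (P w) = P w,
      forall w, (exists v, w = P v) <-> braiding0 w = w &
      forall w, P w = 0 <-> exists2 s : seq (k * linv2),
        forall p, p \in s -> p.1 != 1 /\ braiding0 p.2 = p.1 *: p.2 &
        w = \sum_(p <- s) p.2].

Definition symproj : linv2 -> linv2 := xget (@id linv2 : linv2 -> linv2) [set P | is_symproj P]%classic.

Definition is_left_connection (nabla : {linear E -> tens2}) : Prop :=
  forall a e, nabla (lact a e) = lact2 a (nabla e) + dif E a ⊗A e.

Definition is_bicovariant_map (nabla : {linear E -> tens2}) : Prop :=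
  (forall e, lcoact2 (nabla e) = btlift (fun a e0 => a ⊗ nabla e0) (lcoact E e)) /\
  (forall e, rcoact2 (nabla e) = btlift (fun e0 a => nabla e0 ⊗ a) (rcoact E e)).

Definition is_metric (g : {linear tens2 -> A}) : Prop :=
  [/\ forall a x, g (lact2 a x) = hmul a (g x),
      forall x, g (braiding x) = g x &
      forall f, (forall e, g (e ⊗A f) = 0) -> f = 0].

Definition is_biinvariant (g : {linear tens2 -> A}) : Prop :=
  (forall x, btlift (fun a y => hcounit (g y) *: a) (lcoact2 x) = g x) /\
  (forall x, btlift (fun y a => hcounit (g y) *: a) (rcoact2 x) = g x).

Variables (g : {linear tens2 -> A}) (nabla : {linear E -> tens2}).

(* [g_id v x] is $(g \otimes id)(v \otimes x)$ for $v \in {}_0E$ and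
   $x \in {}_0(E \otimes_A E) = {}_0E \otimes {}_0E$; as g is only left
   A-linear, it is evaluated on coinvariant representatives. *)
Definition g_id (v : linv) (x : tens2) : E :=
  btlift (fun v1 v2 : linv => lact (g (linv_val v ⊗A linv_val v1)) (linv_val v2))
    (coinv2 x).

(* [id_g x f] is $(id \otimes g)(x \otimes f)$. *)
Definition id_g (x : tens2) (f : E) : E :=
  btlift (fun e1 e2 => ract e1 (g (e2 ⊗A f))) x.

(* $(g \otimes id)(id \otimes \sigma)(id \otimes \nabla)$ *)
Definition g_sigma_nabla (w : linv2) : E :=
  btlift (fun v v' : linv => g_id v (braiding (nabla (linv_val v')))) w.

(* $(id \otimes g)(\nabla \otimes id)$ *)
Definition g_nabla (w : linv2) : E :=
  btlift (fun v v' : linv => id_g (nabla (linv_val v)) (linv_val v')) w.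

Definition Pi0 (w : linv2) : E := 2 *: g_sigma_nabla (symproj w).

Definition is_Pi (F : tens2 -> E) : Prop :=
  linear F /\ forall a (v v' : linv),
    let x := linv_val v ⊗A linv_val v' in
    F (lact2 a x) = lact a (Pi0 (v ⊗ v')) + ract (dif E a) (g x).

Definition Pi : tens2 -> E := xget ((fun=> 0) : tens2 -> E) [set F | is_Pi F]%classic.
End Calculus.

(* Main.v *)
Require Import Defs.
From HB Require Import structures.
From mathcomp Require Import all_boot all_order all_algebra.
From mathcomp Require Import boolp classical_sets functions reals complex.
From mathcomp Require freeg.

(** The classical braiding of [E ⊗ E] is the flip. The cocycle identity makes
    [xi : e ⊗ f ↦ γ(e₋₁, f₋₁) (e₀ ⊗ f₀) γ̄(e₁, f₁)] an isomorphism from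
    [E_Ω ⊗ E_Ω] onto the twist of the free module [A ⊗ (V ⊗ V)], where [V] is the
    space of left coinvariants, and it conjugates the braiding σ of [E_Ω] to the
    flip; in particular σ² = 1 and P_sym = (1 + σ) / 2 on [V ⊗ V]. On coinvariants
    [xi] is the operator [J] of the right twist, and [g' ∘ J⁻¹], [J ∘ ∇'] are
    equivariant for the untwisted coactions. Write T = (g' ⊗ id)(id ⊗ σ)(id ⊗ ∇').
    Moving the twist around with the cocycle identity turns
    T ∘ σ = (id ⊗ g')(∇' ⊗ id) on [V ⊗ V] into the symmetry of [g' ∘ J⁻¹].
    Hence (id ⊗ g')(∇' ⊗ id) + T = T ∘ (1 + σ) = 2 T ∘ P_sym = Π⁰, and Π = d g'
    holds exactly when Π⁰ = 0, because g' is scalar-valued on [V ⊗ V]. *)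

(** Coactions are traded for operators: pairing the $A$-leg of a coaction with a functional $h$ of
    the restricted dual turns every Sweedler formula of the deformation into a finite sum of
    composites, over fixed expansions of $\Omega$ and $\Omega^{-1}$. Since [hopf] carries operations
    without axioms, the algebra of the dual has to be derived, and the lever is that elements of $A$
    are functions on $G$. A family of operators that comes from a coaction is determined by its
    members at the evaluations [ev x]; these are group-like, so equivariance only has to be checked
    for translations by points. The balanced tensor product of $E_\Omega$ is a quotient in which
    equalities are hard to test, so actions, coactions and braiding are compared after applying the
    injective map induced by [xi], inside the free model $A\otimes(V\otimes V)$; well-definedness on
    the quotient is read off there too. On $V\otimes V$ only the right half of the twist survives
    because functionals act on left coinvariants through their value at 1 and $\Omega$ is
    normalised; this is the origin of $J$. *)

Set Implicit Arguments.
Unset Strict Implicit.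
Unset Printing Implicit Defensive.

Import GRing.Theory Num.Theory.

Local Open Scope ring_scope.

(** * Linear maps and tensor products *)

(* [U ⊗ V] as an [lmodType]; using the canonical instance directly keeps
   reverse coercions out of nested tensor products. *)
Notation "U ⊠ V" := (@Defs_btens__canonical__GRing_Lmodule _ U V _ (@rscale _ U)
  (fun c (v : V) => c *: v)) (at level 40, left associativity).

Section LinearFunctions.
Variables (k : fieldType) (U V W : lmodType k).
Implicit Types (f : U -> V) (g : V -> W).

Lemma lin0 f : linear f -> f 0 = 0.
Proof.
by move=> lf; have := lf (-1) 0 0; rewrite scaleN1r oppr0 addr0 scaleN1r addNr.
Qed.

Lemma linD f x y : linear f -> f (x + y) = f x + f y.
Proof. by move=> lf; rewrite -[x in LHS]scale1r lf scale1r. Qed.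

Lemma linZ f c x : linear f -> f (c *: x) = c *: f x.
Proof. by move=> lf; rewrite -[c *: x]addr0 lf lin0 // addr0. Qed.

Lemma linB f x y : linear f -> f (x - y) = f x - f y.
Proof. by move=> lf; rewrite -scaleN1r linD // linZ // scaleN1r. Qed.

Lemma lin_sumE (I : Type) (s : seq I) (F : I -> U) f : linear f ->
  f (\sum_(i <- s) F i) = \sum_(i <- s) f (F i).
Proof.
move=> lf; elim: s => [|i s IHs]; first by rewrite !big_nil lin0.
by rewrite !big_cons linD // IHs.
Qed.

Lemma lin_comp f g : linear g -> linear f -> linear (fun x => g (f x)).
Proof. by move=> lg lf c x y; rewrite lf lg. Qed.

Lemma lin_id : linear (fun x : U => x). Proof. by []. Qed.

Lemma lin_cst0 : linear (fun x : U => 0 : V).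
Proof. by move=> c x y; rewrite scaler0 addr0. Qed.

Lemma lin_scale c f : linear f -> linear (fun x => c *: f x).
Proof. by move=> lf d x y; rewrite lf scalerDr !scalerA mulrC. Qed.

Lemma lin_scalel (h : U -> k^o) (v : V) : linear h -> linear (fun x => h x *: v).
Proof. by move=> lh c x y; rewrite lh scalerDl -scalerA. Qed.

Lemma lin_add f f' : linear f -> linear f' -> linear (fun x => f x + f' x).
Proof. by move=> lf lf' c x y; rewrite lf lf' scalerDr addrACA. Qed.

Lemma lin_sum (I : Type) (s : seq I) (F : I -> U -> V) :
  (forall i, linear (F i)) -> linear (fun x => \sum_(i <- s) F i x).
Proof.
move=> lF c x y; rewrite scaler_sumr -big_split; apply: eq_bigr => i _ /=.
exact: lF.
Qed.

End LinearFunctions.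

Section LinearForms.
Variables (k : fieldType) (U : lmodType k).

Lemma lin_mull (c : k^o) (h : U -> k^o) : linear h -> linear (fun x => c * h x : k^o).
Proof. exact: lin_scale. Qed.

Lemma lin_mulr (c : k^o) (h : U -> k^o) : linear h -> linear (fun x => h x * c : k^o).
Proof. exact: lin_scalel. Qed.
End LinearForms.

(** * Maps out of balanced tensor products *)

Section BalancedTensorMaps.
Variables (k : fieldType) (M N : lmodType k) (I : Type).
Variables (ra : M -> I -> M) (la : I -> N -> N).
Local Notation T := (btens ra la).

(** [btlift] evaluates on a chosen representative in the free module, so one finite list serves
    every [f], bilinear or not. For this reason composition with linear maps, finite sums and the
    exchange of two lifts hold for arbitrary functions. *)
Lemma btlift_repr (x : T) : exists s : seq (k * (M * N)),
  forall (W : lmodType k) (f : M -> N -> W),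
    btlift f x = \sum_(p <- s) p.1 *: f p.2.1 p.2.2.
Proof.
exists (freeg.fgenum (repr x)) => W f.
by rewrite /btlift -{1}[repr x]freeg.Freeg_enum freeg.fglift_Freeg.
Qed.

Lemma btlift_comp (W W' : lmodType k) (L : W -> W') (f : M -> N -> W) (x : T) :
  linear L -> L (btlift f x) = btlift (fun m n => L (f m n)) x.
Proof.
move=> lL; have [s E] := btlift_repr x; rewrite !E lin_sumE //.
by apply: eq_bigr => p _; rewrite linZ.
Qed.

Lemma eq_btlift (W : lmodType k) (f f' : M -> N -> W) (x : T) :
  (forall m n, f m n = f' m n) -> btlift f x = btlift f' x.
Proof. by move=> ff'; congr (btlift _ x); apply/funext => m; apply/funext. Qed.

Lemma btlift_sumf (W : lmodType k) (J : Type) (s : seq J)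
    (f : J -> M -> N -> W) (x : T) :
  btlift (fun m n => \sum_(j <- s) f j m n) x = \sum_(j <- s) btlift (f j) x.
Proof.
have [t E] := btlift_repr x; rewrite E; under [RHS]eq_bigr do rewrite E.
by rewrite exchange_big; apply: eq_bigr => p _ /=; rewrite scaler_sumr.
Qed.

Lemma lin_btlift (U W : lmodType k) (f : U -> M -> N -> W) (x : T) :
  (forall m n, linear (fun u => f u m n)) -> linear (fun u => btlift (f u) x).
Proof.
move=> lf c u v; have [s E] := btlift_repr x; rewrite !E.
have L p : linear (fun u => p.1 *: f u p.2.1 p.2.2) by apply: lin_scale; apply: lf.
exact: (lin_sum s L).
Qed.

Lemma btens_ext (W : lmodType k) (f g : T -> W) : linear f -> linear g ->
  (forall m n, f (bpure ra la m n) = g (bpure ra la m n)) -> forall x, f x = g x.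
Proof.
move=> lf lg fg x; have [s ->] := btens_sum x.
by rewrite !lin_sumE //; apply: eq_bigr => p _.
Qed.
End BalancedTensorMaps.

Lemma btlift_exchange (k : fieldType) (M N M' N' W : lmodType k) (I I' : Type)
    (ra : M -> I -> M) (la : I -> N -> N) (ra' : M' -> I' -> M') (la' : I' -> N' -> N')
    (f : M -> N -> M' -> N' -> W) (x : btens ra la) (y : btens ra' la') :
  btlift (fun m n => btlift (f m n) y) x =
  btlift (fun m' n' => btlift (fun m n => f m n m' n') x) y.
Proof.
have [s sE] := btlift_repr x; have [t tE] := btlift_repr y.
rewrite sE tE; under eq_bigr do rewrite tE scaler_sumr.
under [RHS]eq_bigr do rewrite sE scaler_sumr.
rewrite exchange_big; apply: eq_bigr => p _; apply: eq_bigr => q _.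
by rewrite !scalerA mulrC.
Qed.

Section Tensors.
Variables (k : fieldType).
Implicit Types (U V W X : lmodType k).

Lemma lin_tensl U V (v : V) : linear (fun u : U => u ⊗ v).
Proof. by move=> c x y; rewrite tpureDl tpureZl. Qed.

Lemma lin_tensr U V (u : U) : linear (fun v : V => u ⊗ v).
Proof. by move=> c x y; rewrite tpureDr tpureZr. Qed.

Lemma tens_ext U V W (f g : U ⊠ V -> W) : linear f -> linear g ->
  (forall u v, f (u ⊗ v) = g (u ⊗ v)) -> forall x, f x = g x.
Proof. exact: btens_ext. Qed.

Lemma lin_btlift_arg U V W X (F : U -> V -> W) (f : X -> U ⊠ V) :
  bilinear_map F -> linear f -> linear (fun x => btlift F (f x)).
Proof. by move=> bF lf; apply: lin_comp lf; exact: btlift_tlinear. Qed.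

Lemma bilinear_l U V W X (F : U -> V -> W) (f : X -> U) v :
  bilinear_map F -> linear f -> linear (fun x => F (f x) v).
Proof. by move=> [Fl _] lf; apply: (lin_comp (Fl v) lf). Qed.

Lemma bilinear_r U V W X (F : U -> V -> W) (f : X -> V) u :
  bilinear_map F -> linear f -> linear (fun x => F u (f x)).
Proof. by move=> [_ Fr] lf; apply: (lin_comp (Fr u) lf). Qed.

Lemma btlift_id U V (x : U ⊠ V) : btlift (fun u v => u ⊗ v) x = x.
Proof.
have b : bilinear_map (fun (u : U) (v : V) => u ⊗ v).
  by split=> w; [exact: lin_tensl | exact: lin_tensr].
by apply: (@tens_ext U V _ _ id (btlift_tlinear b)) => [|u v] //; rewrite btlift_tpure.
Qed.

Definition tmap U V U' V' (f : U -> U') (g : V -> V') (x : U ⊠ V) :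
  U' ⊠ V' := btlift (fun u v => f u ⊗ g v) x.

Lemma tmapE U V U' V' (f : U -> U') (g : V -> V') u v :
  linear f -> linear g -> tmap f g (u ⊗ v) = f u ⊗ g v.
Proof.
move=> lf lg; rewrite /tmap btlift_tpure //; split=> w.
  exact: (lin_comp (lin_tensl (g w)) lf).
exact: (lin_comp (lin_tensr (f w)) lg).
Qed.

Lemma lin_tmap U V U' V' (f : U -> U') (g : V -> V') :
  linear f -> linear g -> linear (tmap f g).
Proof.
move=> lf lg; apply: btlift_tlinear; split=> w.
  exact: (lin_comp (lin_tensl (g w)) lf).
exact: (lin_comp (lin_tensr (f w)) lg).
Qed.

(** With linearly independent left factors $u_i$, contracting by [h] gives $\sum_i h(v_i)u_i$; if
    this vanishes then $h(v_i)=0$ for all $i$, and the separating family kills each $v_i$. *)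
Lemma tens_sep_r U V (S : (V -> k^o) -> Prop) (t : U ⊠ V) :
  (forall h, S h -> linear h) ->
  (forall v, (forall h, S h -> h v = 0) -> v = 0) ->
  (forall h, S h -> btlift (fun u v => h v *: u) t = 0) -> t = 0.
Proof.
move=> Slin Ssep; have [m [u [v -> fr]]] := tens_free_sum t; move=> t0.
apply: big1 => i _; suff -> : v i = 0 by rewrite tpure0r.
apply: Ssep => h Sh; apply: (fr (fun i => h (v i))).
have := t0 h Sh; rewrite btlift_tsum //; split=> [w|w].
  by apply: lin_scale; exact: lin_id.
exact: lin_scalel (Slin h Sh).
Qed.

Lemma tens_free_sum_r U V (x : U ⊠ V) :
  exists m, exists u : 'I_m -> U, exists2 v : 'I_m -> V,
    x = \sum_i u i ⊗ v i &
    forall c : 'I_m -> k, \sum_i c i *: v i = 0 -> forall i, c i = 0.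
Proof.
pose tw (Y Z : lmodType k) : Y ⊠ Z -> Z ⊠ Y :=
  btlift (fun u v => v ⊗ u).
have bw (Y Z : lmodType k) : bilinear_map (fun (u : Y) (v : Z) => v ⊗ u).
  by split=> w; [exact: lin_tensr | exact: lin_tensl].
have ltw X Y : linear (tw X Y) by exact: btlift_tlinear.
have twE X Y u v : tw X Y (u ⊗ v) = v ⊗ u by exact: btlift_tpure.
have [m [v [u E fr]]] := tens_free_sum (tw _ _ x).
exists m, u, v => //; have <- : tw _ _ (tw _ _ x) = x.
  have L := lin_comp (ltw V U) (ltw U V).
  by apply: (@tens_ext U V _ _ id L) => [|a b] //; rewrite !twE.
rewrite E (lin_sumE _ _ (ltw V U)).
by apply: eq_bigr => i _; rewrite twE.
Qed.

Lemma tens_sep_l U V (S : (U -> k^o) -> Prop) (t : U ⊠ V) :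
  (forall h, S h -> linear h) ->
  (forall v, (forall h, S h -> h v = 0) -> v = 0) ->
  (forall h, S h -> btlift (fun u v => h u *: v) t = 0) -> t = 0.
Proof.
move=> Slin Ssep; have [m [u [v -> fr]]] := tens_free_sum_r t; move=> t0.
apply: big1 => i _; suff -> : u i = 0 by rewrite tpure0l.
apply: Ssep => h Sh; apply: (fr (fun i => h (u i))).
have := t0 h Sh; rewrite btlift_tsum //; split=> [w|w].
  exact: lin_scalel (Slin h Sh).
by apply: lin_scale; exact: lin_id.
Qed.
End Tensors.

(** * The restricted dual of the Hopf algebra of a linear algebraic group *)

Section RegularFunctions.
Variables (k : fieldType) (n : nat) (G : linear_algebraic_group k n).
Local Notation A := (OG G).
Local Notation D := (Defs_rdual__canonical__GRing_Lmodule A).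
Implicit Types (a b c : A) (f g h : D) (x y : lag_pt G).

Definition dmul f g : D := rdual_mul f g.
Definition dunit : D := rdual_one A.

Lemma lin_rdual f : linear (rdual_val f).
Proof. by have /asboolP[] := rdualP f. Qed.

Lemma lin_eval a : linear (fun f => rdual_val f a : k^o).
Proof. by []. Qed.

Lemma rdual_ext f g : (forall a, rdual_val f a = rdual_val g a) -> f = g.
Proof. by move=> fg; apply/val_inj/funext. Qed.

Lemma hmulA a b c : hmul (hmul a b) c = hmul a (hmul b c).
Proof. by apply: regular_ext => x; rewrite /= mulrA. Qed.

Lemma hmulC a b : hmul a b = hmul b a.
Proof. by apply: regular_ext => x; rewrite /= mulrC. Qed.

Lemma hmul1 a : hmul a hone = a.
Proof. by apply: regular_ext => x; rewrite /= mulr1. Qed.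

Lemma lin_hmull b : linear (fun a => hmul a b).
Proof. by move=> c a a'; apply: regular_ext => x; rewrite /= mulrDl -mulrA. Qed.

Lemma lin_hmulr a : linear (fun b => hmul a b).
Proof. by move=> c b b'; apply: regular_ext => x; rewrite /= mulrDr mulrCA. Qed.

Lemma lin_pt x : linear (fun a : A => regular_val a x : k^o).
Proof. by []. Qed.

Lemma pt_in_rdual x : in_rdual (fun a : A => regular_val a x : k^o).
Proof.
split; first exact: lin_pt.
exists [:: ((fun a : A => regular_val a x : k^o), (fun a : A => regular_val a x : k^o))].
  by move=> p; rewrite inE => /eqP ->; split; exact: lin_pt.
by move=> a b; rewrite big_seq1.
Qed.

(** Evaluations are multiplicative on $A$, hence group-like in the dual, and they separate the
    elements of $A$: these are the test functionals of the whole development. *)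
Definition ev x : D := RDual (asboolT (pt_in_rdual x)).

Lemma lin_hcop : linear (@hcop k A).
Proof.
move=> c a b; apply: regular2_inj => x y.
by rewrite regular2_linear !regular_copE.
Qed.

Lemma lin_hcounit : linear (@hcounit k A : A -> k^o).
Proof. by []. Qed.

Lemma lag_mulA x y (z : lag_pt G) : lag_mul x (lag_mul y z) = lag_mul (lag_mul x y) z.
Proof. by apply/val_inj; rewrite /= mulmxA. Qed.

Lemma lag_mul1 x : lag_mul x (lag_e G) = x.
Proof. by apply/val_inj; rewrite /= mulmx1. Qed.

Lemma lag_1mul x : lag_mul (lag_e G) x = x.
Proof. by apply/val_inj; rewrite /= mul1mx. Qed.

Lemma hcop_sum a : exists2 s : seq (A * A), hcop a = \sum_(p <- s) p.1 ⊗ p.2 &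
  forall x y, \sum_(p <- s) regular_val p.1 x * regular_val p.2 y
    = regular_val a (lag_mul x y).
Proof.
have [s sE] := tens_sum (hcop a); exists s => // x y.
by rewrite -regular2_sum -sE regular_copE.
Qed.

(** At [f = ev x] these are the translations $a\mapsto a(x\,\cdot)$ and $a\mapsto a(\cdot\,x)$.
    [rhoA] is an action for the convolution product, [lamA] for its opposite. *)
Definition lamA f a : A := sweedler a (fun a1 a2 => rdual_val f a1 *: a2).
Definition rhoA f a : A := sweedler a (fun a1 a2 => rdual_val f a2 *: a1).

Lemma bil_lam_pair f : bilinear_map (fun a1 a2 : A => rdual_val f a1 *: a2).
Proof.
split=> a; first exact: lin_scalel (lin_rdual f).
by apply: lin_scale; exact: lin_id.
Qed.

Lemma bil_rho_pair f : bilinear_map (fun a1 a2 : A => rdual_val f a2 *: a1).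
Proof.
split=> a; last exact: lin_scalel (lin_rdual f).
by apply: lin_scale; exact: lin_id.
Qed.

Lemma lin_lamA f : linear (lamA f).
Proof. exact: lin_btlift_arg (bil_lam_pair f) lin_hcop. Qed.

Lemma lin_rhoA f : linear (rhoA f).
Proof. exact: lin_btlift_arg (bil_rho_pair f) lin_hcop. Qed.

Lemma lin_lamA_l a : linear (fun f => lamA f a).
Proof. by apply: lin_btlift => a1 a2; exact: lin_scalel (lin_eval a1). Qed.

Lemma lin_rhoA_l a : linear (fun f => rhoA f a).
Proof. by apply: lin_btlift => a1 a2; exact: lin_scalel (lin_eval a2). Qed.

Lemma bil_lamA : bilinear_map lamA.
Proof. by split=> z; [exact: lin_lamA_l | exact: lin_lamA]. Qed.

Lemma bil_rhoA : bilinear_map rhoA.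
Proof. by split=> z; [exact: lin_rhoA_l | exact: lin_rhoA]. Qed.

Lemma dmul_rhoA f g a : rdual_val (dmul f g) a = rdual_val f (rhoA g a).
Proof.
rewrite rdual_mulE /rhoA /sweedler (btlift_comp _ _ (lin_rdual f)).
by apply: eq_btlift => a1 a2; rewrite (linZ _ _ (lin_rdual f)) mulrC.
Qed.

Lemma dmul_lamA f g a : rdual_val (dmul f g) a = rdual_val g (lamA f a).
Proof.
rewrite rdual_mulE /lamA /sweedler (btlift_comp _ _ (lin_rdual g)).
by apply: eq_btlift => a1 a2; rewrite (linZ _ _ (lin_rdual g)).
Qed.

Lemma lamA_ev x a y : regular_val (lamA (ev x) a) y = regular_val a (lag_mul x y).
Proof.
rewrite /lamA /sweedler -(regular_copE a).
exact: (btlift_comp _ _ (lin_pt y)).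
Qed.

Lemma rhoA_ev x a y : regular_val (rhoA (ev x) a) y = regular_val a (lag_mul y x).
Proof.
rewrite /rhoA /sweedler -(regular_copE a) /regular2.
rewrite [LHS](btlift_comp _ _ (lin_pt y)).
by apply: eq_btlift => a1 a2 /=; rewrite mulrC.
Qed.

(** A value of [lamA f a] is [f] applied to a translate of [a]. Equalities of operators thereby
    reduce to equalities of translates, and coassociativity of $A$ enters as associativity of the
    group law. *)
Lemma lamA_pt f a x : regular_val (lamA f a) x = rdual_val f (rhoA (ev x) a).
Proof. by rewrite -dmul_rhoA dmul_lamA. Qed.

Lemma rhoA_pt f a x : regular_val (rhoA f a) x = rdual_val f (lamA (ev x) a).
Proof. by rewrite -dmul_lamA dmul_rhoA. Qed.

Lemma lamA_rhoA_ev f x a : lamA f (rhoA (ev x) a) = rhoA (ev x) (lamA f a).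
Proof.
apply: regular_ext => y; rewrite lamA_pt rhoA_ev lamA_pt; congr (rdual_val f _).
by apply: regular_ext => z; rewrite !rhoA_ev lag_mulA.
Qed.

Lemma rhoA_lamA_ev f x a : rhoA f (lamA (ev x) a) = lamA (ev x) (rhoA f a).
Proof.
apply: regular_ext => y; rewrite rhoA_pt lamA_ev rhoA_pt; congr (rdual_val f _).
by apply: regular_ext => z; rewrite !lamA_ev lag_mulA.
Qed.

Lemma rhoA_mul f g a : rhoA (dmul f g) a = rhoA f (rhoA g a).
Proof.
by apply: regular_ext => x; rewrite !rhoA_pt dmul_rhoA rhoA_lamA_ev.
Qed.

Lemma lamA_mul f g a : lamA (dmul f g) a = lamA g (lamA f a).
Proof.
by apply: regular_ext => x; rewrite !lamA_pt dmul_lamA lamA_rhoA_ev.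
Qed.

Lemma dmulA f g h : dmul f (dmul g h) = dmul (dmul f g) h.
Proof. by apply: rdual_ext => a; rewrite !dmul_rhoA rhoA_mul. Qed.

(** At $x$ the two sides are the values on [a] of the triple product of [f], [ev x] and [g],
    bracketed in the two ways. *)
Lemma lamA_rhoA f g a : lamA f (rhoA g a) = rhoA g (lamA f a).
Proof.
apply: regular_ext => x; rewrite lamA_pt rhoA_pt -rhoA_mul -lamA_mul.
by rewrite -dmul_rhoA -dmul_lamA dmulA.
Qed.

Lemma dunit_ev : dunit = ev (lag_e G).
Proof. by apply: rdual_ext => a; rewrite rdual_oneE. Qed.

Lemma rhoA1 a : rhoA dunit a = a.
Proof. by apply: regular_ext => x; rewrite dunit_ev rhoA_ev lag_mul1. Qed.

Lemma lamA1 a : lamA dunit a = a.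
Proof. by apply: regular_ext => x; rewrite dunit_ev lamA_ev lag_1mul. Qed.

Lemma dmul1 f : dmul f dunit = f.
Proof. by apply: rdual_ext => a; rewrite dmul_rhoA rhoA1. Qed.

Lemma d1mul f : dmul dunit f = f.
Proof. by apply: rdual_ext => a; rewrite dmul_lamA lamA1. Qed.

Lemma lin_dmull g : linear (fun f => dmul f g).
Proof.
move=> c f f'; apply: rdual_ext => a.
by rewrite -[RHS]/(c * rdual_val (dmul f g) a + rdual_val (dmul f' g) a) !dmul_rhoA.
Qed.

Lemma lin_dmulr f : linear (fun g => dmul f g).
Proof.
move=> c g g'; apply: rdual_ext => a.
by rewrite -[RHS]/(c * rdual_val (dmul f g) a + rdual_val (dmul f g') a) !dmul_lamA.
Qed.

Lemma bil_pairing2 a b :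
  bilinear_map (fun f g => rdual_val f a * rdual_val g b : k^o).
Proof.
split=> u; first exact: lin_mulr (lin_eval a).
exact: lin_mull (lin_eval b).
Qed.

(** A functional is determined by its values, so the evaluations at elements [b] separate the right
    factor; the remaining left factor is compared at every [a]. *)
Lemma pairing2_inj (t t' : D ⊠ D) :
  (forall a b, pairing2 t a b = pairing2 t' a b) -> t = t'.
Proof.
move=> tt'; apply/eqP; rewrite -subr_eq0; apply/eqP.
apply: (@tens_sep_r _ D D (fun e => exists a, e = fun f => rdual_val f a)).
- by move=> _ [a ->]; exact: lin_eval.
- by move=> f f0; apply: rdual_ext => a; apply: (f0 (fun f => rdual_val f a : k^o));
    exists a.
move=> _ [b ->]; apply: rdual_ext => a.
have := tt' a b; rewrite /pairing2 => /eqP; rewrite -subr_eq0.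
rewrite -(linB _ _ (btlift_tlinear (bil_pairing2 a b))) => /eqP E0.
rewrite -[RHS]/(0 : k^o) -E0 [LHS](btlift_comp _ _ (lin_eval a)).
by apply: eq_btlift => f g; rewrite (linZ _ _ (lin_eval a)) mulrC.
Qed.

Definition dcop f : D ⊠ D := rdual_cop f.

Lemma dcopE f a b : pairing2 (dcop f) a b = rdual_val f (hmul a b).
Proof. exact: rdual_copE. Qed.

Lemma lin_dcop : linear dcop.
Proof.
move=> c f g; apply: pairing2_inj => a b; rewrite dcopE.
by rewrite /pairing2 (btlift_tlinear (bil_pairing2 a b)) -!/(pairing2 _ _ _) !dcopE.
Qed.

Lemma dcop_ev x : dcop (ev x) = ev x ⊗ ev x.
Proof.
apply: pairing2_inj => a b; rewrite dcopE.
by rewrite /pairing2 btlift_tpure //; exact: bil_pairing2.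
Qed.

Lemma dcop_dunit : dcop dunit = dunit ⊗ dunit.
Proof. by rewrite dunit_ev dcop_ev. Qed.

(** Paired with $a\otimes b$, this is multiplicativity of the coproduct of $A$: expansions of
    $\Delta(a)$ and $\Delta(b)$ multiply to one of $\Delta(ab)$ by [rep_mul]. What is left is the
    reordering of a fourfold sum. *)
Lemma dcop_mul f g : dcop (dmul f g) = tens_mul dmul dmul (dcop f) (dcop g).
Proof.
apply: pairing2_inj => a b; rewrite dcopE.
have [s sE] := tens_sum (dcop f); have [t tE] := tens_sum (dcop g).
have [u _ uE] := hcop_sum a; have [v _ vE] := hcop_sum b.
have bl (f' g' : A -> k^o) : linear f' -> linear g' ->
    bilinear_map (fun a1 a2 : A => f' a1 * g' a2 : k^o).
  by move=> lf lg; split=> ?; [exact: lin_mulr lf | exact: lin_mull lg].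
have mulE f' g' a' w : (forall x y, \sum_(p <- w) regular_val p.1 x * regular_val p.2 y
    = regular_val a' (lag_mul x y)) -> rdual_val (dmul f' g') a'
    = \sum_(p <- w) rdual_val f' p.1 * rdual_val g' p.2.
  move=> wE; rewrite rdual_mulE (sweedler_rep _ wE) //.
  by apply: bl; exact: lin_rdual.
have bm f' g' : bilinear_map (fun f1 f2 => dmul f' f1 ⊗ dmul g' f2).
  split=> z; first exact: (lin_comp (lin_tensl (dmul g' z)) (lin_dmulr f')).
  exact: (lin_comp (lin_tensr (dmul f' z)) (lin_dmulr g')).
have -> : tens_mul dmul dmul (dcop f) (dcop g)
    = \sum_(p <- s) \sum_(q <- t) dmul p.1 q.1 ⊗ dmul p.2 q.2.
  rewrite /tens_mul sE btlift_tsum; last first.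
    split=> z; apply: lin_btlift => f1 f2.
      exact: (lin_comp (lin_tensl (dmul z f2)) (lin_dmull f1)).
    exact: (lin_comp (lin_tensr (dmul z f1)) (lin_dmull f2)).
  by apply: eq_bigr => p _; rewrite tE btlift_tsum.
have cE (h : D) w a' b' : dcop h = \sum_(p <- w) p.1 ⊗ p.2 ->
    rdual_val h (hmul a' b') = \sum_(p <- w) rdual_val p.1 a' * rdual_val p.2 b'.
  move=> wE; rewrite -dcopE wE /pairing2 btlift_tsum //; exact: bil_pairing2.
rewrite (mulE _ _ _ _ (rep_mul uE vE)) big_allpairs_dep /=.
rewrite /pairing2 (lin_sumE _ _ (btlift_tlinear (bil_pairing2 a b))).
under [RHS]eq_bigr => p _.
  rewrite (btlift_tsum _ _ _ (bil_pairing2 a b)).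
  under eq_bigr => q _.
    rewrite (mulE _ _ _ _ uE) (mulE _ _ _ _ vE) mulr_suml.
    under eq_bigr do rewrite mulr_sumr.
    over.
  over.
under eq_bigr => i _ do under eq_bigr => j _ do
  rewrite (cE _ _ _ _ sE) (cE _ _ _ _ tE) mulr_suml.
under eq_bigr => i _ do under eq_bigr => j _ do under eq_bigr => p _ do
  rewrite mulr_sumr.
under eq_bigr => i _ do rewrite exchange_big /=.
rewrite exchange_big; apply: eq_bigr => p _ /=.
under eq_bigr => i _ do rewrite exchange_big /=.
rewrite exchange_big; apply: eq_bigr => q _ /=.
by apply: eq_bigr => i _; apply: eq_bigr => j _; rewrite mulrACA.
Qed.

Lemma btlift_dcop_mul (W : lmodType k) (F : D -> D -> W) f g : bilinear_map F ->
  btlift F (dcop (dmul f g)) = btlift (fun f1 f2 => btlift (fun g1 g2 =>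
    F (dmul f1 g1) (dmul f2 g2)) (dcop g)) (dcop f).
Proof.
move=> bF; rewrite dcop_mul /tens_mul (btlift_comp _ _ (btlift_tlinear bF)).
apply: eq_btlift => f1 f2; rewrite (btlift_comp _ _ (btlift_tlinear bF)).
by apply: eq_btlift => g1 g2; rewrite btlift_tpure.
Qed.
End RegularFunctions.

(** * The cocycle identities as identities of sums *)

Section Trilinear.
Variables (k : fieldType) (U V W X : lmodType k).

Definition trilinear (F : U -> V -> W -> X) : Prop :=
  [/\ forall v w, linear (fun u => F u v w), forall u w, linear (fun v => F u v w) &
      forall u v, linear (fun w => F u v w)].

Lemma tri1 (F : U -> V -> W -> X) v w : trilinear F -> linear (fun u => F u v w).
Proof. by case. Qed.
Lemma tri2 (F : U -> V -> W -> X) u w : trilinear F -> linear (fun v => F u v w).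
Proof. by case. Qed.
Lemma tri3 (F : U -> V -> W -> X) u v : trilinear F -> linear (fun w => F u v w).
Proof. by case. Qed.
End Trilinear.

(* [linear] and [bilinear_map] goals, from (bi-, tri-)linearity hypotheses in the context. *)
Ltac lin :=
  cbv beta;
  lazymatch goal with
  | |- forall _, _ => first [ assumption | let y := fresh "y" in intro y; lin ]
  | |- GRing.linear_for _ ?f => first [ assumption | solve [auto 1] | lin_f f ]
  | |- bilinear_map _ => first [ assumption | solve [auto 1] | split; lin ]
  end
with lin_f f :=
  match f with
  | (fun x => x) => exact (@lin_id _ _)
  | (fun x => @?g x + @?h x) => refine (lin_add (f := g) (f' := h) _ _); lin
  | (fun x => ?c *: @?g x) => apply lin_scale; lin
  | (fun x => \sum_(i <- ?s) (@?F i x)) => refine (lin_sum s (F := F) _); lin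
  | (fun x => btlift (fun m n => @?F x m n) ?t) =>
      refine (lin_btlift (f := F) t _); lin
  | (fun x => btlift ?F (@?g x)) => refine (lin_btlift_arg (F := F) (f := g) _ _); lin
  | (fun x => @?g x ⊗ ?v) => refine (lin_comp (f := g) (lin_tensl v) _); lin
  | (fun x => ?u ⊗ @?g x) => refine (lin_comp (f := g) (lin_tensr u) _); lin
  | (fun x => dmul (@?g x) ?v) => refine (lin_comp (f := g) (lin_dmull v) _); lin
  | (fun x => dmul ?u (@?g x)) => refine (lin_comp (f := g) (lin_dmulr u) _); lin
  | (fun x => dcop (@?g x)) => refine (lin_comp (f := g) (@lin_dcop _ _ _) _); lin
  | (fun x => rdual_val (@?g x) ?a *: ?v) =>
      refine (lin_scalel (h := fun x => rdual_val (g x) a) v _);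
      refine (lin_comp (f := g) (lin_eval a) _); lin
  | (fun x => ?F (@?g x) ?v) =>
      match goal with H : bilinear_map F |- _ => refine (bilinear_l (f := g) v H _); lin end
  | (fun x => ?F ?u (@?g x)) =>
      match goal with H : bilinear_map F |- _ => refine (bilinear_r (f := g) u H _); lin end
  | (fun x => ?F (@?g x)) =>
      match goal with H : linear F |- _ => refine (lin_comp (f := g) H _); lin end
  | (fun x => ?F ?u (@?g x)) =>
      match goal with H : forall _, linear _ |- _ => refine (lin_comp (f := g) (H u) _); lin end
  | (fun x => ?F (@?g x) ?v) =>
      match goal with H : forall _, linear _ |- _ => refine (lin_comp (f := g) (H v) _); lin end
  | (fun x => ?F (@?g x) ?v ?w) =>
      match goal with H : trilinear F |- _ =>
        refine (lin_comp (f := g) (tri1 v w H) _); lin end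
  | (fun x => ?F ?u (@?g x) ?w) =>
      match goal with H : trilinear F |- _ =>
        refine (lin_comp (f := g) (tri2 u w H) _); lin end
  | (fun x => ?F ?u ?v (@?g x)) =>
      match goal with H : trilinear F |- _ =>
        refine (lin_comp (f := g) (tri3 u v H) _); lin end
  end.

Section DualCocycle.
Variables (k : fieldType) (n : nat) (G : linear_algebraic_group k n).
Local Notation A := (OG G).
Local Notation D := (Defs_rdual__canonical__GRing_Lmodule A).
Variable Om : dual_cocycle A.

(** Expansions of $\Omega$ and $\Omega^{-1}$ into pure tensors, fixed once. Identities in tensor
    powers of the dual are then stated as equalities of finite sums for an arbitrary multilinear
    [F], the form in which they apply to operators. *)
Definition seqO : seq (D * D) := sval (cid (tens_sum (dc_val Om))).
Definition seqV : seq (D * D) := sval (cid (tens_sum (dc_inv Om))).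

Lemma seqOE : dc_val Om = \sum_(p <- seqO) p.1 ⊗ p.2.
Proof. exact: (svalP (cid (tens_sum (dc_val Om)))). Qed.

Lemma seqVE : dc_inv Om = \sum_(p <- seqV) p.1 ⊗ p.2.
Proof. exact: (svalP (cid (tens_sum (dc_inv Om)))). Qed.

Lemma mul2_sum (s t : seq (D * D)) (W : lmodType k) (F : D -> D -> W) :
  bilinear_map F ->
  btlift F (mul2 (\sum_(p <- s) p.1 ⊗ p.2) (\sum_(p <- t) p.1 ⊗ p.2)) =
  \sum_(p <- s) \sum_(q <- t) F (dmul p.1 q.1) (dmul p.2 q.2).
Proof.
move=> bF; rewrite -[mul2 _ _]/(tens_mul (@dmul k n G) (@dmul k n G) _ _) /tens_mul.
rewrite (btlift_comp _ _ (btlift_tlinear bF)).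
rewrite btlift_tsum; last by lin.
apply: eq_bigr => p _.
rewrite (btlift_comp _ _ (btlift_tlinear bF)) btlift_tsum; last first.
  by lin.
by apply: eq_bigr => q _; rewrite btlift_tpure.
Qed.

Lemma seqOV (W : lmodType k) (F : D -> D -> W) : bilinear_map F ->
  \sum_(p <- seqO) \sum_(q <- seqV) F (dmul p.1 q.1) (dmul p.2 q.2) = F (dunit G) (dunit G).
Proof.
move=> bF; rewrite -mul2_sum // -seqOE -seqVE dc_mulV.
exact: (btlift_tpure (dunit G) (dunit G) bF).
Qed.

Lemma seqVO (W : lmodType k) (F : D -> D -> W) : bilinear_map F ->
  \sum_(q <- seqV) \sum_(p <- seqO) F (dmul q.1 p.1) (dmul q.2 p.2) = F (dunit G) (dunit G).
Proof.
move=> bF; rewrite -mul2_sum // -seqOE -seqVE dc_mulVl.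
exact: (btlift_tpure (dunit G) (dunit G) bF).
Qed.

Lemma lamA_hone (f : D) : lamA f hone = (rdual_val f hone : k) *: (hone : A).
Proof.
apply: regular_ext => x.
rewrite lamA_pt -[RHS]/(rdual_val f hone * (1 : k)) mulr1.
by congr (rdual_val f _); apply: regular_ext => y; rewrite rhoA_ev.
Qed.

Lemma dmul_hone (f g : D) :
  rdual_val (dmul f g) hone = rdual_val f hone * rdual_val g hone.
Proof. by rewrite dmul_lamA lamA_hone (linZ _ _ (lin_rdual g)). Qed.

Lemma seqO_unitl : \sum_(p <- seqO) (rdual_val p.1 hone : k) *: p.2 = dunit G.
Proof.
rewrite -[RHS](dc_unitl Om) seqOE btlift_tsum //.
split=> x; first exact: lin_scalel (lin_eval hone).
by lin.
Qed.

Lemma seqO_unitr : \sum_(p <- seqO) (rdual_val p.2 hone : k) *: p.1 = dunit G.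
Proof.
rewrite -[RHS](dc_unitr Om) seqOE btlift_tsum //.
split=> x; last exact: lin_scalel (lin_eval hone).
by lin.
Qed.

Lemma dunit_hone : rdual_val (dunit G) (hone : A) = 1.
Proof. by rewrite rdual_oneE. Qed.

(** The counit of the dual is evaluation at [hone], which is multiplicative by [dmul_hone]. Applied
    to the first leg of $\Omega\Omega^{-1}=1$ it leaves the contracted inverse, the contraction of
    $\Omega$ being the unit. *)
Lemma seqV_unitl : \sum_(q <- seqV) (rdual_val q.1 hone : k) *: q.2 = dunit G.
Proof.
have b : bilinear_map (fun f g : D => (rdual_val f hone : k) *: g).
  split=> x; first exact: lin_scalel (lin_eval hone).
  by lin.
have := seqOV b; rewrite dunit_hone scale1r exchange_big => <- /=.
apply: eq_bigr => q _; rewrite -[q.2 in LHS](d1mul q.2) -seqO_unitl.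
rewrite (lin_sumE _ _ (lin_dmull q.2)) scaler_sumr; apply: eq_bigr => p _.
by rewrite (linZ _ _ (lin_dmull q.2)) dmul_hone scalerA mulrC.
Qed.

Lemma seqV_unitr : \sum_(q <- seqV) (rdual_val q.2 hone : k) *: q.1 = dunit G.
Proof.
have b : bilinear_map (fun f g : D => (rdual_val g hone : k) *: f).
  split=> x; last exact: lin_scalel (lin_eval hone).
  by lin.
have := seqOV b; rewrite dunit_hone scale1r exchange_big => <- /=.
apply: eq_bigr => q _; rewrite -[q.1 in LHS](d1mul q.1) -seqO_unitr.
rewrite (lin_sumE _ _ (lin_dmull q.1)) scaler_sumr; apply: eq_bigr => p _.
by rewrite (linZ _ _ (lin_dmull q.1)) dmul_hone scalerA mulrC.
Qed.

Definition lift3 (W : lmodType k) (F : D -> D -> D -> W) (x : D ⊠ (D ⊠ D)) : W :=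
  btlift (fun f => btlift (F f)) x.

Lemma bil_lift3 (W : lmodType k) (F : D -> D -> D -> W) : trilinear F ->
  bilinear_map (fun f => btlift (F f) : D ⊠ D -> W).
Proof.
move=> [F1 F2 F3]; split=> [x|f]; first by apply: lin_btlift => g h; exact: F1.
by apply: btlift_tlinear; split=> ?; [exact: F2 | exact: F3].
Qed.

Lemma lin_lift3 (W : lmodType k) (F : D -> D -> D -> W) : trilinear F ->
  linear (lift3 F).
Proof. by move=> /bil_lift3; exact: btlift_tlinear. Qed.

Lemma lift3E (W : lmodType k) (F : D -> D -> D -> W) f g h : trilinear F ->
  lift3 F (f ⊗ (g ⊗ h)) = F f g h.
Proof.
move=> tF; rewrite /lift3 (btlift_tpure _ _ (bil_lift3 tF)) btlift_tpure //.
by case: tF => F1 F2 F3; split=> ?; [exact: F2 | exact: F3].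
Qed.

Local Notation tm2 := (tens_mul (@dmul k n G) (@dmul k n G)).
Local Notation tm3 := (tens_mul (@dmul k n G) tm2).

Lemma bil_tens_mul (U V : lmodType k) (mU : U -> U -> U) (mV : V -> V -> V) :
  bilinear_map mU -> bilinear_map mV -> bilinear_map (tens_mul mU mV).
Proof.
move=> bU bV.
have b u v : bilinear_map (fun u' v' => mU u u' ⊗ mV v v') by lin.
have b2 (y : U ⊠ V) : bilinear_map (fun u v => btlift (fun u' v' => mU u u' ⊗ mV v v') y) by lin.
split=> x; first exact: btlift_tlinear.
by rewrite /tens_mul; lin.
Qed.

Lemma tens_mulE (U V : lmodType k) (mU : U -> U -> U) (mV : V -> V -> V) u v u' v' :
  bilinear_map mU -> bilinear_map mV ->
  tens_mul mU mV (u ⊗ v) (u' ⊗ v') = mU u u' ⊗ mV v v'.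
Proof.
move=> bU bV; have b (y : U ⊠ V) : bilinear_map (fun u v =>
  btlift (fun u' v' => mU u u' ⊗ mV v v') y) by lin.
by rewrite /tens_mul (btlift_tpure _ _ (b _)) btlift_tpure //; lin.
Qed.

Lemma bil_dmul : bilinear_map (@dmul k n G).
Proof. by split=> ?; [exact: lin_dmull | exact: lin_dmulr]. Qed.

(** [Q1] and [Q2] expand $\Omega_{12}(\Delta\otimes\mathrm{id})(\Omega)$ and
    $\Omega_{23}(\mathrm{id}\otimes\Delta)(\Omega)$, tested against [F]. *)
Lemma seqO_cocycle (W : lmodType k) (F : D -> D -> D -> W) : trilinear F ->
  \sum_(q <- seqO) \sum_(p <- seqO)
    btlift (fun h1 h2 => F (dmul p.1 h1) (dmul p.2 h2) q.2) (dcop q.1) =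
  \sum_(q <- seqO) \sum_(p <- seqO)
    btlift (fun h1 h2 => F q.1 (dmul p.1 h1) (dmul p.2 h2)) (dcop q.2).
Proof.
move=> tF; have lF := lin_lift3 tF; have b1 := bil_dmul.
have b2 := bil_tens_mul b1 b1; have b3 := bil_tens_mul b1 b2.
have Q1 (s t : seq (D * D)) :
  lift3 F (tm3 (\sum_(p <- s) p.1 ⊗ (p.2 ⊗ dunit G))
    (\sum_(q <- t) btlift (fun h1 h2 => h1 ⊗ (h2 ⊗ q.2))
      (dcop q.1))) =
  \sum_(q <- t) \sum_(p <- s)
    btlift (fun h1 h2 => F (dmul p.1 h1) (dmul p.2 h2) q.2) (dcop q.1).
  rewrite (lin_sumE _ _ (b3.2 _)) (lin_sumE _ _ lF); apply: eq_bigr => q _.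
  rewrite (lin_sumE _ _ (b3.1 _)) (lin_sumE _ _ lF); apply: eq_bigr => p _.
  rewrite (btlift_comp _ _ (b3.2 _)) (btlift_comp _ _ lF); apply: eq_btlift => h1 h2.
  by rewrite (tens_mulE _ _ _ _ b1 b2) (tens_mulE _ _ _ _ b1 b1) lift3E // d1mul.
have Q2 (s t : seq (D * D)) :
  lift3 F (tm3 (dunit G ⊗ \sum_(p <- s) p.1 ⊗ p.2)
    (\sum_(q <- t) q.1 ⊗ dcop q.2)) =
  \sum_(q <- t) \sum_(p <- s)
    btlift (fun h1 h2 => F q.1 (dmul p.1 h1) (dmul p.2 h2)) (dcop q.2).
  rewrite (lin_sumE _ _ (b3.2 _)) (lin_sumE _ _ lF); apply: eq_bigr => q _.
  rewrite (tens_mulE _ _ _ _ b1 b2) d1mul (lin_sumE _ _ (b2.1 _)).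
  rewrite (lin_sumE _ _ (lin_tensr _)) (lin_sumE _ _ lF); apply: eq_bigr => p _.
  have L : linear (fun z => lift3 F (q.1 ⊗ tm2 (p.1 ⊗ p.2) z)).
    exact: (lin_comp lF (lin_comp (lin_tensr _) (b2.2 _))).
  rewrite -[dcop q.2 in LHS]btlift_id (btlift_comp _ _ L); apply: eq_btlift => h1 h2.
  by rewrite (tens_mulE _ _ _ _ b1 b1) lift3E.
rewrite -Q1 -Q2; have := congr1 (lift3 F) (dc_cocycle Om).
rewrite !seqOE.
rewrite (@btlift_tsum k D D (D ⊠ (D ⊠ D))); last by lin.
rewrite (@btlift_tsum k D D (D ⊠ (D ⊠ D))); last first.
  have L : bilinear_map (fun h c : D => btlift (fun h1 h2 => h1 ⊗ (h2 ⊗ c)) (dcop h)).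
    by lin.
  exact: L.
rewrite (@btlift_tsum k D D (D ⊠ (D ⊠ D))); last first.
  split=> x; first by lin.
  exact: (lin_comp (lin_tensr x) (@lin_dcop _ _ G)).
by [].
Qed.

(** * The cocycle identity of the inverse *)

Section Inverse.
Variable W : lmodType k.
Implicit Types (F : D -> D -> D -> W) (s t : seq (D * D)).

(** Precomposition of a trilinear map with left multiplication by $s_{12}$, and below by $s_{23}$,
    $(\Delta\otimes\mathrm{id})(s)$ and $(\mathrm{id}\otimes\Delta)(s)$. In a composite the outer
    operator contributes the right factor of the product. Inverting these operators one at a time
    replaces inversion in the triple tensor algebra. *)
Let M12 s F h f g := \sum_(p <- s) F (dmul p.1 h) (dmul p.2 f) g.
Let M23 s F h f g := \sum_(p <- s) F h (dmul p.1 f) (dmul p.2 g).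
Let M12_3 s F h f g := \sum_(p <- s)
  btlift (fun a b => F (dmul a h) (dmul b f) (dmul p.2 g)) (dcop p.1).
Let M1_23 s F h f g := \sum_(p <- s)
  btlift (fun a b => F (dmul p.1 h) (dmul a f) (dmul b g)) (dcop p.2).

Let tri12 s F : trilinear F -> trilinear (M12 s F).
Proof. by move=> tF; split=> x y; rewrite /M12; lin. Qed.
Let tri23 s F : trilinear F -> trilinear (M23 s F).
Proof. by move=> tF; split=> x y; rewrite /M23; lin. Qed.
Let tri12_3 s F : trilinear F -> trilinear (M12_3 s F).
Proof. by move=> tF; split=> x y; rewrite /M12_3; lin. Qed.
Let ext3 F F' : (forall h f g, F h f g = F' h f g) -> F = F'.
Proof. by move=> E; do 3![apply/funext => ?]; exact: E. Qed.

Let M12K F : trilinear F -> M12 seqO (M12 seqV F) = F.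
Proof.
move=> tF; apply: ext3 => h f g; rewrite /M12.
have b : bilinear_map (fun a b => F (dmul a h) (dmul b f) g) by lin.
rewrite exchange_big -[RHS]/(F h f g) -[h in RHS]d1mul -[f in RHS]d1mul -(seqVO b).
by apply: eq_bigr => q _; apply: eq_bigr => p _; rewrite !dmulA.
Qed.

Let M23K F : trilinear F -> M23 seqV (M23 seqO F) = F.
Proof.
move=> tF; apply: ext3 => h f g; rewrite /M23.
have b : bilinear_map (fun a b => F h (dmul a f) (dmul b g)) by lin.
rewrite exchange_big -[RHS]/(F h f g) -[f in RHS]d1mul -[g in RHS]d1mul -(seqOV b).
by apply: eq_bigr => q _; apply: eq_bigr => p _; rewrite !dmulA.
Qed.

Let M12_3K F : trilinear F -> M12_3 seqO (M12_3 seqV F) = F.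
Proof.
move=> tF; apply: ext3 => h f g; rewrite /M12_3.
have b x : bilinear_map (fun a b => F (dmul a h) (dmul b f) (dmul x g)) by lin.
pose B z x := btlift (fun a b => F (dmul a h) (dmul b f) (dmul x g)) (dcop z).
have bB : bilinear_map B by rewrite /B; lin.
have <- : B (dunit G) (dunit G) = F h f g.
  by rewrite /B dcop_dunit (btlift_tpure _ _ (b _)) !d1mul.
rewrite -(seqVO bB) exchange_big; apply: eq_bigr => p _.
rewrite btlift_sumf; apply: eq_bigr => q _.
rewrite /B (btlift_dcop_mul _ _ (b _)) btlift_exchange.
by do 2!apply: eq_btlift => ? ?; rewrite !dmulA.
Qed.

Let M1_23K F : trilinear F -> M1_23 seqV (M1_23 seqO F) = F.
Proof.
move=> tF; apply: ext3 => h f g; rewrite /M1_23.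
have b x : bilinear_map (fun a b => F (dmul x h) (dmul a f) (dmul b g)) by lin.
pose B x z := btlift (fun a b => F (dmul x h) (dmul a f) (dmul b g)) (dcop z).
have bB : bilinear_map B by rewrite /B; lin.
have <- : B (dunit G) (dunit G) = F h f g.
  by rewrite /B dcop_dunit (btlift_tpure _ _ (b _)) !d1mul.
rewrite -(seqOV bB) exchange_big; apply: eq_bigr => p _.
rewrite btlift_sumf; apply: eq_bigr => q _.
rewrite /B (btlift_dcop_mul _ _ (b _)) btlift_exchange.
by do 2!apply: eq_btlift => ? ?; rewrite !dmulA.
Qed.

Let M_cocycle F : trilinear F -> M12_3 seqO (M12 seqO F) = M1_23 seqO (M23 seqO F).
Proof.
move=> tF; apply: ext3 => h f g.
have tF' : trilinear (fun a b c => F (dmul a h) (dmul b f) (dmul c g)) by split; lin.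
have := seqO_cocycle tF'.
congr (_ = _); apply: eq_bigr => q _; rewrite /M12 /M23 btlift_sumf;
  by apply: eq_bigr => p _; apply: eq_btlift => a b; rewrite !dmulA.
Qed.

(** Inversion reverses the factors:
    $(\Delta\otimes\mathrm{id})(\Omega^{-1})\,\Omega^{-1}_{12}=(\mathrm{id}\otimes\Delta)(\Omega^{-1})\,\Omega^{-1}_{23}$.
    Hence $\Omega^{-1}$ with the convolution product and $\Omega$ with the opposite product satisfy
    one common identity, the field [stw_cocycle] below. *)
Lemma seqV_cocycle F : trilinear F ->
  \sum_(q <- seqV) \sum_(p <- seqV)
    btlift (fun h1 h2 => F (dmul h1 p.1) (dmul h2 p.2) q.2) (dcop q.1) =
  \sum_(q <- seqV) \sum_(p <- seqV)
    btlift (fun h1 h2 => F q.1 (dmul h1 p.1) (dmul h2 p.2)) (dcop q.2).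
Proof.
move=> tF.
have : M12 seqV (M12_3 seqV F) = M23 seqV (M1_23 seqV F).
  (* The two multiplications on the right of the cocycle identity are inserted with their inverses;
     turned by that identity into the two on its left, the inner pair cancels against the left-hand
     side and leaves [F]. *)
  rewrite -[LHS]M23K; last exact/tri12/tri12_3.
  rewrite -[M23 seqO _]M1_23K; last exact/tri23/tri12/tri12_3.
  rewrite -M_cocycle; last exact/tri12/tri12_3.
  by rewrite M12K; [rewrite M12_3K | exact: tri12_3].
move/(congr1 (fun F => F (dunit G) (dunit G) (dunit G))).
rewrite /M12 /M23 /M12_3 /M1_23 exchange_big [RHS]exchange_big.
congr (_ = _); apply: eq_bigr => q _; apply: eq_bigr => p _;
  by apply: eq_btlift => a b; rewrite !dmul1.
Qed.
End Inverse.

End DualCocycle.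

(** * One-sided twists *)

Section Twist.
Variables (k : fieldType) (d : nat) (G : linear_algebraic_group k d).
Local Notation A := (OG G).
Local Notation D := (Defs_rdual__canonical__GRing_Lmodule A).

(* A uniform treatment of the two halves of the cocycle deformation: the twist
   by Ω through the left coactions ([twl]) and by its inverse through the right
   coactions ([twr]). Functionals act on the left through the opposite of their
   convolution product, whence [smul]. *)
Record twist_side := TwistSide {
  smul : D -> D -> D;
  stw : seq (D * D);
  sti : seq (D * D);
  smul_bil : bilinear_map smul;
  smul_dcop : forall (W : lmodType k) (F : D -> D -> W) f g, bilinear_map F ->
    btlift F (dcop (smul f g)) = btlift (fun f1 f2 => btlift (fun g1 g2 =>
      F (smul f1 g1) (smul f2 g2)) (dcop g)) (dcop f);
  stw_cocycle : forall (W : lmodType k) (F : D -> D -> D -> W), trilinear F ->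
    \sum_(q <- stw) \sum_(p <- stw)
      btlift (fun h1 h2 => F (smul h1 p.1) (smul h2 p.2) q.2) (dcop q.1) =
    \sum_(q <- stw) \sum_(p <- stw)
      btlift (fun h1 h2 => F q.1 (smul h1 p.1) (smul h2 p.2)) (dcop q.2);
  stwK : forall (W : lmodType k) (F : D -> D -> W), bilinear_map F ->
    \sum_(p <- stw) \sum_(q <- sti) F (smul p.1 q.1) (smul p.2 q.2) =
    F (dunit G) (dunit G);
  stiK : forall (W : lmodType k) (F : D -> D -> W), bilinear_map F ->
    \sum_(p <- sti) \sum_(q <- stw) F (smul p.1 q.1) (smul p.2 q.2) =
    F (dunit G) (dunit G) }.

Section Sides.
Variable Om : dual_cocycle A.

Lemma bil_dmulV : bilinear_map (fun f g : D => dmul g f).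
Proof. by split=> ?; [exact: lin_dmulr | exact: lin_dmull]. Qed.

Lemma btlift_dcop_mulV (W : lmodType k) (F : D -> D -> W) f g : bilinear_map F ->
  btlift F (dcop (dmul g f)) = btlift (fun f1 f2 => btlift (fun g1 g2 =>
    F (dmul g1 f1) (dmul g2 f2)) (dcop g)) (dcop f).
Proof. by move=> bF; rewrite btlift_dcop_mul // btlift_exchange. Qed.

Lemma seqVO_op (W : lmodType k) (F : D -> D -> W) : bilinear_map F ->
  \sum_(p <- seqO Om) \sum_(q <- seqV Om) F (dmul q.1 p.1) (dmul q.2 p.2) =
  F (dunit G) (dunit G).
Proof. by move=> bF; rewrite exchange_big seqVO. Qed.

Lemma seqOV_op (W : lmodType k) (F : D -> D -> W) : bilinear_map F ->
  \sum_(p <- seqV Om) \sum_(q <- seqO Om) F (dmul q.1 p.1) (dmul q.2 p.2) =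
  F (dunit G) (dunit G).
Proof. by move=> bF; rewrite exchange_big seqOV. Qed.

Definition twl : twist_side := TwistSide bil_dmulV btlift_dcop_mulV
  (@seqO_cocycle _ _ _ Om) seqVO_op seqOV_op.

Definition twr : twist_side := TwistSide (@bil_dmul _ _ G) (@btlift_dcop_mul _ _ G)
  (@seqV_cocycle _ _ _ Om) (@seqVO _ _ _ Om) (@seqOV _ _ _ Om).
End Sides.

Variable S : twist_side.

Definition is_action (M : lmodType k) (a : D -> M -> M) : Prop :=
  [/\ bilinear_map a, forall f g m, a (smul S f g) m = a f (a g m) &
      forall m, a (dunit G) m = m].

Definition equivariant (M N Q : lmodType k) (aM : D -> M -> M) (aN : D -> N -> N)
  (aQ : D -> Q -> Q) (b : M -> N -> Q) : Prop :=
  forall h m n, aQ h (b m n) = btlift (fun h1 h2 => b (aM h1 m) (aN h2 n)) (dcop h).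

Definition twist (M N Q : lmodType k) (aM : D -> M -> M) (aN : D -> N -> N)
  (b : M -> N -> Q) (m : M) (n : N) : Q := \sum_(p <- stw S) b (aM p.1 m) (aN p.2 n).

Lemma bil_twist (M N Q : lmodType k) (aM : D -> M -> M) (aN : D -> N -> N)
    (b : M -> N -> Q) : bilinear_map aM -> bilinear_map aN -> bilinear_map b ->
  bilinear_map (twist aM aN b).
Proof. by move=> bM bN bb; rewrite /twist; lin. Qed.

(** * Associativity of a one-sided twist *)

Section Associativity.
Variables (M N P MN NP Q : lmodType k).
Variables (aM : D -> M -> M) (aN : D -> N -> N) (aP : D -> P -> P).
Variables (aMN : D -> MN -> MN) (aNP : D -> NP -> NP).
Variables (b1 : M -> N -> MN) (b2 : MN -> P -> Q) (b3 : N -> P -> NP) (b4 : M -> NP -> Q).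
Hypotheses (actM : is_action aM) (actN : is_action aN) (actP : is_action aP).
Hypotheses (bMN : bilinear_map aMN) (bNP : bilinear_map aNP).
Hypotheses (bb1 : bilinear_map b1) (bb2 : bilinear_map b2).
Hypotheses (bb3 : bilinear_map b3) (bb4 : bilinear_map b4).
Hypotheses (eq1 : equivariant aM aN aMN b1) (eq3 : equivariant aN aP aNP b3).
Hypothesis b_assoc : forall m n p, b2 (b1 m n) p = b4 m (b3 n p).

(** Equivariance of [b1] and [b3] moves the outer action onto the arguments through $\Delta$. This
    produces the two sides of the cocycle identity for a single trilinear map [F], which [b_assoc]
    writes in two ways. *)
Lemma twist_assoc m n p :
  twist aMN aP b2 (twist aM aN b1 m n) p = twist aM aNP b4 m (twist aN aP b3 n p).
Proof.
have [bM aMM _] := actM; have [bN aNM _] := actN; have [bP aPM _] := actP.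
pose F x y z := b2 (b1 (aM x m) (aN y n)) (aP z p).
have tF : trilinear F by rewrite /F; split; lin.
have FE x y z : F x y z = b4 (aM x m) (b3 (aN y n) (aP z p)) by rewrite /F b_assoc.
transitivity (\sum_(q <- stw S) \sum_(p <- stw S)
      btlift (fun h1 h2 => F (smul S h1 p.1) (smul S h2 p.2) q.2) (dcop q.1)).
  apply: eq_bigr => q _; rewrite /twist.
  have L : linear (fun z => b2 (aMN q.1 z) (aP q.2 p)) by lin.
  rewrite (lin_sumE _ _ L); apply: eq_bigr => r _.
  rewrite eq1 (btlift_comp _ _ (bb2.1 _)).
  by apply: eq_btlift => h1 h2; rewrite /F aMM aNM.
rewrite stw_cocycle //; apply: eq_bigr => q _; rewrite /twist.
have L : linear (fun z => b4 (aM q.1 m) (aNP q.2 z)) by lin.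
rewrite (lin_sumE _ _ L); apply: eq_bigr => r _.
rewrite eq3 (btlift_comp _ _ (bb4.2 _)).
by apply: eq_btlift => h1 h2; rewrite FE aPM aNM.
Qed.
End Associativity.

(** * Equivariance of a one-sided twist *)

Section Equivariance.
Variables (M N Q : lmodType k).
Variables (aM : D -> M -> M) (aN : D -> N -> N) (aQ : D -> Q -> Q).
Variables (cM : D -> M -> M) (cN : D -> N -> N) (cQ : D -> Q -> Q).
Variable b : M -> N -> Q.
Hypothesis (bb : bilinear_map b).

(** The [c]-actions commute with those inside the twist and pass through every summand. With left
    actions as [c] and right actions in the twist, this lets the two halves of the deformation be
    performed one after the other. *)
Lemma twist_equivariant : bilinear_map cQ ->
  (forall f g m, cM f (aM g m) = aM g (cM f m)) ->
  (forall f g m, cN f (aN g m) = aN g (cN f m)) ->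
  equivariant cM cN cQ b -> equivariant cM cN cQ (twist aM aN b).
Proof.
move=> bQ cmM cmN eqb h m m'; rewrite /twist (lin_sumE _ _ (bQ.2 h)) btlift_sumf.
by apply: eq_bigr => p _; rewrite eqb; apply: eq_btlift => h1 h2; rewrite cmM cmN.
Qed.

(** The [sti] factor cancels against the [stw] brought by the outer [twist], equivariance of [b]
    absorbs $\Delta(h)$, and the innermost [stw] becomes the twist on the right-hand side. *)
Lemma twist_covariant h m n :
  is_action aM -> is_action aN -> bilinear_map aQ -> equivariant aM aN aQ b ->
  \sum_(p <- sti S) \sum_(q <- stw S) btlift (fun h1 h2 =>
     twist aM aN b (aM (smul S p.1 (smul S h1 q.1)) m)
                   (aN (smul S p.2 (smul S h2 q.2)) n)) (dcop h)
  = aQ h (twist aM aN b m n).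
Proof.
move=> [bM aMM aM1] [bN aNM aN1] bQ eqb; rewrite exchange_big.
rewrite /twist (lin_sumE _ _ (bQ.2 h)); apply: eq_bigr => q _.
rewrite eqb -btlift_sumf; apply: eq_btlift => h1 h2.
pose F x y := b (aM x (aM (smul S h1 q.1) m)) (aN y (aN (smul S h2 q.2) n)).
have bF : bilinear_map F by rewrite /F; lin.
have := stwK S bF; rewrite exchange_big /F /= aM1 aN1 aMM aNM => <-.
apply: eq_bigr => p _; apply: eq_bigr => r _.
by rewrite !aMM !aNM.
Qed.
End Equivariance.

(** * Diagonal action and invertible twist operator on a tensor product *)

Section TensorAction.
Variables (U W : lmodType k) (aU : D -> U -> U) (aW : D -> W -> W).
Hypotheses (actU : is_action aU) (actW : is_action aW).

Definition tens_act (h : D) (z : U ⊠ W) : U ⊠ W :=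
  btlift (fun h1 h2 => tmap (aU h1) (aW h2) z) (dcop h).

Lemma bil_tens_act : bilinear_map tens_act.
Proof.
have [bU _ _] := actU; have [bW _ _] := actW.
have L f g : linear (tmap (aU f) (aW g)) by apply: lin_tmap; [exact: bU.2 | exact: bW.2].
split=> [z|h]; rewrite /tens_act; last by lin.
by rewrite /tmap; lin.
Qed.

Lemma tens_actE h u w :
  tens_act h (u ⊗ w) = btlift (fun h1 h2 => aU h1 u ⊗ aW h2 w) (dcop h).
Proof.
have [bU _ _] := actU; have [bW _ _] := actW.
by apply: eq_btlift => f g; rewrite tmapE //; [exact: bU.2 | exact: bW.2].
Qed.

Lemma tens_act_ev x u w : tens_act (ev x) (u ⊗ w) = aU (ev x) u ⊗ aW (ev x) w.
Proof.
have [bU _ _] := actU; have [bW _ _] := actW.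
by rewrite tens_actE dcop_ev btlift_tpure //; lin.
Qed.

Lemma is_action_tens : is_action tens_act.
Proof.
have b := bil_tens_act; have [bU aUM aU1] := actU; have [bW aWM aW1] := actW.
split=> // [f g|] z.
  have L : linear (fun z => tens_act f (tens_act g z)) by lin.
  apply: (tens_ext (b.2 _) L) z.
  move=> u w; rewrite !tens_actE smul_dcop; last by lin.
  rewrite btlift_exchange (btlift_comp _ _ (b.2 f)).
  by apply: eq_btlift => g1 g2; rewrite tens_actE; apply: eq_btlift => f1 f2; rewrite aUM aWM.
apply: (tens_ext (g := id) (b.2 (dunit G))) z => //.
by move=> u w; rewrite dunit_ev tens_act_ev -dunit_ev aU1 aW1.
Qed.

Definition tw_op (s : seq (D * D)) (z : U ⊠ W) : U ⊠ W :=
  \sum_(p <- s) tmap (aU p.1) (aW p.2) z.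

Lemma lin_tw_op s : linear (tw_op s).
Proof.
have [bU _ _] := actU; have [bW _ _] := actW.
by apply: lin_sum => p; apply: lin_tmap; [exact: bU.2 | exact: bW.2].
Qed.

Lemma tw_opE s u w : tw_op s (u ⊗ w) = \sum_(p <- s) aU p.1 u ⊗ aW p.2 w.
Proof.
have [bU _ _] := actU; have [bW _ _] := actW.
by apply: eq_bigr => p _; rewrite tmapE //; [exact: bU.2 | exact: bW.2].
Qed.

Lemma stwK_op z : tw_op (stw S) (tw_op (sti S) z) = z.
Proof.
have L := lin_tw_op; have [bU aUM aU1] := actU; have [bW aWM aW1] := actW.
apply: (tens_ext (g := id) (lin_comp (L _) (L _))) z => //.
move=> u w; rewrite tw_opE (lin_sumE _ _ (L _)).
under eq_bigr do rewrite tw_opE.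
have bF : bilinear_map (fun f g => aU f u ⊗ aW g w) by lin.
rewrite exchange_big -[RHS](congr2 (fun u w => u ⊗ w) (aU1 u) (aW1 w)) -(stwK S bF).
by apply: eq_bigr => p _; apply: eq_bigr => q _; rewrite aUM aWM.
Qed.

Lemma stiK_op z : tw_op (sti S) (tw_op (stw S) z) = z.
Proof.
have L := lin_tw_op; have [bU aUM aU1] := actU; have [bW aWM aW1] := actW.
apply: (tens_ext (g := id) (lin_comp (L _) (L _))) z => //.
move=> u w; rewrite tw_opE (lin_sumE _ _ (L _)).
under eq_bigr do rewrite tw_opE.
have bF : bilinear_map (fun f g => aU f u ⊗ aW g w) by lin.
rewrite exchange_big -[RHS](congr2 (fun u w => u ⊗ w) (aU1 u) (aW1 w)) -(stiK S bF).
by apply: eq_bigr => p _; apply: eq_bigr => q _; rewrite aUM aWM.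
Qed.
End TensorAction.
End Twist.

(** * Antipode and regular families of operators *)

Section Antipode.
Variables (k : fieldType) (d : nat) (G : linear_algebraic_group k d).
Local Notation A := (OG G).
Implicit Types (x y : lag_pt G) (a b : A).

Lemma regular_fun_sum (I : Type) (r : seq I) (F : I -> lag_pt G -> k^o) :
  (forall i, regular_fun (F i)) -> regular_fun (fun x => \sum_(i <- r) F i x).
Proof.
move=> rF; elim: r => [|i r IHr].
  rewrite (_ : (fun _ => _) = fun=> 0); first exact: RegCst.
  by apply/funext => x; rewrite big_nil.
rewrite (_ : (fun _ => _) = F i + fun x => \sum_(j <- r) F j x); first exact: RegAdd.
by apply/funext => x; rewrite big_cons.
Qed.

Lemma regular_fun_prod (I : Type) (r : seq I) (F : I -> lag_pt G -> k^o) :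
  (forall i, regular_fun (F i)) -> regular_fun (fun x => \prod_(i <- r) F i x).
Proof.
move=> rF; elim: r => [|i r IHr].
  rewrite (_ : (fun _ => _) = fun=> 1); first exact: RegCst.
  by apply/funext => x; rewrite big_nil.
rewrite (_ : (fun _ => _) = fun x => F i x * \prod_(j <- r) F j x); first exact: RegMul.
by apply/funext => x; rewrite big_cons.
Qed.

Lemma regular_fun_det m (F : 'I_m -> 'I_m -> lag_pt G -> k^o) :
  (forall i j, regular_fun (F i j)) ->
  regular_fun (fun x => \det (\matrix_(i, j) F i j x)).
Proof.
move=> rF; apply: regular_fun_sum => s; apply: RegMul; first exact: RegCst.
by apply: regular_fun_prod => i; under eq_fun do rewrite mxE.
Qed.

Lemma lag_unit x : lag_val x \in unitmx.
Proof.
have [S _ /(congr1 (fun P => P (lag_val x))) E] := lag_closed G.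
have : lag_pts G (lag_val x) by exact: asboolW (valP x).
by rewrite E => -[].
Qed.

Definition lag_inv x : lag_pt G :=
  Sub (invmx (val x)) (asboolT (lag_invP (asboolW (valP x)))).

Lemma lag_mulV x : lag_mul x (lag_inv x) = lag_e G.
Proof. by apply/val_inj; rewrite /= mulmxV // lag_unit. Qed.

Lemma lag_mulVl x : lag_mul (lag_inv x) x = lag_e G.
Proof. by apply/val_inj; rewrite /= mulVmx // lag_unit. Qed.

Lemma lag_invM x y : lag_inv (lag_mul x y) = lag_mul (lag_inv y) (lag_inv x).
Proof.
rewrite -[RHS]lag_mul1 -(lag_mulV (lag_mul x y)) lag_mulA.
by rewrite -[lag_mul _ (lag_mul x y)]lag_mulA (lag_mulA _ x y) lag_mulVl lag_1mul
  lag_mulVl lag_1mul.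
Qed.

(** Inversion preserves the generators: the entries of the inverse are cofactors over the
    determinant, and the reciprocal determinant of the inverse is the determinant. *)
Lemma regular_fun_inv (F : lag_pt G -> k^o) : regular_fun F ->
  regular_fun (fun x => F (lag_inv x)).
Proof.
elim=> {F} [c|i j||F F' _ rF _ rF'|F F' _ rF _ rF'].
- exact: RegCst.
- rewrite (_ : (fun _ => _) = fun x => (\det (lag_val x))^-1 *
      ((-1) ^+ (j + i) * \det (\matrix_(a, b) lag_val x (lift j a) (lift i b)))).
    apply: (RegMul (RegDetV G)); apply: RegMul; first exact: RegCst.
    by apply: regular_fun_det => a b; exact: RegCoord.
  apply/funext => x; rewrite -[LHS]/(invmx (lag_val x) i j) /invmx (lag_unit x) !mxE.
  congr (_ * (_ * \det _)).
  by apply/matrixP => a b; rewrite !mxE.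
- rewrite (_ : (fun _ => _) = fun x => \det (\matrix_(a, b) lag_val x a b)).
    by apply: regular_fun_det => a b; exact: RegCoord.
  apply/funext => x.
  rewrite -[LHS]/((\det (invmx (lag_val x)))^-1) det_inv invrK; congr (\det _).
  by apply/matrixP => a b; rewrite mxE.
- exact: RegAdd.
- exact: RegMul.
Qed.

Definition antipode a : A :=
  Regular (asboolT (regular_fun_inv (asboolW (regularP a)))).

Lemma antipodeE a x : regular_val (antipode a) x = regular_val a (lag_inv x).
Proof. by []. Qed.

Lemma lin_antipode : linear antipode.
Proof. by move=> c a b; apply: regular_ext => x. Qed.

Lemma lin_hcop_pt (W : lmodType k) (F : A -> A -> W) a : bilinear_map F ->
  exists s : seq (A * A), sweedler a F = \sum_(p <- s) F p.1 p.2 /\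
    (forall x y, \sum_(p <- s) regular_val p.1 x * regular_val p.2 y
      = regular_val a (lag_mul x y)).
Proof.
move=> bF; have [s sE sP] := hcop_sum a; exists s; split => //.
exact: sweedler_rep.
Qed.

Lemma antipode_l a :
  sweedler a (fun a1 a2 => hmul (antipode a1) a2) = hcounit a *: (hone : A).
Proof.
have b : bilinear_map (fun a1 a2 : A => hmul (antipode a1) a2).
  split=> z; last exact: lin_hmulr.
  exact: (lin_comp (lin_hmull z) lin_antipode).
have [s [-> sP]] := lin_hcop_pt a b; apply: regular_ext => x.
rewrite (lin_sumE _ _ (lin_pt x)) -[RHS]/(regular_val a (lag_e G) * 1) mulr1.
rewrite -(lag_mulVl x) -sP.
by apply: eq_bigr => p _.
Qed.

Lemma antipode_r a :
  sweedler a (fun a1 a2 => hmul a1 (antipode a2)) = hcounit a *: (hone : A).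
Proof.
have b : bilinear_map (fun a1 a2 : A => hmul a1 (antipode a2)).
  split=> z; first exact: lin_hmull.
  exact: (lin_comp (lin_hmulr z) lin_antipode).
have [s [-> sP]] := lin_hcop_pt a b; apply: regular_ext => x.
rewrite (lin_sumE _ _ (lin_pt x)) -[RHS]/(regular_val a (lag_e G) * 1) mulr1.
rewrite -(lag_mulV x) -sP.
by apply: eq_bigr => p _.
Qed.
End Antipode.

(** * Families of operators determined by the points of the group *)

Section Rational.
Variables (k : fieldType) (d : nat) (G : linear_algebraic_group k d).
Local Notation A := (OG G).
Local Notation D := (Defs_rdual__canonical__GRing_Lmodule A).

(** The families $h\mapsto F(h)$ that arise from a coaction, as pairings with one fixed tensor. Such
    a tensor is determined by its pairings with points, so two such families agree as soon as they
    agree on every [ev x]. *)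
Definition regfam (W : lmodType k) (F : D -> W) : Prop :=
  exists t : W ⊠ A, forall h, F h = btlift (fun w a => rdual_val h a *: w) t.

Lemma bil_pairr (W : lmodType k) (h : D) :
  bilinear_map (fun (w : W) (a : A) => rdual_val h a *: w).
Proof.
split=> z; last exact: lin_scalel (lin_rdual h).
by apply: lin_scale; exact: lin_id.
Qed.

Lemma bil_pairl (W : lmodType k) (h : D) :
  bilinear_map (fun (a : A) (w : W) => rdual_val h a *: w).
Proof.
split=> z; first exact: lin_scalel (lin_rdual h).
by apply: lin_scale; exact: lin_id.
Qed.

Lemma pairr_sep (W : lmodType k) (t t' : W ⊠ A) :
  (forall x : lag_pt G, btlift (fun w (a : A) => rdual_val (ev x) a *: w) t =
             btlift (fun w (a : A) => rdual_val (ev x) a *: w) t') -> t = t'.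
Proof.
move=> tt'; apply/eqP; rewrite -subr_eq0; apply/eqP.
apply: (@tens_sep_r _ W A (fun e => exists x, e = rdual_val (ev x))).
- by move=> _ [x ->]; exact: lin_rdual.
- move=> a a0; apply: regular_ext => x.
  by have := a0 (rdual_val (ev x)); apply; exists x.
move=> _ [x ->]; rewrite (linB _ _ (btlift_tlinear (bil_pairr W (ev x)))).
by rewrite tt' subrr.
Qed.

Lemma pairl_sep (W : lmodType k) (t t' : A ⊠ W) :
  (forall x : lag_pt G, btlift (fun (a : A) w => rdual_val (ev x) a *: w) t =
             btlift (fun (a : A) w => rdual_val (ev x) a *: w) t') -> t = t'.
Proof.
move=> tt'; apply/eqP; rewrite -subr_eq0; apply/eqP.
apply: (@tens_sep_l _ A W (fun e => exists x, e = rdual_val (ev x))).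
- by move=> _ [x ->]; exact: lin_rdual.
- move=> a a0; apply: regular_ext => x.
  by have := a0 (rdual_val (ev x)); apply; exists x.
move=> _ [x ->]; rewrite (linB _ _ (btlift_tlinear (bil_pairl W (ev x)))).
by rewrite tt' subrr.
Qed.

Lemma regfam_ext (W : lmodType k) (F F' : D -> W) : regfam F -> regfam F' ->
  (forall x, F (ev x) = F' (ev x)) -> forall h, F h = F' h.
Proof.
move=> [t tE] [t' t'E] FF' h; rewrite tE t'E; congr (btlift _ _).
by apply: pairr_sep => x; rewrite -tE -t'E.
Qed.

Lemma regfam_comp (W W' : lmodType k) (L : W -> W') (F : D -> W) : linear L ->
  regfam F -> regfam (fun h => L (F h)).
Proof.
move=> lL [t tE]; exists (tmap L id t) => h.
rewrite tE /tmap (btlift_comp _ _ lL) (btlift_comp _ _ (btlift_tlinear (bil_pairr W' h))).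
apply: eq_btlift => w a; rewrite (linZ _ _ lL) btlift_tpure //.
exact: bil_pairr.
Qed.

(** The $A$-legs of the two tensors are multiplied, because $\Delta(h)$ is dual to the product of
    $A$. *)
Lemma regfam_dcop (M N W : lmodType k) (b : M -> N -> W) (F : D -> M) (F' : D -> N) :
  bilinear_map b -> regfam F -> regfam F' ->
  regfam (fun h => btlift (fun h1 h2 => b (F h1) (F' h2)) (dcop h)).
Proof.
move=> bb [t tE] [t' t'E].
have [s sE] := tens_sum t; have [s' s'E] := tens_sum t'.
exists (\sum_(p <- s) \sum_(q <- s') b p.1 q.1 ⊗ hmul p.2 q.2) => h.
have FE f : F f = \sum_(p <- s) rdual_val f p.2 *: p.1.
  by rewrite tE sE btlift_tsum //; exact: bil_pairr.
have F'E f : F' f = \sum_(q <- s') rdual_val f q.2 *: q.1.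
  by rewrite t'E s'E btlift_tsum //; exact: bil_pairr.
have L := btlift_tlinear (bil_pairr W h).
rewrite (lin_sumE _ _ L).
under [RHS]eq_bigr => p _ do rewrite (btlift_tsum _ _ _ (bil_pairr W h)).
under eq_btlift => f g.
  rewrite FE F'E (lin_sumE _ _ (bb.1 _)).
  under eq_bigr => p _ do rewrite (lin_sumE _ _ (bb.2 _)).
  over.
rewrite btlift_sumf; apply: eq_bigr => p _.
rewrite btlift_sumf; apply: eq_bigr => q _.
rewrite -(dcopE h) /pairing2.
have Lw : linear (fun c : k^o => c *: b p.1 q.1).
  by move=> c x y; rewrite scalerDl -scalerA.
rewrite (btlift_comp _ _ Lw); apply: eq_btlift => f g.
by rewrite (linZ _ _ (bb.1 _)) (linZ _ _ (bb.2 _)) scalerA.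
Qed.

(** Both sides are regular families in [h], and at [ev x] the coproduct is
    $\mathrm{ev}_x\otimes\mathrm{ev}_x$; so equivariance under points gives equivariance under all
    functionals. *)
Lemma equivariant_pt (M N Q : lmodType k) (aM : D -> M -> M) (aN : D -> N -> N)
    (aQ : D -> Q -> Q) (b : M -> N -> Q) : bilinear_map b ->
  bilinear_map aM -> bilinear_map aN ->
  (forall m, regfam (fun h => aM h m)) -> (forall m, regfam (fun h => aN h m)) ->
  (forall m, regfam (fun h => aQ h m)) ->
  (forall x m n, aQ (ev x) (b m n) = b (aM (ev x) m) (aN (ev x) n)) ->
  equivariant aM aN aQ b.
Proof.
move=> bb bM bN rM rN rQ pt h m n.
apply: (regfam_ext (F := fun h => aQ h (b m n)) (F' := fun h => btlift _ (dcop h))) => //.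
  exact: regfam_dcop.
by move=> x; rewrite pt dcop_ev btlift_tpure //; lin.
Qed.

Lemma regfam_sum (W : lmodType k) (I : Type) (s : seq I) (F : I -> D -> W) :
  (forall i, regfam (F i)) -> regfam (fun h => \sum_(i <- s) F i h).
Proof.
move=> rF; pose t i := sval (cid (rF i)); exists (\sum_(i <- s) t i) => h.
rewrite (lin_sumE _ _ (btlift_tlinear (bil_pairr W h))).
by apply: eq_bigr => i _; exact: (svalP (cid (rF i)) h).
Qed.

Lemma regfam_tens_act (S : twist_side G) (U W : lmodType k) (aU : D -> U -> U)
    (aW : D -> W -> W) z :
  is_action S aU -> is_action S aW ->
  (forall m, regfam (fun h => aU h m)) -> (forall m, regfam (fun h => aW h m)) ->
  regfam (fun h => tens_act aU aW h z).
Proof.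
move=> actU actW rU rW; have b := bil_tens_act actU actW.
have [s ->] := tens_sum z.
rewrite (_ : (fun h => _) = fun h => \sum_(p <- s) tens_act aU aW h (p.1 ⊗ p.2)).
  apply: regfam_sum => p; rewrite (_ : (fun h => _) = fun h =>
    btlift (fun h1 h2 => aU h1 p.1 ⊗ aW h2 p.2) (dcop h)).
    have bt : bilinear_map (fun (u : U) (w : W) => u ⊗ w) by lin.
    exact: (regfam_dcop bt (rU p.1) (rW p.2)).
  by apply/funext => h; rewrite (tens_actE actU actW).
by apply/funext => h; rewrite (lin_sumE _ _ (b.2 h)).
Qed.

Lemma regfam_rhoA a : regfam (fun h : D => rhoA h a).
Proof. by exists (hcop a). Qed.

Lemma regfam_lamA a : regfam (fun h : D => lamA h a).
Proof.
exists (btlift (fun a1 a2 => a2 ⊗ a1) (hcop a)) => h.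
rewrite (btlift_comp _ _ (btlift_tlinear (bil_pairr A h))).
by apply: eq_btlift => a1 a2; rewrite btlift_tpure //; exact: bil_pairr.
Qed.
End Rational.

(** * Actions of the restricted dual on a bicovariant bimodule *)

Section Coactions.
Variables (k : fieldType) (d : nat) (G : linear_algebraic_group k d).
Local Notation A := (OG G).
Local Notation D := (Defs_rdual__canonical__GRing_Lmodule A).
Variable Om : dual_cocycle A.

Lemma is_action_rhoA : is_action (twr Om) (@rhoA k d G).
Proof.
split=> [|f g a|a]; last exact: rhoA1.
  by split=> z; [exact: lin_rhoA_l | exact: lin_rhoA].
exact: rhoA_mul.
Qed.

Lemma is_action_lamA : is_action (twl Om) (@lamA k d G).
Proof.
split=> [|f g a|a]; last exact: lamA1.
  by split=> z; [exact: lin_lamA_l | exact: lin_lamA].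
exact: lamA_mul.
Qed.

Lemma equivariant_rhoA_mul :
  equivariant (@rhoA k d G) (@rhoA k d G) (@rhoA k d G) (@hmul k A).
Proof.
apply: equivariant_pt; do ?by [exact: regfam_rhoA | exact: bil_rhoA].
  by split=> z; [exact: lin_hmull | exact: lin_hmulr].
by move=> x a b; apply: regular_ext => y; rewrite rhoA_ev /= !rhoA_ev.
Qed.

Lemma equivariant_lamA_mul :
  equivariant (@lamA k d G) (@lamA k d G) (@lamA k d G) (@hmul k A).
Proof.
apply: equivariant_pt; do ?by [exact: regfam_lamA | exact: bil_lamA].
  by split=> z; [exact: lin_hmull | exact: lin_hmulr].
by move=> x a b; apply: regular_ext => y; rewrite lamA_ev /= !lamA_ev.
Qed.

Variable E : bimod A.
Hypothesis hE : is_bicovariant E.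

Definition rhoE (h : D) (e : E) : E := btlift (fun m a => rdual_val h a *: m) (rcoact E e).
Definition lamE (h : D) (e : E) : E := btlift (fun a m => rdual_val h a *: m) (lcoact E e).

Lemma lin_lcoact : linear (lcoact E).
Proof. by move=> c x y; rewrite linearP. Qed.
Lemma lin_rcoact : linear (rcoact E).
Proof. by move=> c x y; rewrite linearP. Qed.

Lemma bil_rhoE : bilinear_map rhoE.
Proof.
split=> [e|h]; first by apply: lin_btlift => m a; exact: (lin_scalel _ (lin_eval a)).
exact: lin_btlift_arg (bil_pairr E h) lin_rcoact.
Qed.

Lemma bil_lamE : bilinear_map lamE.
Proof.
split=> [e|h]; first by apply: lin_btlift => m a; exact: (lin_scalel _ (lin_eval m)).
exact: lin_btlift_arg (bil_pairl E h) lin_lcoact.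
Qed.

Lemma regfam_rhoE e : regfam (fun h => rhoE h e).
Proof. by exists (rcoact E e). Qed.

Lemma regfam_lamE e : regfam (fun h => lamE h e).
Proof.
exists (btlift (fun a m => m ⊗ a) (lcoact E e)) => h.
rewrite (btlift_comp _ _ (btlift_tlinear (bil_pairr E h))).
by apply: eq_btlift => a m; rewrite btlift_tpure //; exact: bil_pairr.
Qed.

Lemma bil_lact : bilinear_map (@lact k A E).
Proof. by case: hE => [[[]]]. Qed.
Lemma bil_ract : bilinear_map (@ract k A E).
Proof. by case: hE => [[]]. Qed.

(** [Phi] pairs the two $A$-legs of the coassociativity identity with the two functionals, which
    turns it into a composition of operators. The same device serves [lamE_mul] and, with the
    identity for commuting coactions, [lamE_rhoE]. *)
Lemma rhoE_mul f g e : rhoE (dmul f g) e = rhoE f (rhoE g e).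
Proof.
have [_ _ [[_ rc] _ _] _] := hE.
pose Phi : (E ⊠ A) ⊠ A -> E := btlift (fun y b =>
  rdual_val g b *: btlift (fun m a => rdual_val f a *: m) y).
have bP : bilinear_map (fun (y : E ⊠ A) (b : A) =>
    rdual_val g b *: btlift (fun m a => rdual_val f a *: m) y).
  split=> z; last exact: lin_scalel (lin_rdual g).
  by apply: lin_scale; exact: btlift_tlinear (bil_pairr E f).
have lP : linear Phi by exact: btlift_tlinear.
have := congr1 Phi (rc e); rewrite !(btlift_comp _ _ lP).
rewrite [X in _ = X](_ : _ = rhoE f (rhoE g e)) => [<-|].
  apply: eq_btlift => m a; rewrite (btlift_comp _ _ lP) rdual_mulE /sweedler.
  have L : linear (fun c : k^o => c *: m) by move=> c x y; rewrite scalerDl -scalerA.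
  rewrite (btlift_comp _ _ L); apply: eq_btlift => a1 a2.
  rewrite /Phi (btlift_tpure _ _ bP) btlift_tpure; last exact: bil_pairr.
  by rewrite scalerA mulrC.
rewrite [in RHS]/rhoE -/(rhoE f _) (btlift_comp _ _ (bil_rhoE.2 f)).
apply: eq_btlift => m a; rewrite /Phi (btlift_tpure _ _ bP).
by rewrite (linZ _ _ (bil_rhoE.2 f)).
Qed.

Lemma lamE_mul f g e : lamE (dmul f g) e = lamE g (lamE f e).
Proof.
have [_ [[_ lc] _ _] _ _] := hE.
pose Phi : A ⊠ (A ⊠ E) -> E := btlift (fun b y =>
  rdual_val f b *: btlift (fun a m => rdual_val g a *: m) y).
have bP : bilinear_map (fun (b : A) (y : A ⊠ E) =>
    rdual_val f b *: btlift (fun a m => rdual_val g a *: m) y).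
  split=> z; first exact: lin_scalel (lin_rdual f).
  by apply: lin_scale; exact: btlift_tlinear (bil_pairl E g).
have lP : linear Phi by exact: btlift_tlinear.
have := congr1 Phi (lc e); rewrite !(btlift_comp _ _ lP).
rewrite [X in _ = X](_ : _ = lamE g (lamE f e)) => [<-|].
  apply: eq_btlift => a m; rewrite (btlift_comp _ _ lP) rdual_mulE /sweedler.
  have L : linear (fun c : k^o => c *: m) by move=> c x y; rewrite scalerDl -scalerA.
  rewrite (btlift_comp _ _ L); apply: eq_btlift => a1 a2.
  rewrite /Phi (btlift_tpure _ _ bP) btlift_tpure; last exact: bil_pairl.
  by rewrite scalerA.
rewrite [in RHS]/lamE -/(lamE g _) (btlift_comp _ _ (bil_lamE.2 g)).
apply: eq_btlift => a m; rewrite /Phi (btlift_tpure _ _ bP).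
by rewrite (linZ _ _ (bil_lamE.2 g)).
Qed.

Lemma rhoE1 e : rhoE (dunit G) e = e.
Proof.
have [_ _ [[ru _] _ _] _] := hE; rewrite -[RHS]ru.
by apply: eq_btlift => m a; rewrite rdual_oneE.
Qed.

Lemma lamE1 e : lamE (dunit G) e = e.
Proof.
have [_ [[lu _] _ _] _ _] := hE; rewrite -[RHS]lu.
by apply: eq_btlift => a m; rewrite rdual_oneE.
Qed.

Lemma is_action_rhoE : is_action (twr Om) rhoE.
Proof. by split; [exact: bil_rhoE | exact: rhoE_mul | exact: rhoE1]. Qed.

Lemma is_action_lamE : is_action (twl Om) lamE.
Proof. by split; [exact: bil_lamE | move=> f g e; exact: lamE_mul | exact: lamE1]. Qed.

Lemma lamE_rhoE f g e : lamE f (rhoE g e) = rhoE g (lamE f e).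
Proof.
have [_ _ _ cc] := hE.
pose Phi : A ⊠ (E ⊠ A) -> E := btlift (fun b y =>
  rdual_val f b *: btlift (fun m a => rdual_val g a *: m) y).
have bP : bilinear_map (fun (b : A) (y : E ⊠ A) =>
    rdual_val f b *: btlift (fun m a => rdual_val g a *: m) y).
  split=> z; first exact: lin_scalel (lin_rdual f).
  by apply: lin_scale; exact: btlift_tlinear (bil_pairr E g).
have lP : linear Phi by exact: btlift_tlinear.
have := congr1 Phi (cc e); rewrite !(btlift_comp _ _ lP) => H.
transitivity (btlift (fun a m => Phi (a ⊗ rcoact E m)) (lcoact E e)); last first.
  rewrite [RHS](btlift_comp _ _ (bil_rhoE.2 g)); apply: eq_btlift => a m.
  by rewrite /Phi (btlift_tpure _ _ bP) (linZ _ _ (bil_rhoE.2 g)).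
rewrite H [LHS](btlift_comp _ _ (bil_lamE.2 f)); apply: eq_btlift => m a.
rewrite (btlift_comp _ _ lP) (linZ _ _ (bil_lamE.2 f)) /lamE.
rewrite (btlift_comp _ _ (lin_scale _ (@lin_id _ _))); apply: eq_btlift => b m'.
rewrite /Phi (btlift_tpure _ _ bP) btlift_tpure; last exact: bil_pairr.
by rewrite !scalerA mulrC.
Qed.

Lemma equivariant_rhoE_lact : equivariant (@rhoA k d G) rhoE rhoE (@lact k A E).
Proof.
have [_ _ [_ rl _] _] := hE; have bl := bil_lact.
apply: equivariant_pt; do ?by [exact: regfam_rhoA | exact: regfam_rhoE |
  exact: bil_rhoA | exact: bil_rhoE | exact: bil_lact].
move=> x a e; rewrite {1}/rhoE rl /sweedler.
rewrite (btlift_comp _ _ (btlift_tlinear (bil_pairr E (ev x)))).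
rewrite /rhoA /sweedler (btlift_comp _ _ (bl.1 _)); apply: eq_btlift => a1 a2.
rewrite (btlift_comp _ _ (btlift_tlinear (bil_pairr E (ev x)))).
rewrite /rhoE (btlift_comp _ _ (bl.2 _)); apply: eq_btlift => m b.
rewrite btlift_tpure; last exact: bil_pairr.
by rewrite (linZ _ _ (bl.1 _)) (linZ _ _ (bl.2 _)) scalerA.
Qed.

Lemma equivariant_lamE_lact : equivariant (@lamA k d G) lamE lamE (@lact k A E).
Proof.
have [_ [_ ll _] _ _] := hE; have bl := bil_lact.
apply: equivariant_pt; do ?by [exact: regfam_lamA | exact: regfam_lamE |
  exact: bil_lamA | exact: bil_lamE | exact: bil_lact].
move=> x a e; rewrite {1}/lamE ll /sweedler.
rewrite (btlift_comp _ _ (btlift_tlinear (bil_pairl E (ev x)))).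
rewrite /lamA /sweedler (btlift_comp _ _ (bl.1 _)); apply: eq_btlift => a1 a2.
rewrite (btlift_comp _ _ (btlift_tlinear (bil_pairl E (ev x)))).
rewrite /lamE (btlift_comp _ _ (bl.2 _)); apply: eq_btlift => b m.
rewrite btlift_tpure; last exact: bil_pairl.
by rewrite (linZ _ _ (bl.1 _)) (linZ _ _ (bl.2 _)) scalerA.
Qed.

Hypothesis ractE : forall (a : A) (e : E), ract e a = lact a e.

(** As both actions agree, this is the left case with arguments exchanged; at a point the exchange
    is harmless, the coproduct of [ev x] being symmetric. *)
Lemma equivariant_rhoE_ract : equivariant rhoE (@rhoA k d G) rhoE (@ract k A E).
Proof.
apply: equivariant_pt; do ?by [exact: regfam_rhoA | exact: regfam_rhoE |
  exact: bil_rhoA | exact: bil_rhoE | exact: bil_ract].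
move=> x e a; rewrite !ractE equivariant_rhoE_lact dcop_ev btlift_tpure //.
have bl := bil_lact; have br := bil_rhoE; have ba := @bil_rhoA _ _ G.
by lin.
Qed.

Lemma equivariant_lamE_ract : equivariant lamE (@lamA k d G) lamE (@ract k A E).
Proof.
apply: equivariant_pt; do ?by [exact: regfam_lamA | exact: regfam_lamE |
  exact: bil_lamA | exact: bil_lamE | exact: bil_ract].
move=> x e a; rewrite !ractE equivariant_lamE_lact dcop_ev btlift_tpure //.
have bl := bil_lact; have br := bil_lamE; have ba := @bil_lamA _ _ G.
by lin.
Qed.
End Coactions.

(** * Coinvariants of a classical bicovariant bimodule *)

Section Coinvariants.
Variables (k : fieldType) (d : nat) (G : linear_algebraic_group k d).
Local Notation A := (OG G).
Local Notation D := (Defs_rdual__canonical__GRing_Lmodule A).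
Variable Om : dual_cocycle A.
Variable E : bimod A.
Hypothesis hE : is_bicovariant E.
Variables (V : lmodType k) (incl : V -> E).
Hypotheses (lin_incl : linear incl) (inj_incl : injective incl).
Hypothesis incl_coinv : forall v, lcoact E (incl v) = (hone : A) ⊗ incl v.
Hypothesis incl_surj : forall e, lcoact E e = (hone : A) ⊗ e -> exists v, incl v = e.

Let bl := bil_lact hE.

Lemma lamE_incl h v : lamE h (incl v) = (rdual_val h hone : k) *: incl v.
Proof. by rewrite /lamE incl_coinv btlift_tpure //; exact: bil_pairl. Qed.

Lemma coinv_pre e : (forall x, lamE (ev x) e = e) -> exists v, incl v = e.
Proof.
move=> le; apply: incl_surj; apply: pairl_sep => x.
rewrite [LHS]le btlift_tpure; last exact: bil_pairl.
by rewrite -[X in X *: _]/(1 : k) scale1r.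
Qed.

Lemma rhoV_ex h v : exists u, incl u = rhoE h (incl v).
Proof. by apply: coinv_pre => x; rewrite (lamE_rhoE hE) lamE_incl scale1r. Qed.

Definition rhoV h v : V := sval (cid (rhoV_ex h v)).

Lemma incl_rhoV h v : incl (rhoV h v) = rhoE h (incl v).
Proof. exact: (svalP (cid (rhoV_ex h v))). Qed.

Lemma is_action_rhoV : is_action (twr Om) rhoV.
Proof.
have [bE mE oE] := is_action_rhoE Om hE.
split=> [|f g v|v]; try by apply: inj_incl; rewrite !incl_rhoV (mE, oE).
split=> [v c f g|h c v w]; apply: inj_incl; rewrite lin_incl !incl_rhoV.
  exact: bE.1.
by rewrite lin_incl bE.2.
Qed.

(** The projection $e\mapsto S(e_{(-1)})e_{(0)}$ onto the left coinvariants. *)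
Definition pcoinv (e : E) : E := btlift (fun a m => lact (antipode a) m) (lcoact E e).

Let bS : bilinear_map (fun (a : A) (m : E) => lact (antipode a) m).
Proof.
split=> z; first exact: (lin_comp (bl.1 z) (@lin_antipode _ _ G)).
exact: bl.2.
Qed.

Lemma lin_pcoinv : linear pcoinv.
Proof. exact: lin_btlift_arg bS (@lin_lcoact _ _ _ E). Qed.

Lemma dmul_ev (x y : lag_pt G) : dmul (ev x) (ev y) = ev (lag_mul x y).
Proof. by apply: rdual_ext => a; rewrite dmul_lamA; exact: lamA_ev. Qed.

Lemma lamE_ev_lact x (a : A) (e : E) :
  lamE (ev x) (lact a e) = lact (lamA (ev x) a) (lamE (ev x) e).
Proof.
rewrite (equivariant_lamE_lact hE) dcop_ev btlift_tpure //.
have bE := bil_lamE E; have bA := @bil_lamA _ _ G.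
by lin.
Qed.

(** Left translation by $x$ of $S(a)$ is $S$ of the right translate of $a$ by $x^{-1}$. In the
    coaction this translate of the first leg cancels the action of $x$ on the second. *)
Lemma lamE_pcoinv x e : lamE (ev x) (pcoinv e) = pcoinv e.
Proof.
have bE := bil_lamE E.
have lr : linear (@rhoA k d G (ev (lag_inv x))) by exact: lin_rhoA.
transitivity (btlift (fun a m => lact (antipode a) m)
    (tmap (@rhoA k d G (ev (lag_inv x))) (lamE (ev x)) (lcoact E e))).
  rewrite /pcoinv (btlift_comp _ _ (bE.2 _)) /tmap (btlift_comp _ _ (btlift_tlinear bS)).
  apply: eq_btlift => a m; rewrite lamE_ev_lact (btlift_tpure _ _ bS).
  congr (lact _ _); apply: regular_ext => y.
  by rewrite lamA_ev !antipodeE rhoA_ev lag_invM.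
congr (btlift _ _); apply: pairl_sep => y.
rewrite /tmap (btlift_comp _ _ (btlift_tlinear (bil_pairl E (ev y)))).
transitivity (lamE (ev x) (lamE (ev (lag_mul y (lag_inv x))) e)).
  rewrite [RHS](btlift_comp _ _ (bE.2 _)); apply: eq_btlift => a m.
  rewrite btlift_tpure; last exact: bil_pairl.
  by rewrite (linZ _ _ (bE.2 _)); congr (_ *: _); exact: rhoA_ev.
by rewrite -(lamE_mul hE) dmul_ev -lag_mulA lag_mulVl lag_mul1.
Qed.

Lemma incl_proj_ex e : exists v, incl v = pcoinv e.
Proof. by apply: coinv_pre => x; exact: lamE_pcoinv. Qed.

Definition proj e : V := sval (cid (incl_proj_ex e)).

Lemma incl_proj e : incl (proj e) = pcoinv e.
Proof. exact: (svalP (cid (incl_proj_ex e))). Qed.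

Lemma lin_proj : linear proj.
Proof. by move=> c e f; apply: inj_incl; rewrite lin_incl !incl_proj lin_pcoinv. Qed.

Lemma lcoact_incl (a : A) v :
  lcoact E (lact a (incl v)) = sweedler a (fun a1 a2 => a1 ⊗ lact a2 (incl v)).
Proof.
have [_ [_ ll _] _ _] := hE; rewrite ll incl_coinv; apply: eq_btlift => a1 a2.
rewrite btlift_tpure; first by rewrite hmul1.
have lh := @lin_hmulr _ _ G a1; have ll2 := bl.2 a2.
by lin.
Qed.

Lemma proj_lact (a : A) v : proj (lact a (incl v)) = hcounit a *: v.
Proof.
apply: inj_incl; rewrite incl_proj (linZ _ _ lin_incl) /pcoinv lcoact_incl /sweedler.
rewrite (btlift_comp _ _ (btlift_tlinear bS)).
transitivity (lact (sweedler a (fun a1 a2 => hmul (antipode a1) a2) : A) (incl v)).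
  rewrite /sweedler [RHS](btlift_comp _ _ (bl.1 _)); apply: eq_btlift => a1 a2.
  rewrite (btlift_tpure _ _ bS).
  by have [[[_ _ lM] _ _ _ _] _ _ _] := hE; rewrite lM.
rewrite antipode_l (linZ _ _ (bl.1 _)).
by have [[[_ l1 _] _ _ _ _] _ _ _] := hE; rewrite l1.
Qed.

(** $e\mapsto e_{(-1)}\otimes\mathrm{proj}(e_{(0)})$, the explicit inverse of the multiplication
    $A\otimes V\to E$. *)
Definition to_tens (e : E) : A ⊠ V := tmap id proj (lcoact E e).

Lemma lin_to_tens : linear to_tens.
Proof.
apply: (lin_comp _ (@lin_lcoact _ _ _ E)); apply: lin_tmap; last exact: lin_proj.
exact: lin_id.
Qed.

Lemma to_tens_lact a v : to_tens (lact a (incl v)) = a ⊗ v.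
Proof.
rewrite /to_tens lcoact_incl /sweedler.
have L : linear (tmap id proj : A ⊠ E -> A ⊠ V).
  by apply: lin_tmap; [exact: lin_id | exact: lin_proj].
rewrite (btlift_comp _ _ L) -[a in RHS]rhoA1 /rhoA /sweedler.
rewrite [RHS](btlift_comp _ _ (lin_tensl v)); apply: eq_btlift => a1 a2.
rewrite tmapE //; last exact: lin_proj.
by rewrite proj_lact tpureZr tpureZl rdual_oneE.
Qed.

Definition of_tens (z : A ⊠ V) : E := btlift (fun a v => lact a (incl v)) z.

Lemma bil_of_tens : bilinear_map (fun (a : A) v => lact a (incl v)).
Proof. by lin. Qed.

(** Coassociativity places the first leg next to the antipode of the second, and $a_{(1)}S(a_{(2)})$
    collapses to the counit. *)
Lemma to_tensK e : of_tens (to_tens e) = e.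
Proof.
have [_ [[lu lc] _ _] _ _] := hE.
have [[[_ l1 lM] _ _ _ _] _ _ _] := hE.
pose Phi : A ⊠ (A ⊠ E) -> E := btlift (fun (a : A) y =>
  btlift (fun (b : A) m => lact (hmul a (antipode b)) m) y).
have bp a : bilinear_map (fun (b : A) (m : E) => lact (hmul a (antipode b)) m).
  split=> z; last exact: bl.2.
  exact: (lin_comp (bl.1 z) (lin_comp (lin_hmulr a) (@lin_antipode _ _ G))).
have bP : bilinear_map (fun (a : A) (y : A ⊠ E) =>
    btlift (fun (b : A) m => lact (hmul a (antipode b)) m) y).
  split=> z; last exact: btlift_tlinear.
  by apply: lin_btlift => b m; exact: (lin_comp (bl.1 m) (lin_hmull _)).
have lP : linear Phi by exact: btlift_tlinear.
have := congr1 Phi (lc e); rewrite !(btlift_comp _ _ lP) => H.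
rewrite -[RHS]lu; transitivity (btlift (fun a m => Phi (a ⊗ lcoact E m)) (lcoact E e)).
  rewrite /of_tens /to_tens /tmap (btlift_comp _ _ (btlift_tlinear bil_of_tens)).
  apply: eq_btlift => a m; rewrite (btlift_tpure _ _ bil_of_tens) incl_proj.
  rewrite /Phi (btlift_tpure _ _ bP) /pcoinv (btlift_comp _ _ (bl.2 _)).
  by apply: eq_btlift => b m'; rewrite lM.
rewrite -H; apply: eq_btlift => a m; rewrite (btlift_comp _ _ lP).
transitivity (lact (sweedler a (fun a1 a2 => hmul a1 (antipode a2)) : A) m).
  rewrite /sweedler [RHS](btlift_comp _ _ (bl.1 _)); apply: eq_btlift => a1 a2.
  by rewrite /Phi (btlift_tpure _ _ bP) (btlift_tpure _ _ (bp _)).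
by rewrite antipode_r (linZ _ _ (bl.1 _)) l1.
Qed.

Lemma E_span e : exists s : seq (A * V), e = \sum_(p <- s) lact p.1 (incl p.2).
Proof.
have [s sE] := tens_sum (to_tens e); exists s; rewrite -[LHS]to_tensK sE.
by rewrite /of_tens (btlift_tsum _ _ _ bil_of_tens).
Qed.

Lemma E_ext (W : lmodType k) (F F' : E -> W) : linear F -> linear F' ->
  (forall a v, F (lact a (incl v)) = F' (lact a (incl v))) -> forall e, F e = F' e.
Proof.
move=> lF lF' FF' e; have [s ->] := E_span e; rewrite !lin_sumE //.
by apply: eq_bigr => p _.
Qed.

Lemma E_ext2 (W : lmodType k) (F F' : E -> E -> W) :
  bilinear_map F -> bilinear_map F' ->
  (forall a v b w, F (lact a (incl v)) (lact b (incl w)) =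
                   F' (lact a (incl v)) (lact b (incl w))) ->
  forall e f, F e f = F' e f.
Proof.
move=> bF bF' FF' e f.
apply: (E_ext (F := F^~ f) (F' := F'^~ f) (bF.1 f) (bF'.1 f)) => a v.
by apply: E_ext f => //; [exact: bF.2 | exact: bF'.2].
Qed.

Local Notation T := (A ⊠ (V ⊠ V)).

(** The classical $E\otimes_A E$ in coordinates, on a free module instead of a quotient.
    Commutativity of $A$ makes it balanced for the left action in [mu_bal] and carries the exchange
    of arguments to the flip in [flip_mu]. *)
Definition mu (e f : E) : T :=
  btlift (fun a v => btlift (fun b w => hmul a b ⊗ (v ⊗ w)) (to_tens f)) (to_tens e).

Lemma bil_hmul : bilinear_map (@hmul k A).
Proof. by split=> z; [exact: lin_hmull | exact: lin_hmulr]. Qed.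

Lemma bil_mu : bilinear_map mu.
Proof.
have bh := bil_hmul; have ld := lin_to_tens.
by rewrite /mu; split=> z; lin.
Qed.

Lemma muE a v b w : mu (lact a (incl v)) (lact b (incl w)) = hmul a b ⊗ (v ⊗ w).
Proof.
have bh := bil_hmul.
rewrite /mu !to_tens_lact btlift_tpure; first by rewrite btlift_tpure //; lin.
by lin.
Qed.

Definition lactT (a : A) (t : T) : T := tmap (hmul a) id t.

Lemma lin_lactT a : linear (lactT a).
Proof. by apply: lin_tmap; [exact: lin_hmulr | exact: lin_id]. Qed.

Lemma lactTE a b z : lactT a (b ⊗ z) = hmul a b ⊗ z.
Proof. by rewrite /lactT tmapE //; exact: lin_hmulr. Qed.

Lemma bil_lactT : bilinear_map lactT.
Proof.
have bh := bil_hmul; split=> z; last exact: lin_lactT.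
by rewrite /lactT /tmap; lin.
Qed.

Lemma mu_lact a e f : mu (lact a e) f = lactT a (mu e f).
Proof.
have bm := bil_mu; have lt := lin_lactT a.
have [[[_ _ lM] _ _ _ _] _ _ _] := hE.
apply: (E_ext2 (F := fun e f => mu (lact a e) f) (F' := fun e f => lactT a (mu e f)));
  try by lin.
by move=> b v c w; rewrite lM !muE lactTE hmulA.
Qed.

Lemma mu_bal e a f : mu (lact a e) f = mu e (lact a f).
Proof.
have bm := bil_mu; have [[[_ _ lM] _ _ _ _] _ _ _] := hE.
apply: (E_ext2 (F := fun e f => mu (lact a e) f) (F' := fun e f => mu e (lact a f)));
  try by lin.
by move=> b v c w; rewrite !lM !muE (hmulC a b) hmulA.
Qed.

Definition flip (z : V ⊠ V) : V ⊠ V := btlift (fun v w => w ⊗ v) z.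
Definition flipT (t : T) : T := tmap id flip t.

Lemma bil_flip : bilinear_map (fun v w : V => w ⊗ v).
Proof. by lin. Qed.

Lemma lin_flip : linear flip.
Proof. exact: btlift_tlinear bil_flip. Qed.

Lemma flipE v w : flip (v ⊗ w) = w ⊗ v.
Proof. exact: btlift_tpure bil_flip. Qed.

Lemma flipK z : flip (flip z) = z.
Proof.
apply: (tens_ext (lin_comp lin_flip lin_flip) (@lin_id _ _)) z => v w.
by rewrite !flipE.
Qed.

Lemma lin_flipT : linear flipT.
Proof. by apply: lin_tmap; [exact: lin_id | exact: lin_flip]. Qed.

Lemma flipTE a z : flipT (a ⊗ z) = a ⊗ flip z.
Proof. by rewrite /flipT tmapE //; exact: lin_flip. Qed.

Lemma flip_mu e f : flipT (mu e f) = mu f e.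
Proof.
have bm := bil_mu; have lf := lin_flipT.
apply: (E_ext2 (F := fun e f => flipT (mu e f)) (F' := fun e f => mu f e)); try by lin.
by move=> b v c w; rewrite !muE flipTE flipE hmulC.
Qed.

Lemma flipT_lactT a t : flipT (lactT a t) = lactT a (flipT t).
Proof.
apply: (tens_ext (lin_comp lin_flipT (lin_lactT a)) (lin_comp (lin_lactT a) lin_flipT)) t.
by move=> b z; rewrite lactTE !flipTE lactTE.
Qed.

(** Elements of $V$ are left-coinvariant, so the left functionals act on $A$ alone; the right action
    [rhoT] is diagonal over all three factors. *)
Definition lamT (h : D) (t : T) : T := tmap (lamA h) id t.
Definition rhoVV : D -> V ⊠ V -> V ⊠ V := tens_act rhoV rhoV.
Definition rhoT : D -> T -> T := tens_act (@rhoA k d G) rhoVV.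

Lemma lin_lamT h : linear (lamT h).
Proof. by apply: lin_tmap; [exact: lin_lamA | exact: lin_id]. Qed.

Lemma lamTE h a z : lamT h (a ⊗ z) = lamA h a ⊗ z.
Proof. by rewrite /lamT tmapE //; exact: lin_lamA. Qed.

Lemma is_action_lamT : is_action (twl Om) lamT.
Proof.
have [bA mA oA] := is_action_lamA Om.
have bT : bilinear_map lamT.
  by split=> z; [rewrite /lamT /tmap; lin | exact: lin_lamT].
split=> // [f g t|t].
  apply: (tens_ext (lin_lamT _) (lin_comp (lin_lamT f) (lin_lamT g))) t => a z.
  by rewrite !lamTE mA.
by apply: (tens_ext (lin_lamT _) (@lin_id _ _)) t => a z; rewrite lamTE oA.
Qed.

Lemma is_action_rhoVV : is_action (twr Om) rhoVV.
Proof. by apply: is_action_tens; exact: is_action_rhoV. Qed.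

Lemma is_action_rhoT : is_action (twr Om) rhoT.
Proof. exact: is_action_tens (is_action_rhoA Om) is_action_rhoVV. Qed.

Lemma projK v : proj (incl v) = v.
Proof.
have [[[_ l1 _] _ _ _ _] _ _ _] := hE.
by rewrite -[incl v]l1 proj_lact -[hcounit _]/(1 : k) scale1r.
Qed.

Lemma regfam_rhoV v : regfam (fun h => rhoV h v).
Proof.
have [t tE] := regfam_comp lin_proj (regfam_rhoE (incl v)); exists t => h.
by rewrite -tE -incl_rhoV projK.
Qed.

Lemma regfam_rhoVV z : regfam (fun h => rhoVV h z).
Proof. exact: (regfam_tens_act _ is_action_rhoV is_action_rhoV regfam_rhoV regfam_rhoV). Qed.

Lemma regfam_rhoT t : regfam (fun h => rhoT h t).
Proof.
exact: (regfam_tens_act _ (is_action_rhoA Om) is_action_rhoVV (@regfam_rhoA _ _ _) regfam_rhoVV).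
Qed.

Lemma regfam_lamT t : regfam (fun h => lamT h t).
Proof.
have [s ->] := tens_sum t.
rewrite (_ : (fun h => _) = fun h => \sum_(p <- s) lamA h p.1 ⊗ p.2).
  by apply: regfam_sum => p; exact: (regfam_comp (lin_tensl p.2) (regfam_lamA p.1)).
apply/funext => h; rewrite (lin_sumE _ _ (lin_lamT h)).
by apply: eq_bigr => p _; rewrite lamTE.
Qed.

Lemma rhoVV_ev x v w : rhoVV (ev x) (v ⊗ w) = rhoV (ev x) v ⊗ rhoV (ev x) w.
Proof. exact: tens_act_ev is_action_rhoV is_action_rhoV _ _ _. Qed.

Lemma rhoT_ev x a z : rhoT (ev x) (a ⊗ z) = rhoA (ev x) a ⊗ rhoVV (ev x) z.
Proof. exact: tens_act_ev (is_action_rhoA Om) is_action_rhoVV _ _ _. Qed.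

Lemma lamT_rhoT f g t : lamT f (rhoT g t) = rhoT g (lamT f t).
Proof.
have [bT _ _] := is_action_rhoT.
apply: (tens_ext (lin_comp (lin_lamT f) (bT.2 g)) (lin_comp (bT.2 g) (lin_lamT f))) t => a z.
rewrite lamTE /rhoT !(tens_actE (is_action_rhoA Om) is_action_rhoVV).
rewrite (btlift_comp _ _ (lin_lamT f)); apply: eq_btlift => g1 g2.
by rewrite lamTE lamA_rhoA.
Qed.

Lemma rhoA_ev_mul x (a b : A) :
  rhoA (ev x) (hmul a b) = hmul (rhoA (ev x) a) (rhoA (ev x) b).
Proof. by apply: regular_ext => y; rewrite rhoA_ev /= !rhoA_ev. Qed.

Lemma lamA_ev_mul x (a b : A) :
  lamA (ev x) (hmul a b) = hmul (lamA (ev x) a) (lamA (ev x) b).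
Proof. by apply: regular_ext => y; rewrite lamA_ev /= !lamA_ev. Qed.

Lemma rhoE_ev_lact x (a : A) (e : E) :
  rhoE (ev x) (lact a e) = lact (rhoA (ev x) a) (rhoE (ev x) e).
Proof.
rewrite (equivariant_rhoE_lact hE) dcop_ev btlift_tpure //.
have bE := bil_rhoE E; have bA := @bil_rhoA _ _ G.
by lin.
Qed.

Lemma equivariant_rhoE_mu : equivariant (@rhoE _ _ _ E) (@rhoE _ _ _ E) rhoT mu.
Proof.
have bE := bil_rhoE E; have [bT _ _] := is_action_rhoT; have bm := bil_mu.
apply: equivariant_pt => //; do ?by [exact: regfam_rhoE | exact: regfam_rhoT].
move=> x; apply: (E_ext2 (F := fun e f => rhoT (ev x) (mu e f))
  (F' := fun e f => mu (rhoE (ev x) e) (rhoE (ev x) f))); try by lin.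
move=> a v b w; rewrite !rhoE_ev_lact -!incl_rhoV !muE rhoT_ev rhoVV_ev.
by rewrite rhoA_ev_mul.
Qed.

Lemma equivariant_lamE_mu : equivariant (@lamE _ _ _ E) (@lamE _ _ _ E) lamT mu.
Proof.
have bE := bil_lamE E; have lT := lin_lamT; have bm := bil_mu.
apply: equivariant_pt => //; do ?by [exact: regfam_lamE | exact: regfam_lamT].
move=> x; apply: (E_ext2 (F := fun e f => lamT (ev x) (mu e f))
  (F' := fun e f => mu (lamE (ev x) e) (lamE (ev x) f))); try by lin.
move=> a v b w; rewrite !lamE_ev_lact !lamE_incl !scale1r !muE lamTE.
by rewrite lamA_ev_mul.
Qed.

Definition ractT (t : T) (a : A) : T := lactT a t.

Lemma bil_ractT : bilinear_map ractT.
Proof. by have [l r] := bil_lactT; split. Qed.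

Lemma flipT_lamT h t : flipT (lamT h t) = lamT h (flipT t).
Proof.
apply: (tens_ext (lin_comp lin_flipT (lin_lamT h)) (lin_comp (lin_lamT h) lin_flipT)) t.
by move=> a z; rewrite lamTE !flipTE lamTE.
Qed.

(** The dual of a commutative algebra is cocommutative, so a diagonal action commutes with the flip;
    in practice both sides are compared at points. *)
Lemma flip_rhoVV h z : flip (rhoVV h z) = rhoVV h (flip z).
Proof.
have [bVV _ _] := is_action_rhoVV; have lf := lin_flip.
apply: (regfam_ext (F := fun h => flip (rhoVV h z)) (F' := fun h => rhoVV h (flip z))) => [||x].
- exact: (regfam_comp lin_flip (regfam_rhoVV z)).
- exact: regfam_rhoVV.
apply: (tens_ext (lin_comp lf (bVV.2 _)) (lin_comp (bVV.2 _) lf)) z => v w.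
by rewrite flipE !rhoVV_ev flipE.
Qed.

Lemma flipT_rhoT h t : flipT (rhoT h t) = rhoT h (flipT t).
Proof.
have [bT _ _] := is_action_rhoT; have lf := lin_flipT.
apply: (tens_ext (lin_comp lf (bT.2 _)) (lin_comp (bT.2 _) lf)) t => a z.
rewrite flipTE /rhoT !(tens_actE (is_action_rhoA Om) is_action_rhoVV).
rewrite (btlift_comp _ _ lf); apply: eq_btlift => h1 h2.
by rewrite flipTE flip_rhoVV.
Qed.

End Coinvariants.

(** * Two-sided twists *)

Section TwoSided.
Variables (k : fieldType) (d : nat) (G : linear_algebraic_group k d).
Local Notation A := (OG G).
Local Notation D := (Defs_rdual__canonical__GRing_Lmodule A).
Variable Om : dual_cocycle A.

Record biaction (M : lmodType k) := BiAction {
  lam : D -> M -> M;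
  rho : D -> M -> M;
  lamP : is_action (twl Om) lam;
  rhoP : is_action (twr Om) rho;
  lam_rho : forall f g m, lam f (rho g m) = rho g (lam f m) }.

(** The operator form of $\gamma(m_{(-1)}\otimes
    n_{(-1)})\,b(m_{(0)},n_{(0)})\,\overline\gamma(m_{(1)}\otimes n_{(1)})$, the common pattern of
    the deformed product, of both deformed actions and of [xi]. *)
Definition twist2 (M N Q : lmodType k) (x : biaction M) (y : biaction N)
  (b : M -> N -> Q) : M -> N -> Q :=
  twist (twl Om) (lam x) (lam y) (twist (twr Om) (rho x) (rho y) b).

Definition equivariant2 (M N Q : lmodType k) (x : biaction M) (y : biaction N)
    (z : biaction Q) (b : M -> N -> Q) : Prop :=
  equivariant (lam x) (lam y) (lam z) b /\ equivariant (rho x) (rho y) (rho z) b.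

Lemma bil_lam (M : lmodType k) (x : biaction M) : bilinear_map (lam x).
Proof. by case: (lamP x). Qed.
Lemma bil_rho (M : lmodType k) (x : biaction M) : bilinear_map (rho x).
Proof. by case: (rhoP x). Qed.
Local Hint Resolve bil_lam bil_rho lamP rhoP : core.

Lemma bil_twist2 (M N Q : lmodType k) (x : biaction M) (y : biaction N)
  (b : M -> N -> Q) : bilinear_map b -> bilinear_map (twist2 x y b).
Proof. by move=> bb; do 2!apply: bil_twist => //. Qed.

Lemma twist2E (M N Q : lmodType k) (x : biaction M) (y : biaction N)
    (b : M -> N -> Q) m n : twist2 x y b m n =
  \sum_(p <- seqO Om) \sum_(q <- seqV Om)
    b (rho x q.1 (lam x p.1 m)) (rho y q.2 (lam y p.2 n)).
Proof. by []. Qed.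

(** [twist_assoc] is used twice: the inner right twist is associative and, since left and right
    actions commute, still equivariant for the left actions, so the outer left twist is associative
    as well. *)
Lemma twist2_assoc (M N P MN NP Q : lmodType k) (x : biaction M) (y : biaction N)
    (z : biaction P) (xy : biaction MN) (yz : biaction NP)
    (b1 : M -> N -> MN) (b2 : MN -> P -> Q) (b3 : N -> P -> NP) (b4 : M -> NP -> Q) :
  bilinear_map b1 -> bilinear_map b2 -> bilinear_map b3 -> bilinear_map b4 ->
  equivariant2 x y xy b1 -> equivariant2 y z yz b3 ->
  (forall m n p, b2 (b1 m n) p = b4 m (b3 n p)) -> forall m n p,
  twist2 xy z b2 (twist2 x y b1 m n) p = twist2 x yz b4 m (twist2 y z b3 n p).
Proof.
move=> bb1 bb2 bb3 bb4 [l1 r1] [l3 r3] ass; apply: twist_assoc => //;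
  do ?by apply: bil_twist.
- by apply: twist_equivariant => //; exact: lam_rho.
- by apply: twist_equivariant => //; exact: lam_rho.
by apply: twist_assoc.
Qed.

(** $\Omega\Delta(h)\Omega^{-1}$ is the coproduct dual to the deformed product, as [rdual_twist_mul]
    shows; so the twisted map is covariant for the diagonal coaction formed with that product. *)
Lemma twist2_covariant_l (M N Q : lmodType k) (x : biaction M) (y : biaction N)
    (z : biaction Q) (b : M -> N -> Q) h m n : bilinear_map b -> equivariant2 x y z b ->
  \sum_(p <- seqO Om) \sum_(q <- seqV Om) btlift (fun h1 h2 =>
     twist2 x y b (lam x (dmul p.1 (dmul h1 q.1)) m)
                  (lam y (dmul p.2 (dmul h2 q.2)) n)) (dcop h)
  = lam z h (twist2 x y b m n).
Proof.
move=> bb [eqb _].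
have eqr : equivariant (lam x) (lam y) (lam z) (twist (twr Om) (rho x) (rho y) b).
  by apply: twist_equivariant => //; exact: lam_rho.
have bt : bilinear_map (twist (twr Om) (rho x) (rho y) b) by exact: bil_twist.
rewrite -[RHS](twist_covariant bt h m n (lamP x) (lamP y) (bil_lam z) eqr).
rewrite exchange_big; apply: eq_bigr => q _; apply: eq_bigr => p _.
by apply: eq_btlift => h1 h2 /=; rewrite !dmulA.
Qed.

Lemma twist2_covariant_r (M N Q : lmodType k) (x : biaction M) (y : biaction N)
    (z : biaction Q) (b : M -> N -> Q) h m n : bilinear_map b -> equivariant2 x y z b ->
  \sum_(p <- seqO Om) \sum_(q <- seqV Om) btlift (fun h1 h2 =>
     twist2 x y b (rho x (dmul p.1 (dmul h1 q.1)) m)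
                  (rho y (dmul p.2 (dmul h2 q.2)) n)) (dcop h)
  = rho z h (twist2 x y b m n).
Proof.
move=> bb [_ eqb]; rewrite [in RHS]/twist2 [in RHS]/twist.
rewrite (lin_sumE _ _ ((bil_rho z).2 h)).
under eq_bigr => p _ do under eq_bigr => q _ do rewrite /twist2 {1}/twist btlift_sumf.
under eq_bigr => p _ do rewrite exchange_big.
rewrite exchange_big; apply: eq_bigr => r _ /=.
rewrite -[RHS](twist_covariant bb h _ _ (rhoP x) (rhoP y) (bil_rho z) eqb).
apply: eq_bigr => p _; apply: eq_bigr => q _; apply: eq_btlift => h1 h2.
by rewrite !lam_rho.
Qed.

(** [inv] expresses that [m] is left-coinvariant, and the normalisation of $\Omega$ collapses the
    sum. The three companions treat the other argument and the right twist. *)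
Lemma twistl_inv_l (M N Q : lmodType k) (x : biaction M) (y : biaction N)
    (b : M -> N -> Q) m n : bilinear_map b ->
  (forall h, lam x h m = (rdual_val h hone : k) *: m) ->
  twist (twl Om) (lam x) (lam y) b m n = b m n.
Proof.
move=> bb inv; rewrite /twist.
transitivity (b m (lam y (\sum_(p <- seqO Om) (rdual_val p.1 hone : k) *: p.2) n)).
  rewrite (lin_sumE _ _ ((bil_lam y).1 n)) (lin_sumE _ _ (bb.2 m)).
  apply: eq_bigr => p _.
  by rewrite inv (linZ _ _ (bb.1 _)) (linZ _ _ ((bil_lam y).1 n)) (linZ _ _ (bb.2 _)).
by rewrite seqO_unitl; case: (lamP y) => _ _ ->.
Qed.

Lemma twistl_inv_r (M N Q : lmodType k) (x : biaction M) (y : biaction N)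
    (b : M -> N -> Q) m n : bilinear_map b ->
  (forall h, lam y h n = (rdual_val h hone : k) *: n) ->
  twist (twl Om) (lam x) (lam y) b m n = b m n.
Proof.
move=> bb inv; rewrite /twist.
transitivity (b (lam x (\sum_(p <- seqO Om) (rdual_val p.2 hone : k) *: p.1) m) n).
  rewrite (lin_sumE _ _ ((bil_lam x).1 m)) (lin_sumE _ _ (bb.1 n)).
  apply: eq_bigr => p _.
  by rewrite inv (linZ _ _ (bb.2 _)) (linZ _ _ ((bil_lam x).1 m)) (linZ _ _ (bb.1 _)).
by rewrite seqO_unitr; case: (lamP x) => _ _ ->.
Qed.

Lemma twistr_inv_l (M N Q : lmodType k) (x : biaction M) (y : biaction N)
    (b : M -> N -> Q) m n : bilinear_map b ->
  (forall h, rho x h m = (rdual_val h hone : k) *: m) ->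
  twist (twr Om) (rho x) (rho y) b m n = b m n.
Proof.
move=> bb inv; rewrite /twist.
transitivity (b m (rho y (\sum_(p <- seqV Om) (rdual_val p.1 hone : k) *: p.2) n)).
  rewrite (lin_sumE _ _ ((bil_rho y).1 n)) (lin_sumE _ _ (bb.2 m)).
  apply: eq_bigr => p _.
  by rewrite inv (linZ _ _ (bb.1 _)) (linZ _ _ ((bil_rho y).1 n)) (linZ _ _ (bb.2 _)).
by rewrite seqV_unitl; case: (rhoP y) => _ _ ->.
Qed.

Lemma twistr_inv_r (M N Q : lmodType k) (x : biaction M) (y : biaction N)
    (b : M -> N -> Q) m n : bilinear_map b ->
  (forall h, rho y h n = (rdual_val h hone : k) *: n) ->
  twist (twr Om) (rho x) (rho y) b m n = b m n.
Proof.
move=> bb inv; rewrite /twist.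
transitivity (b (rho x (\sum_(p <- seqV Om) (rdual_val p.2 hone : k) *: p.1) m) n).
  rewrite (lin_sumE _ _ ((bil_rho x).1 m)) (lin_sumE _ _ (bb.1 n)).
  apply: eq_bigr => p _.
  by rewrite inv (linZ _ _ (bb.2 _)) (linZ _ _ ((bil_rho x).1 m)) (linZ _ _ (bb.1 _)).
by rewrite seqV_unitr; case: (rhoP x) => _ _ ->.
Qed.

Definition biA : biaction A :=
  BiAction (is_action_lamA Om) (is_action_rhoA Om) (@lamA_rhoA _ _ G).

Lemma equivariant2_hmul : equivariant2 biA biA biA (@hmul k A).
Proof. by split; [exact: (@equivariant_lamA_mul _ _ G) | exact: (@equivariant_rhoA_mul _ _ G)]. Qed.

Lemma cocycleE (a b : A) :
  cocycle Om a b = \sum_(p <- seqO Om) rdual_val p.1 a * rdual_val p.2 b.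
Proof. by rewrite /cocycle seqOE /pairing2 btlift_tsum //; exact: bil_pairing2. Qed.

Lemma cocycleVE (a b : A) :
  cocycleV Om a b = \sum_(p <- seqV Om) rdual_val p.1 a * rdual_val p.2 b.
Proof. by rewrite /cocycleV seqVE /pairing2 btlift_tsum //; exact: bil_pairing2. Qed.

Section Sums.
Variables (W : lmodType k) (I J : Type) (s : seq I) (t : seq J).
Variables (f : I -> D) (g : J -> D).

(** The bridge from Sweedler formulas to operators: functionals on the outer legs $a_{(1)}$ and
    $a_{(3)}$ become [lamA] and [rhoA] applied to [a]. *)
Lemma sweedler3_sum (L : I -> J -> A -> W) (a : A) : (forall i j, linear (L i j)) ->
  sweedler3 a (fun a1 a2 a3 => \sum_(i <- s) \sum_(j <- t)
    (rdual_val (f i) a1 * rdual_val (g j) a3) *: L i j a2) =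
  \sum_(i <- s) \sum_(j <- t) L i j (rhoA (g j) (lamA (f i) a)).
Proof.
move=> lL; rewrite /sweedler3 /sweedler.
under eq_btlift => a1 a' do rewrite btlift_sumf.
rewrite btlift_sumf; apply: eq_bigr => i _.
under eq_btlift => a1 a' do rewrite btlift_sumf.
rewrite btlift_sumf; apply: eq_bigr => j _.
have lr := @lin_rhoA _ _ G (g j).
rewrite /lamA /sweedler (btlift_comp _ _ (lin_comp (lL i j) lr)).
apply: eq_btlift => a1 a'; rewrite (linZ _ _ lr) (linZ _ _ (lL i j)) /rhoA /sweedler.
rewrite (btlift_comp _ _ (lL i j)) (btlift_comp _ _ (lin_scale _ (@lin_id _ _))).
by apply: eq_btlift => a2 a3; rewrite (linZ _ _ (lL i j)) scalerA.
Qed.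

Variable E : bimod A.

Lemma bisweedler_sum (L : I -> J -> E -> W) (m : E) : (forall i j, linear (L i j)) ->
  bisweedler m (fun b1 m0 b2 => \sum_(i <- s) \sum_(j <- t)
    (rdual_val (f i) b1 * rdual_val (g j) b2) *: L i j m0) =
  \sum_(i <- s) \sum_(j <- t) L i j (rhoE (g j) (lamE (f i) m)).
Proof.
move=> lL; rewrite /bisweedler.
under eq_btlift => a1 a' do rewrite btlift_sumf.
rewrite btlift_sumf; apply: eq_bigr => i _.
under eq_btlift => a1 a' do rewrite btlift_sumf.
rewrite btlift_sumf; apply: eq_bigr => j _.
have lr := (bil_rhoE E).2 (g j).
rewrite /lamE (btlift_comp _ _ (lin_comp (lL i j) lr)).
apply: eq_btlift => a1 a'; rewrite (linZ _ _ lr) (linZ _ _ (lL i j)) /rhoE.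
rewrite (btlift_comp _ _ (lL i j)) (btlift_comp _ _ (lin_scale _ (@lin_id _ _))).
by apply: eq_btlift => a2 a3; rewrite (linZ _ _ (lL i j)) scalerA.
Qed.
End Sums.

Lemma scale_sum2 (W : lmodType k) (I J : Type) (s : seq I) (t : seq J)
    (x y : I -> k) (u v : J -> k) (w : W) :
  (\sum_(i <- s) x i * y i) * (\sum_(j <- t) u j * v j) *: w =
  \sum_(i <- s) \sum_(j <- t) (y i * v j) *: ((x i * u j) *: w).
Proof.
rewrite mulr_suml scaler_suml; apply: eq_bigr => i _.
rewrite mulr_sumr scaler_suml; apply: eq_bigr => j _.
by rewrite scalerA mulrACA mulrC.
Qed.

Lemma twist_mulE (a b : A) : twist_mul Om a b = twist2 biA biA (@hmul k A) a b.
Proof.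
rewrite twist2E /twist_mul.
transitivity (sweedler3 a (fun a1 a2 a3 => \sum_(p <- seqO Om) \sum_(q <- seqV Om)
    (rdual_val p.1 a1 * rdual_val q.1 a3) *: hmul a2 (rhoA q.2 (lamA p.2 b)))).
  apply: eq_btlift => a1 a'; apply: eq_btlift => a2 a3.
  pose L (p q : D * D) c : A := (rdual_val p.1 a1 * rdual_val q.1 a3) *: hmul a2 c.
  have lL p q : linear (L p q) by apply: lin_scale; exact: lin_hmulr.
  rewrite -(sweedler3_sum _ _ (fun p => p.2) (fun p => p.2) _ lL).
  do 2!apply: eq_btlift => ? ?.
  by rewrite cocycleE cocycleVE scale_sum2.
pose L (p q : D * D) c : A := hmul c (rhoA q.2 (lamA p.2 b)).
have lL p q : linear (L p q) by exact: lin_hmull.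
exact: (sweedler3_sum _ _ (fun p => p.1) (fun p => p.1) _ lL).
Qed.

Lemma rdual_twist_mul (h : D) (a b : A) : rdual_val h (twist_mul Om a b) =
  \sum_(p <- seqO Om) \sum_(q <- seqV Om) btlift (fun h1 h2 =>
    rdual_val (dmul p.1 (dmul h1 q.1)) a * rdual_val (dmul p.2 (dmul h2 q.2)) b : k^o)
    (dcop h).
Proof.
rewrite twist_mulE twist2E (lin_sumE _ _ (lin_rdual h)); apply: eq_bigr => p _.
rewrite (lin_sumE _ _ (lin_rdual h)); apply: eq_bigr => q _.
rewrite -dcopE; apply: eq_btlift => h1 h2.
by rewrite -!dmul_rhoA -!dmul_lamA.
Qed.

Lemma rhoA_hone (h : D) : rhoA h hone = (rdual_val h hone : k) *: (hone : A).
Proof.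
apply: regular_ext => x; rewrite rhoA_pt -[RHS]/(rdual_val h hone * (1 : k)) mulr1.
by congr (rdual_val h _); apply: regular_ext => y; rewrite lamA_ev.
Qed.

Lemma twist_mul1 (a : A) : twist_mul Om a hone = a.
Proof.
have l1 h : lamA h hone = (rdual_val h hone : k) *: (hone : A) by exact: lamA_hone.
have r1 h : rhoA h hone = (rdual_val h hone : k) *: (hone : A) by exact: rhoA_hone.
have bh := @bil_hmul _ _ G.
rewrite twist_mulE /twist2 (twistl_inv_r biA (y := biA)) //; last exact: bil_twist.
by rewrite (twistr_inv_r biA (y := biA)) // hmul1.
Qed.
Variable E : bimod A.
Hypothesis hE : is_bicovariant E.
Hypothesis ractE : forall (a : A) (e : E), ract e a = lact a e.

Definition biE : biaction E :=
  BiAction (is_action_lamE Om hE) (is_action_rhoE Om hE) (lamE_rhoE hE).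

Lemma equivariant2_lact : equivariant2 biA biE biE (@lact k A E).
Proof. by split; [exact: (equivariant_lamE_lact hE) | exact: (equivariant_rhoE_lact hE)]. Qed.

Lemma equivariant2_ract : equivariant2 biE biA biE (@ract k A E).
Proof.
by split; [exact: (equivariant_lamE_ract hE) | exact: (equivariant_rhoE_ract hE)].
Qed.

Lemma twist_lactE (a : A) (m : E) : twist_lact Om a m = twist2 biA biE (@lact k A E) a m.
Proof.
have bl := bil_lact hE; rewrite twist2E /twist_lact.
transitivity (sweedler3 a (fun a1 a2 a3 => \sum_(p <- seqO Om) \sum_(q <- seqV Om)
    (rdual_val p.1 a1 * rdual_val q.1 a3) *: lact a2 (rhoE q.2 (lamE p.2 m)))).
  apply: eq_btlift => a1 a'; apply: eq_btlift => a2 a3.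
  pose L (p q : D * D) c : E := (rdual_val p.1 a1 * rdual_val q.1 a3) *: lact a2 c.
  have lL p q : linear (L p q) by apply: lin_scale; exact: bl.2.
  rewrite -(bisweedler_sum _ _ (fun p => p.2) (fun p => p.2) _ lL).
  do 2!apply: eq_btlift => ? ?.
  by rewrite cocycleE cocycleVE scale_sum2.
pose L (p q : D * D) c : E := lact c (rhoE q.2 (lamE p.2 m)).
have lL p q : linear (L p q) by exact: bl.1.
exact: (sweedler3_sum _ _ (fun p => p.1) (fun p => p.1) _ lL).
Qed.

Lemma twist_ractE (m : E) (a : A) : twist_ract Om m a = twist2 biE biA (@ract k A E) m a.
Proof.
have br := bil_ract hE; rewrite twist2E /twist_ract.
transitivity (sweedler3 a (fun a1 a2 a3 => \sum_(p <- seqO Om) \sum_(q <- seqV Om)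
    (rdual_val p.2 a1 * rdual_val q.2 a3) *: ract (rhoE q.1 (lamE p.1 m)) a2)).
  apply: eq_btlift => a1 a'; apply: eq_btlift => a2 a3.
  pose L (p q : D * D) c : E := (rdual_val p.2 a1 * rdual_val q.2 a3) *: ract c a2.
  have lL p q : linear (L p q) by apply: lin_scale; exact: br.1.
  rewrite -(bisweedler_sum _ _ (fun p => p.1) (fun p => p.1) _ lL).
  do 2!apply: eq_btlift => ? ?; rewrite cocycleE cocycleVE.
  under eq_bigr do rewrite mulrC.
  under [X in _ * X]eq_bigr do rewrite mulrC.
  by rewrite scale_sum2.
pose L (p q : D * D) c : E := ract (rhoE q.1 (lamE p.1 m)) c.
have lL p q : linear (L p q) by exact: br.2.
exact: (sweedler3_sum _ _ (fun p => p.2) (fun p => p.2) _ lL).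
Qed.

Lemma bil_twist_lact : bilinear_map (@twist_lact _ _ Om E).
Proof.
have [l r] : bilinear_map (twist2 biA biE (@lact k A E)).
  exact: bil_twist2 (bil_lact hE).
split=> z c x y; rewrite !twist_lactE; [exact: l | exact: r].
Qed.

Lemma bil_twist_ract : bilinear_map (@twist_ract _ _ Om E).
Proof.
have [l r] : bilinear_map (twist2 biE biA (@ract k A E)).
  exact: bil_twist2 (bil_ract hE).
split=> z c x y; rewrite !twist_ractE; [exact: l | exact: r].
Qed.

Lemma twist_ract1 (m : E) : twist_ract Om m hone = m.
Proof.
have l1 h : lamA h hone = (rdual_val h hone : k) *: (hone : A) by exact: lamA_hone.
have r1 h : rhoA h hone = (rdual_val h hone : k) *: (hone : A) by exact: rhoA_hone.
have br := bil_ract hE.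
rewrite twist_ractE /twist2 (twistl_inv_r biE (y := biA)) //; last exact: bil_twist.
by rewrite (twistr_inv_r biE (y := biA)) //; have [[_ _ -> _ _] _ _ _] := hE.
Qed.

Lemma twist_lact1 (m : E) : twist_lact Om hone m = m.
Proof.
have l1 h : lamA h hone = (rdual_val h hone : k) *: (hone : A) by exact: lamA_hone.
have r1 h : rhoA h hone = (rdual_val h hone : k) *: (hone : A) by exact: rhoA_hone.
have br := bil_lact hE.
rewrite twist_lactE /twist2 (twistl_inv_l biE (x := biA)) //; last exact: bil_twist.
by rewrite (twistr_inv_l biE (x := biA)) //; have [[[_ -> _] _ _ _ _] _ _ _] := hE.
Qed.

Lemma twist_ractM (m : E) (a b : A) :
  twist_ract Om (twist_ract Om m a) b = twist_ract Om m (twist_mul Om a b).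
Proof.
rewrite !twist_ractE twist_mulE.
have br := bil_ract hE; have bh := @bil_hmul _ _ G.
apply: (twist2_assoc br br bh br equivariant2_ract equivariant2_hmul).
by have [[_ _ _ ? _] _ _ _] := hE.
Qed.

(** * Right coinvariants generate the twisted right module *)

Section RightCoinvariants.

Definition prinv (e : E) : E := btlift (fun m a => lact (antipode a) m) (rcoact E e).

Let bl := bil_lact hE.

Let bS : bilinear_map (fun (m : E) (a : A) => lact (antipode a) m).
Proof.
split=> z; last exact: (lin_comp (bl.1 z) (@lin_antipode _ _ G)).
exact: bl.2.
Qed.

Lemma lin_prinv : linear prinv.
Proof. exact: lin_btlift_arg bS (@lin_rcoact _ _ _ E). Qed.

Lemma rhoE_prinv x e : rhoE (ev x) (prinv e) = prinv e.
Proof.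
have bE := bil_rhoE E.
have lr : linear (@lamA k d G (ev (lag_inv x))) by exact: lin_lamA.
transitivity (btlift (fun m a => lact (antipode a) m)
    (tmap (rhoE (ev x)) (@lamA k d G (ev (lag_inv x))) (rcoact E e))).
  rewrite /prinv (btlift_comp _ _ (bE.2 _)) /tmap (btlift_comp _ _ (btlift_tlinear bS)).
  apply: eq_btlift => m a; rewrite (rhoE_ev_lact hE) (btlift_tpure _ _ bS).
  congr (lact _ _); apply: regular_ext => y.
  by rewrite rhoA_ev !antipodeE lamA_ev lag_invM.
congr (btlift _ _); apply: pairr_sep => y.
rewrite /tmap (btlift_comp _ _ (btlift_tlinear (bil_pairr E (ev y)))).
transitivity (rhoE (ev x) (rhoE (ev (lag_mul (lag_inv x) y)) e)).
  rewrite [RHS](btlift_comp _ _ (bE.2 _)); apply: eq_btlift => m a.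
  rewrite btlift_tpure; last exact: bil_pairr.
  by rewrite (linZ _ _ (bE.2 _)); congr (_ *: _); exact: lamA_ev.
by rewrite -(rhoE_mul hE) dmul_ev lag_mulA lag_mulV lag_1mul.
Qed.

Lemma prinv_rinv e : rcoact E (prinv e) = prinv e ⊗ (hone : A).
Proof.
apply: pairr_sep => x; rewrite [LHS]rhoE_prinv btlift_tpure; last exact: bil_pairr.
by rewrite -[X in X *: _]/(1 : k) scale1r.
Qed.

Lemma rhoE_rinv h (f : E) : rcoact E f = f ⊗ (hone : A) ->
  rhoE h f = (rdual_val h hone : k) *: f.
Proof. by move=> fE; rewrite /rhoE fE btlift_tpure //; exact: bil_pairr. Qed.

Lemma prinvK e : btlift (fun m a => lact a (prinv m)) (rcoact E e) = e.
Proof.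
have [[[_ l1 lM] _ _ _ _] _ [[ru rc] _ _] _] := hE.
pose Phi : (E ⊠ A) ⊠ A -> E := btlift (fun y (a : A) =>
  btlift (fun m (b : A) => lact (hmul a (antipode b)) m) y).
have bp a : bilinear_map (fun (m : E) (b : A) => lact (hmul a (antipode b)) m).
  split=> z; first exact: bl.2.
  exact: (lin_comp (bl.1 z) (lin_comp (lin_hmulr a) (@lin_antipode _ _ G))).
have bP : bilinear_map (fun (y : E ⊠ A) (a : A) =>
    btlift (fun m (b : A) => lact (hmul a (antipode b)) m) y).
  split=> z; first exact: btlift_tlinear.
  by apply: lin_btlift => m b; exact: (lin_comp (bl.1 m) (lin_hmull _)).
have lP : linear Phi by exact: btlift_tlinear.
have := congr1 Phi (rc e); rewrite !(btlift_comp _ _ lP) => H.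
rewrite -[RHS]ru; transitivity (btlift (fun m a => Phi (rcoact E m ⊗ a)) (rcoact E e)).
  apply: eq_btlift => m a; rewrite /Phi (btlift_tpure _ _ bP) /prinv.
  rewrite (btlift_comp _ _ (bl.2 _)).
  by apply: eq_btlift => m' b; rewrite lM.
rewrite -H; apply: eq_btlift => m a; rewrite (btlift_comp _ _ lP).
transitivity (lact (sweedler a (fun a1 a2 => hmul (antipode a1) a2) : A) m).
  rewrite /sweedler [RHS](btlift_comp _ _ (bl.1 _)); apply: eq_btlift => a1 a2.
  by rewrite /Phi (btlift_tpure _ _ bP) (btlift_tpure _ _ (bp _)) hmulC.
by rewrite antipode_l (linZ _ _ (bl.1 _)) l1.
Qed.

Lemma rinv_lamE h (f : E) : rcoact E f = f ⊗ (hone : A) ->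
  rcoact E (lamE h f) = lamE h f ⊗ (hone : A).
Proof.
move=> fE; apply: pairr_sep => x; rewrite [LHS](_ : _ = rhoE (ev x) (lamE h f)) //.
rewrite -(lamE_rhoE hE) rhoE_rinv // btlift_tpure; last exact: bil_pairr.
by rewrite (linZ _ _ ((bil_lamE E).2 h)).
Qed.

(** For right-coinvariant [f] the right twist is trivial, and the left twist is undone by
    $\Omega^{-1}$. Left functionals preserve right coinvariance by [rinv_lamE], so every summand is
    again of this kind. *)
Lemma ract_rinv (f : E) (a : A) : rcoact E f = f ⊗ (hone : A) ->
  ract f a = \sum_(q <- seqV Om) twist_ract Om (lamE q.1 f) (lamA q.2 a).
Proof.
move=> fE; have br := bil_ract hE; have bE := bil_lamE E.
have bA : bilinear_map (@lamA _ _ G) := bil_lam biA.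
have bF : bilinear_map (fun x y => ract (lamE x f) (lamA y a) : E) by lin.
transitivity (ract (lamE (dunit G) f) (lamA (dunit G) a) : E).
  by rewrite (lamE1 hE) lamA1.
rewrite -(seqVO Om bF); apply: eq_bigr => q _.
rewrite twist_ractE /twist2 {1}/twist; apply: eq_bigr => p _.
rewrite (twistr_inv_l biA (x := biE)) //=.
  by rewrite -(lamE_mul hE) -lamA_mul.
by move=> h; apply: rhoE_rinv; do 2!apply: rinv_lamE.
Qed.

(** [prinvK] expands [e] classically over right coinvariants and [ract_rinv] converts each product
    into deformed ones. Uniqueness of the braiding rests on this. *)
Lemma twist_ract_rinv_span e : exists2 s : seq (E * A),
  (forall p, p \in s -> rcoact E p.1 = p.1 ⊗ (hone : A)) &
  e = \sum_(p <- s) twist_ract Om p.1 p.2.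
Proof.
have [s sE] := tens_sum (rcoact E e).
exists [seq (lamE q.1 (prinv p.1), lamA q.2 p.2) | p <- s, q <- seqV Om] => [p|].
  by move=> /allpairsP[[u v] /= [_ _ ->]] /=; apply: rinv_lamE; exact: prinv_rinv.
have bp : bilinear_map (fun (m : E) (a : A) => lact a (prinv m)).
  split=> z; last exact: bl.1.
  exact: (lin_comp (bl.2 z) lin_prinv).
rewrite big_allpairs_dep -[LHS]prinvK sE (btlift_tsum _ _ _ bp).
apply: eq_bigr => p _ /=; rewrite -ractE ract_rinv //.
exact: prinv_rinv.
Qed.
End RightCoinvariants.

(** * The comparison map into the free model *)

Section Xi.
Variables (V : lmodType k) (incl : V -> E).
Hypotheses (lin_incl : linear incl) (inj_incl : injective incl).
Hypothesis incl_coinv : forall v, lcoact E (incl v) = (hone : A) ⊗ incl v.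
Hypothesis incl_surj : forall e, lcoact E e = (hone : A) ⊗ e -> exists v, incl v = e.

Local Notation T := (A ⊠ (V ⊠ V)).
Local Notation rV := (rhoV hE incl_coinv incl_surj).
Local Notation rVV := (rhoVV hE incl_coinv incl_surj).
Local Notation rT := (rhoT hE incl_coinv incl_surj).
Local Notation mu := (mu hE incl_surj).

Let aV : is_action (twr Om) rV := is_action_rhoV Om hE lin_incl inj_incl incl_coinv incl_surj.
Let aVV : is_action (twr Om) rVV :=
  is_action_rhoVV Om hE lin_incl inj_incl incl_coinv incl_surj.
Let aT : is_action (twr Om) rT := is_action_rhoT Om hE lin_incl inj_incl incl_coinv incl_surj.

Definition biT : biaction T.
Proof.
apply: (BiAction (is_action_lamT Om V) aT).
exact: (lamT_rhoT Om hE lin_incl inj_incl incl_coinv incl_surj).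
Defined.

Let bmu : bilinear_map mu := bil_mu hE lin_incl inj_incl incl_surj.

Lemma equivariant2_mu : equivariant2 biE biE biT mu.
Proof.
split; first exact: (equivariant_lamE_mu hE lin_incl inj_incl incl_coinv incl_surj).
exact: (equivariant_rhoE_mu Om hE lin_incl inj_incl incl_coinv incl_surj).
Qed.

Definition xi : E -> E -> T := twist2 biE biE mu.
Definition tlactT : A -> T -> T := twist2 biA biT (@lactT _ _ _ V).
Definition tractT : T -> A -> T := twist2 biT biA (@ractT _ _ _ V).

Lemma bil_xi : bilinear_map xi.
Proof. exact: bil_twist2. Qed.
Lemma bil_tlactT : bilinear_map tlactT.
Proof. by apply: bil_twist2; exact: bil_lactT. Qed.
Lemma bil_tractT : bilinear_map tractT.
Proof. by apply: bil_twist2; exact: bil_ractT. Qed.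

(** An instance of [twist2_assoc], like [xi_bal] and [xi_ract]: the deformed actions and [xi] are
    twists of classical maps that satisfy the corresponding identity. *)
Lemma xi_lact a e f : xi (twist_lact Om a e) f = tlactT a (xi e f).
Proof.
rewrite twist_lactE; apply: (twist2_assoc (bil_lact hE) bmu bmu (@bil_lactT _ _ G V)
  equivariant2_lact equivariant2_mu).
by move=> *; exact: mu_lact.
Qed.

Lemma xi_bal e a f : xi (twist_ract Om e a) f = xi e (twist_lact Om a f).
Proof.
rewrite twist_lactE twist_ractE.
apply: (twist2_assoc (bil_ract hE) bmu (bil_lact hE) bmu
  equivariant2_ract equivariant2_lact).
by move=> *; rewrite ractE; exact: mu_bal.
Qed.

Lemma xi_ract e f a : xi e (twist_ract Om f a) = tractT (xi e f) a.
Proof.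
symmetry; rewrite twist_ractE.
apply: (twist2_assoc bmu (@bil_ractT _ _ G V) (bil_ract hE) bmu
  equivariant2_mu equivariant2_ract) => m n p.
by rewrite ractE -mu_bal // mu_lact.
Qed.

Lemma flip_tlactT a t : flipT (tlactT a t) = tlactT a (flipT t).
Proof.
have lf := @lin_flipT _ _ G V.
rewrite /tlactT !twist2E (lin_sumE _ _ lf); apply: eq_bigr => p _.
rewrite (lin_sumE _ _ lf); apply: eq_bigr => q _ /=.
by rewrite flipT_lactT flipT_rhoT // flipT_lamT.
Qed.

Lemma flip_tractT t a : flipT (tractT t a) = tractT (flipT t) a.
Proof.
have lf := @lin_flipT _ _ G V.
rewrite /tractT !twist2E (lin_sumE _ _ lf); apply: eq_bigr => p _.
rewrite (lin_sumE _ _ lf); apply: eq_bigr => q _ /=.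
by rewrite /ractT flipT_lactT flipT_rhoT // flipT_lamT.
Qed.

(** The operator $J$. It uses [seqV] because the right half of the deformation is by $\Omega^{-1}$;
    [kV] is its inverse, and [jT], [kT] are the analogues on $A\otimes(V\otimes V)$ with $V\otimes
    V$ as one factor. *)
Definition jV : V ⊠ V -> V ⊠ V := tw_op rV rV (seqV Om).
Definition kV : V ⊠ V -> V ⊠ V := tw_op rV rV (seqO Om).
Definition jT : T -> T := tw_op (@rhoA _ _ G) rVV (seqV Om).
Definition kT : T -> T := tw_op (@rhoA _ _ G) rVV (seqO Om).

Lemma jVK z : jV (kV z) = z. Proof. exact: (stwK_op aV aV). Qed.
Lemma kVK z : kV (jV z) = z. Proof. exact: (stiK_op aV aV). Qed.
Lemma jTK t : jT (kT t) = t. Proof. exact: (stwK_op (is_action_rhoA Om) aVV). Qed.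
Lemma kTK t : kT (jT t) = t. Proof. exact: (stiK_op (is_action_rhoA Om) aVV). Qed.
Lemma lin_jV : linear jV. Proof. exact: (lin_tw_op aV aV). Qed.
Lemma lin_kV : linear kV. Proof. exact: (lin_tw_op aV aV). Qed.
Lemma lin_jT : linear jT. Proof. exact: (lin_tw_op (is_action_rhoA Om) aVV). Qed.
Lemma lin_kT : linear kT. Proof. exact: (lin_tw_op (is_action_rhoA Om) aVV). Qed.

Lemma twist_lact_incl a v : twist_lact Om a (incl v) =
  of_tens incl (tw_op (@rhoA _ _ G) rV (seqV Om) (a ⊗ v)).
Proof.
have bm := bil_of_tens hE lin_incl; have bt := bil_lact hE.
rewrite twist_lactE /twist2 (twistl_inv_r biA (y := biE)); last first.
- by move=> h; exact: lamE_incl.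
- exact: bil_twist.
rewrite (tw_opE (is_action_rhoA Om) aV) /of_tens (lin_sumE _ _ (btlift_tlinear bm)).
by apply: eq_bigr => q _; rewrite (btlift_tpure _ _ bm) /= incl_rhoV.
Qed.

(** The left twist is trivial on $V$, so by [twist_lact_incl] the deformed multiplication $A\otimes
    V\to E$ is the classical one preceded by an invertible operator. A classical expansion is pulled
    back through its inverse. *)
Lemma twist_E_span e : exists s : seq (A * V),
  e = \sum_(p <- s) twist_lact Om p.1 (incl p.2).
Proof.
have bm := bil_of_tens hE lin_incl.
pose z := tw_op (@rhoA _ _ G) rV (seqO Om) (to_tens hE incl_surj e).
have zE : tw_op (@rhoA _ _ G) rV (seqV Om) z = to_tens hE incl_surj e.
  exact: (stwK_op (is_action_rhoA Om) aV).
have [s sE] := tens_sum z; exists s.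
rewrite -[LHS](to_tensK hE lin_incl incl_surj) -zE sE.
rewrite (lin_sumE _ _ (lin_tw_op (is_action_rhoA Om) aV _)).
rewrite /of_tens (lin_sumE _ _ (btlift_tlinear bm)); apply: eq_bigr => p _.
by rewrite twist_lact_incl.
Qed.

Lemma rhoT_hone h z : rT h ((hone : A) ⊗ z) = (hone : A) ⊗ rVV h z.
Proof.
apply: (regfam_ext (F := fun h => rT h ((hone : A) ⊗ z))
  (F' := fun h => (hone : A) ⊗ rVV h z)) => [||x].
- exact: (regfam_rhoT Om hE lin_incl inj_incl incl_coinv incl_surj).
- exact: (regfam_comp (lin_tensr _) (regfam_rhoVV Om hE lin_incl inj_incl incl_coinv incl_surj z)).
rewrite (rhoT_ev Om hE lin_incl inj_incl incl_coinv incl_surj) rhoA_hone.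
by rewrite -[rdual_val _ _]/(1 : k) scale1r.
Qed.

Lemma lamT_hone h (z : V ⊠ V) :
  lamT h ((hone : A) ⊗ z) = (rdual_val h hone : k) *: ((hone : A) ⊗ z).
Proof. by rewrite lamTE lamA_hone tpureZl. Qed.

Lemma tlactT_hone a z : tlactT a ((hone : A) ⊗ z) = jT (a ⊗ z).
Proof.
have bt := @bil_lactT _ _ G V.
rewrite /tlactT /twist2 (twistl_inv_r biA (y := biT)); last first.
- by move=> h; exact: lamT_hone.
- exact: bil_twist.
rewrite /jT (tw_opE (is_action_rhoA Om) aVV); apply: eq_bigr => q _ /=.
by rewrite rhoT_hone lactTE hmul1.
Qed.

Lemma mu_incl v w : mu (incl v) (incl w) = (hone : A) ⊗ (v ⊗ w).
Proof.
have [[[_ l1 _] _ _ _ _] _ _ _] := hE.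
by rewrite -[incl v]l1 -[incl w]l1 muE // hmul1.
Qed.

Lemma xi_incl v w : xi (incl v) (incl w) = (hone : A) ⊗ jV (v ⊗ w).
Proof.
rewrite /xi /twist2 (twistl_inv_l biE (x := biE)); last first.
- by move=> h; exact: lamE_incl.
- exact: bil_twist.
rewrite /jV (tw_opE aV aV) (lin_sumE _ _ (lin_tensr _)); apply: eq_bigr => q _ /=.
by rewrite -!incl_rhoV // mu_incl.
Qed.

Lemma xi_lact_incl a v w : xi (twist_lact Om a (incl v)) (incl w) = jT (a ⊗ jV (v ⊗ w)).
Proof. by rewrite xi_lact xi_incl tlactT_hone. Qed.

(** One argument is left-coinvariant and the other right-coinvariant, so both halves of the twist
    vanish in either order. There [xi] equals [mu], and the classical flip identity applies. *)
Lemma flip_xi_rinv v f : rcoact E f = f ⊗ (hone : A) ->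
  flipT (xi (incl v) f) = xi f (incl v).
Proof.
move=> fE; have bt := bmu.
have xl : xi (incl v) f = mu (incl v) f.
  rewrite /xi /twist2 (twistl_inv_l biE (x := biE)); last first.
  - by move=> h; exact: lamE_incl.
  - exact: bil_twist.
  by rewrite (twistr_inv_r biE (y := biE)) // => h; exact: rhoE_rinv.
have xr : xi f (incl v) = mu f (incl v).
  rewrite /xi /twist2 (twistl_inv_r biE (y := biE)); last first.
  - by move=> h; exact: lamE_incl.
  - exact: bil_twist.
  by rewrite (twistr_inv_l biE (x := biE)) // => h; exact: rhoE_rinv.
by rewrite xl xr flip_mu.
Qed.

(** [xi] carries the diagonal coaction formed with the deformed product to the undeformed action on
    the free model. This lets invariance of metric and connection be stated without the cocycle. *)
Lemma xi_lcoact h e f :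
  btlift (fun a e0 => btlift (fun b f0 =>
    rdual_val h (twist_mul Om a b) *: xi e0 f0) (lcoact E f)) (lcoact E e) =
  lamT h (xi e f).
Proof.
have bx := bil_xi; have bE := bil_lamE E.
rewrite -[RHS](twist2_covariant_l h e f bmu equivariant2_mu).
under eq_btlift => a e0 do under eq_btlift => b f0 do
  rewrite rdual_twist_mul scaler_suml.
under eq_btlift => a e0 do rewrite btlift_sumf.
rewrite btlift_sumf; apply: eq_bigr => p _.
under eq_btlift => a e0 do under eq_btlift => b f0 do rewrite scaler_suml.
under eq_btlift => a e0 do rewrite btlift_sumf.
rewrite btlift_sumf; apply: eq_bigr => q _.
have L (t : T) : linear (fun c : k^o => c *: t).
  by move=> c x y; rewrite scalerDl -scalerA.
under eq_btlift => a e0 do under eq_btlift => b f0 do rewrite (btlift_comp _ _ (L _)).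
under eq_btlift => a e0 do rewrite btlift_exchange.
rewrite btlift_exchange; apply: eq_btlift => h1 h2.
rewrite -/xi /= [in RHS]/lamE (btlift_comp _ _ (bx.1 _)); apply: eq_btlift => a e0.
rewrite (btlift_comp _ _ (bx.2 _)); apply: eq_btlift => b f0.
by rewrite (linZ _ _ (bx.1 _)) (linZ _ _ (bx.2 _)) scalerA.
Qed.

Lemma xi_rcoact h e f :
  btlift (fun e0 a => btlift (fun f0 b =>
    rdual_val h (twist_mul Om a b) *: xi e0 f0) (rcoact E f)) (rcoact E e) =
  rT h (xi e f).
Proof.
have bx := bil_xi; have bE := bil_rhoE E.
rewrite -[RHS](twist2_covariant_r h e f bmu equivariant2_mu).
under eq_btlift => a e0 do under eq_btlift => b f0 do
  rewrite rdual_twist_mul scaler_suml.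
under eq_btlift => a e0 do rewrite btlift_sumf.
rewrite btlift_sumf; apply: eq_bigr => p _.
under eq_btlift => a e0 do under eq_btlift => b f0 do rewrite scaler_suml.
under eq_btlift => a e0 do rewrite btlift_sumf.
rewrite btlift_sumf; apply: eq_bigr => q _.
have L (t : T) : linear (fun c : k^o => c *: t).
  by move=> c x y; rewrite scalerDl -scalerA.
under eq_btlift => a e0 do under eq_btlift => b f0 do rewrite (btlift_comp _ _ (L _)).
under eq_btlift => a e0 do rewrite btlift_exchange.
rewrite btlift_exchange; apply: eq_btlift => h1 h2.
rewrite -/xi /= [in RHS]/rhoE (btlift_comp _ _ (bx.1 _)); apply: eq_btlift => a e0.
rewrite (btlift_comp _ _ (bx.2 _)); apply: eq_btlift => b f0.
by rewrite (linZ _ _ (bx.1 _)) (linZ _ _ (bx.2 _)) scalerA.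
Qed.
End Xi.
End TwoSided.

(** * The twisted calculus *)

Section TwistedTensor.
Variables (k : fieldType) (d : nat) (G : linear_algebraic_group k d).
Local Notation A := (OG G).
Local Notation D := (Defs_rdual__canonical__GRing_Lmodule A).
Variables (Om : dual_cocycle A) (E : calculus A).
Hypothesis hE : is_bicovariant E.
Hypothesis ractE : forall (a : A) (e : E), ract e a = lact a e.

Local Notation E' := (twist_calculus Om E).
Local Notation V := (Defs_linv__canonical__GRing_Lmodule E').

(** The deformation keeps the space, the coactions and the unit, so the left coinvariants of
    $E_\Omega$ serve as the abstract $V$ of the classical sections. *)
Definition incl (v : V) : E := linv_val v.

Lemma lin_incl : linear incl.
Proof. by []. Qed.

Lemma inj_incl : injective incl.
Proof. by move=> v w vw; apply: val_inj. Qed.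

Lemma incl_coinv v : lcoact E (incl v) = (hone : A) ⊗ incl v.
Proof. exact: (eqP (linvP v)). Qed.

Lemma incl_surj e : lcoact E e = (hone : A) ⊗ e -> exists v, incl v = e.
Proof. by move=> /eqP ce; exists (@LInv _ _ E' e ce). Qed.

Local Notation T := (A ⊠ (V ⊠ V)).
Local Notation rV := (rhoV hE incl_coinv incl_surj).
Local Notation rVV := (rhoVV hE incl_coinv incl_surj).
Local Notation rT := (rhoT hE incl_coinv incl_surj).
Local Notation Xi := (xi Om hE incl_surj).
Local Notation jV := (jV Om hE incl_coinv incl_surj).
Local Notation kV := (kV Om hE incl_coinv incl_surj).
Local Notation jT := (jT Om hE incl_coinv incl_surj).
Local Notation kT := (kT Om hE incl_coinv incl_surj).
Local Notation LT := (tlactT Om hE lin_incl inj_incl incl_coinv incl_surj).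
Local Notation RT := (tractT Om hE lin_incl inj_incl incl_coinv incl_surj).
Local Notation tlact := (@twist_lact k A Om E).
Local Notation tract := (@twist_ract k A Om E).
Local Notation C := (tens2 E').
Local Notation "e ⊗A f" := (@pure2 k (twist_hopf Om) E' e f) (at level 40).

Let Xi_incl v w : Xi (incl v) (incl w) = (hone : A) ⊗ jV (v ⊗ w) :=
  xi_incl Om hE lin_incl inj_incl incl_coinv incl_surj v w.
Let Xi_lact_incl a v w : Xi (tlact a (incl v)) (incl w) = jT (a ⊗ jV (v ⊗ w)) :=
  xi_lact_incl Om hE lin_incl inj_incl incl_coinv incl_surj a v w.
Let Xi_lact a e f : Xi (tlact a e) f = LT a (Xi e f) :=
  xi_lact Om hE lin_incl inj_incl incl_coinv incl_surj a e f.
Let Xi_bal e a f : Xi (tract e a) f = Xi e (tlact a f) :=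
  xi_bal Om hE ractE lin_incl inj_incl incl_coinv incl_surj e a f.
Let Xi_ract e f a : Xi e (tract f a) = RT (Xi e f) a :=
  xi_ract Om hE ractE lin_incl inj_incl incl_coinv incl_surj e f a.
Let bXi : bilinear_map Xi := bil_xi Om hE lin_incl inj_incl incl_surj.
Let bLT : bilinear_map LT := bil_tlactT Om hE lin_incl inj_incl incl_coinv incl_surj.
Let bRT : bilinear_map RT := bil_tractT Om hE lin_incl inj_incl incl_coinv incl_surj.
Let bl : bilinear_map tlact := bil_twist_lact Om hE.
Let br : bilinear_map tract := bil_twist_ract Om hE.
Let ljV : linear jV := lin_jV Om hE lin_incl inj_incl incl_coinv incl_surj.
Let lkV : linear kV := lin_kV Om hE lin_incl inj_incl incl_coinv incl_surj.
Let ljT : linear jT := lin_jT Om hE lin_incl inj_incl incl_coinv incl_surj.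
Let lkT : linear kT := lin_kT Om hE lin_incl inj_incl incl_coinv incl_surj.
Let jkV z : jV (kV z) = z := jVK Om hE lin_incl inj_incl incl_coinv incl_surj z.
Let kjV z : kV (jV z) = z := kVK Om hE lin_incl inj_incl incl_coinv incl_surj z.
Let jkT z : jT (kT z) = z := jTK Om hE lin_incl inj_incl incl_coinv incl_surj z.
Let kjT z : kT (jT z) = z := kTK Om hE lin_incl inj_incl incl_coinv incl_surj z.

(** * The comparison map on the balanced tensor product *)

Lemma bil_pure2 : bilinear_map (fun e f : E => e ⊗A f : C).
Proof. exact: bpure_bilinear. Qed.

Lemma pure2_bal (e : E) (a : A) (f : E) : tract e a ⊗A f = e ⊗A tlact a f.
Proof. exact: bpure_bal. Qed.

Definition xi2 (x : C) : T := btlift Xi x.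

Lemma xi2E (e f : E) : xi2 (e ⊗A f) = Xi e f.
Proof. by apply: btlift_pure => // m a n; exact: Xi_bal. Qed.

Lemma lin_xi2 : linear xi2.
Proof. by apply: btlift_linear => // m a n; exact: Xi_bal. Qed.

Definition of_free (t : T) : C :=
  btlift (fun a z => btlift (fun v w => tlact a (incl v) ⊗A incl w) z) t.

Let li := lin_incl.
Let bp2 := bil_pure2.

Let bth a : bilinear_map (fun v w : V => tlact a (incl v) ⊗A incl w : C).
Proof.
split=> z; first exact: (lin_comp (bp2.1 (incl z)) (lin_comp (bl.2 a) li)).
exact: (lin_comp (bp2.2 _) li).
Qed.

Let bth2 : bilinear_map (fun (a : A) (z : V ⊠ V) =>
  btlift (fun v w => tlact a (incl v) ⊗A incl w) z : C).
Proof.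
split=> z; last exact: btlift_tlinear (bth z).
by apply: lin_btlift => v w; exact: (lin_comp (bp2.1 (incl w)) (bl.1 (incl v))).
Qed.

Lemma lin_of_free : linear of_free.
Proof. exact: btlift_tlinear bth2. Qed.

Lemma of_freeE a v w : of_free (a ⊗ (v ⊗ w)) = tlact a (incl v) ⊗A incl w.
Proof. by rewrite /of_free (btlift_tpure _ _ bth2) (btlift_tpure _ _ (bth a)). Qed.

(** Expand the right factor over $V$, move its coefficients across the balanced tensor sign, then
    expand the left factor over $V$. *)
Lemma of_free_surj x : exists t, x = of_free t.
Proof.
have lt := lin_of_free; have [s ->] := btens_sum x.
suff H e f : exists t, (e ⊗A f : C) = of_free t.
  pose t p := sval (cid (H p.1 p.2)); exists (\sum_(p <- s) t p).
  rewrite (lin_sumE _ _ lt); apply: eq_bigr => p _.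
  exact: (svalP (cid (H p.1 p.2))).
have [s1 s1E] := twist_E_span Om hE lin_incl inj_incl incl_coinv incl_surj f.
pose sp e := cid (twist_E_span Om hE lin_incl inj_incl incl_coinv incl_surj e).
exists (\sum_(p <- s1) \sum_(q <- sval (sp (tract e p.1))) q.1 ⊗ (q.2 ⊗ p.2)).
rewrite s1E (lin_sumE _ _ (bp2.2 e)) (lin_sumE _ _ lt); apply: eq_bigr => p _.
rewrite -pure2_bal {1}(svalP (sp (tract e p.1))) (lin_sumE _ _ (bp2.1 _)).
by rewrite (lin_sumE _ _ lt); apply: eq_bigr => q _; rewrite of_freeE.
Qed.

Let lid_jV : linear (tmap id jV : T -> T).
Proof. by apply: lin_tmap; [exact: lin_id | exact: ljV]. Qed.
Let lid_kV : linear (tmap id kV : T -> T).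
Proof. by apply: lin_tmap; [exact: lin_id | exact: lkV]. Qed.

Lemma xi2_of_free t : xi2 (of_free t) = jT (tmap id jV t).
Proof.
have lx := lin_xi2; have lt := lin_of_free.
apply: (tens_ext (lin_comp lx lt) (lin_comp ljT lid_jV)) t => a z.
have L1 : linear (fun z => xi2 (of_free (a ⊗ z))).
  exact: (lin_comp lx (lin_comp lt (lin_tensr a))).
have L2 : linear (fun z => jT (tmap id jV (a ⊗ z))).
  exact: (lin_comp ljT (lin_comp lid_jV (lin_tensr a))).
apply: (tens_ext L1 L2) z => v w; rewrite of_freeE xi2E Xi_lact_incl tmapE //.
Qed.

(** [xi2] after [of_free] is the invertible $j_T(\mathrm{id}\otimes J)$, and [of_free] is
    surjective; hence both maps are bijective, with the inverse of [xi2] given here. *)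
Definition xi2_inv (t : T) : C := of_free (tmap id kV (kT t)).

Lemma tmap_kjV t : tmap id kV (tmap id jV t) = t :> T.
Proof.
apply: (tens_ext (lin_comp lid_kV lid_jV) (@lin_id _ _)) t => a z.
by rewrite !tmapE // kjV.
Qed.

Lemma tmap_jkV t : tmap id jV (tmap id kV t) = t :> T.
Proof.
apply: (tens_ext (lin_comp lid_jV lid_kV) (@lin_id _ _)) t => a z.
by rewrite !tmapE // jkV.
Qed.

Lemma xi2_invK t : xi2 (xi2_inv t) = t.
Proof. by rewrite xi2_of_free tmap_jkV jkT. Qed.

Lemma xi2K x : xi2_inv (xi2 x) = x.
Proof. by have [t ->] := of_free_surj x; rewrite /xi2_inv xi2_of_free kjT tmap_kjV. Qed.

Lemma xi2_inj : injective xi2.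
Proof. exact: can_inj xi2K. Qed.

Lemma lin_xi2_inv : linear xi2_inv.
Proof. exact: (lin_comp lin_of_free (lin_comp lid_kV lkT)). Qed.

Local Notation inc := (@incl2 k (twist_hopf Om) E').

Let binc : bilinear_map (fun v w : V => incl v ⊗A incl w : C).
Proof.
split=> z; first exact: (lin_comp (bp2.1 (incl z)) li).
exact: (lin_comp (bp2.2 _) li).
Qed.

Lemma incl2_pure v w : inc (v ⊗ w) = incl v ⊗A incl w.
Proof. exact: (btlift_tpure _ _ binc). Qed.

Lemma lin_incl2 : linear (inc : V ⊠ V -> C).
Proof. exact: (btlift_tlinear binc). Qed.

Lemma xi2_incl2 (z : V ⊠ V) : xi2 (inc z) = (hone : A) ⊗ jV z.
Proof.
apply: (tens_ext (lin_comp lin_xi2 lin_incl2) (lin_comp (lin_tensr _) ljV)) z => v w.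
by rewrite incl2_pure xi2E Xi_incl.
Qed.

Lemma xi2_inv_hone z : xi2_inv ((hone : A) ⊗ z) = inc (kV z).
Proof. by apply: xi2_inj; rewrite xi2_invK xi2_incl2 jkV. Qed.

Lemma hone_tens_inj (W : lmodType k) : injective (fun w : W => (hone : A) ⊗ w).
Proof.
move=> w w' /= E0; have b := bil_pairl W (dunit G).
have := congr1 (btlift (fun (a : A) (w : W) => rdual_val (dunit G) a *: w)) E0.
by rewrite !(btlift_tpure _ _ b) dunit_hone !scale1r.
Qed.

Lemma coinv2_incl2 (z : V ⊠ V) : coinv2 (inc z) = z.
Proof.
(* [xget] returns some preimage; it is [z] because [xi2] sends [inc z] to $1\otimes J(z)$, from
   which [z] is recovered. *)
have : [set w | inc w = inc z]%classic (coinv2 (inc z)).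
  by apply: (xgetPex 0); exists z.
move=> /= /(congr1 xi2); rewrite !xi2_incl2 => /hone_tens_inj /(congr1 kV).
by rewrite !kjV.
Qed.

Lemma tens2_ext (W : lmodType k) (f g : C -> W) : linear f -> linear g ->
  (forall e e', f (e ⊗A e') = g (e ⊗A e')) -> forall x, f x = g x.
Proof. exact: btens_ext. Qed.

Local Notation l2 := (@lact2 k (twist_hopf Om) E').
Local Notation r2 := (@ract2 k (twist_hopf Om) E').

Let bl2 a : bilinear_map (fun e f : E => tlact a e ⊗A f : C).
Proof.
split=> z; last exact: bp2.2.
exact: (lin_comp (bp2.1 z) (bl.2 a)).
Qed.

Let br2 a : bilinear_map (fun e f : E => e ⊗A tract f a : C).
Proof.
split=> z; first exact: bp2.1.
exact: (lin_comp (bp2.2 z) (br.1 a)).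
Qed.

(** Needed for the deformed action to descend to the quotient; injectivity of [xi2] reduces it to
    the free model. *)
Let bal_l2 a m b n : tlact a (tract m b) ⊗A n = tlact a m ⊗A tlact b n.
Proof. by apply: xi2_inj; rewrite !xi2E !Xi_lact Xi_bal. Qed.

Let bal_r2 a m b n : tract m b ⊗A tract n a = m ⊗A tract (tlact b n) a.
Proof. by apply: xi2_inj; rewrite !xi2E !Xi_ract Xi_bal. Qed.

Lemma lact2_pure a (e f : E) : l2 a (e ⊗A f) = tlact a e ⊗A f.
Proof. exact: (btlift_pure (bl2 a) (bal_l2 a)). Qed.

Lemma lin_lact2 a : linear (l2 a).
Proof. exact: (btlift_linear (bl2 a) (bal_l2 a)). Qed.

Lemma ract2_pure a (e f : E) : r2 (e ⊗A f) a = e ⊗A tract f a.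
Proof. exact: (btlift_pure (br2 a) (bal_r2 a)). Qed.

Lemma lin_ract2 a : linear (r2^~ a).
Proof. exact: (btlift_linear (br2 a) (bal_r2 a)). Qed.

Lemma xi2_lact2 a x : xi2 (l2 a x) = LT a (xi2 x).
Proof.
apply: (tens2_ext (lin_comp lin_xi2 (lin_lact2 a)) (lin_comp (bLT.2 a) lin_xi2)) x => e f.
by rewrite lact2_pure !xi2E Xi_lact.
Qed.

Lemma xi2_ract2 a x : xi2 (r2 x a) = RT (xi2 x) a.
Proof.
apply: (tens2_ext (lin_comp lin_xi2 (lin_ract2 a)) (lin_comp (bRT.1 a) lin_xi2)) x => e f.
by rewrite ract2_pure !xi2E Xi_ract.
Qed.

(** * The braiding of the twisted calculus *)

Definition flip_braiding (x : C) : C := xi2_inv (flipT (xi2 x)).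

Lemma is_braiding_flip : is_braiding flip_braiding.
Proof.
split.
- exact: (lin_comp lin_xi2_inv (lin_comp (@lin_flipT _ _ G V) lin_xi2)).
- move=> a x; apply: xi2_inj; rewrite /flip_braiding xi2_invK !xi2_lact2 xi2_invK.
  exact: (flip_tlactT Om hE lin_incl inj_incl incl_coinv incl_surj).
- move=> x a; apply: xi2_inj; rewrite /flip_braiding xi2_invK !xi2_ract2 xi2_invK.
  exact: (flip_tractT Om hE lin_incl inj_incl incl_coinv incl_surj).
move=> v f ff; apply: xi2_inj; rewrite /flip_braiding xi2_invK !xi2E.
exact: (flip_xi_rinv Om hE lin_incl inj_incl incl_coinv incl_surj v ff).
Qed.

(** Left linearity reduces to $v\otimes w$ with $v,w\in V$; expanding $w$ over right coinvariants
    and using right linearity leaves the prescribed values $v\otimes f\mapsto f\otimes v$. *)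
Lemma braiding_uniq s1 s2 : is_braiding s1 -> is_braiding s2 -> forall x : C, s1 x = s2 x.
Proof.
move=> [ls1 l1 r1 b1] [ls2 l2' r2' b2] x.
have [t ->] := of_free_surj x.
apply: (tens_ext (lin_comp ls1 lin_of_free) (lin_comp ls2 lin_of_free)) t => a z.
have L := lin_comp lin_of_free (@lin_tensr k A (V ⊠ V) a).
apply: (tens_ext (lin_comp ls1 L) (lin_comp ls2 L)) z => v w.
rewrite of_freeE -lact2_pure l1 l2'; congr (l2 a _).
have [s sr ->] := twist_ract_rinv_span Om hE ractE (incl w).
rewrite (lin_sumE _ _ (bp2.2 _)) (lin_sumE _ _ ls1) (lin_sumE _ _ ls2).
apply: eq_big_seq => p /sr prinv; rewrite -ract2_pure r1 r2'; congr (r2 _ _).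
by rewrite b1 // b2.
Qed.

Lemma braidingE (x : C) : braiding x = flip_braiding x.
Proof.
apply: braiding_uniq is_braiding_flip x.
by apply: (@xgetPex _ (@id C) [set s | is_braiding s]%classic);
  exists flip_braiding; exact: is_braiding_flip.
Qed.

Lemma xi2_braiding x : xi2 (braiding x) = flipT (xi2 x).
Proof. by rewrite braidingE xi2_invK. Qed.

Definition braid0 (z : V ⊠ V) : V ⊠ V := kV (flip (jV z)).

Lemma braiding_incl2 (z : V ⊠ V) : braiding (inc z) = inc (braid0 z).
Proof. by apply: xi2_inj; rewrite xi2_braiding !xi2_incl2 flipTE jkV. Qed.

Lemma braiding0E (z : V ⊠ V) : braiding0 (E := E') z = braid0 z.
Proof. by rewrite /braiding0 braiding_incl2 coinv2_incl2. Qed.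

Lemma braid0K z : braid0 (braid0 z) = z.
Proof. by rewrite /braid0 jkV flipK kjV. Qed.

Lemma lin_braid0 : linear braid0.
Proof. exact: (lin_comp lkV (lin_comp (@lin_flip _ _) ljV)). Qed.

Lemma scaler_invol (c : k) (z : V ⊠ V) : braid0 z = c *: z -> c != 1 -> braid0 z = - z.
Proof.
move=> sz c1; have := braid0K z; rewrite sz (linZ _ _ lin_braid0) sz scalerA => /eqP.
rewrite -subr_eq0 -{2}[z]scale1r -scalerBl scaler_eq0.
case/orP => [|/eqP ->]; last by rewrite scaler0 oppr0.
rewrite -expr2 subr_sqr_1 mulf_eq0 subr_eq0 (negPf c1) /= addr_eq0 => /eqP ->.
by rewrite scaleN1r.
Qed.

(** * The symmetriser of an involutive braiding *)

Hypothesis two_neq0 : (2 : k) != 0.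

(** Eigenvectors of an involution for eigenvalues other than 1 lie in the $-1$ eigenspace, so
    $(1+\sigma)/2$ satisfies the specification. Any other solution $S$ has the same range and
    kernel: $Sw$ is fixed by $(1+\sigma)/2$, and $Sw-w$ is killed by it. *)
Lemma symprojE (w : V ⊠ V) : symproj (E := E') w = 2^-1 *: (w + braid0 w).
Proof.
pose P0 (w : V ⊠ V) := 2^-1 *: (w + braid0 w).
have ls := lin_braid0.
have half (z : V ⊠ V) : 2^-1 *: (z + z) = z.
  by rewrite -mulr2n -scaler_nat scalerA mulVf // scale1r.
have two (z : V ⊠ V) : z + z = 2 *: z by rewrite -mulr2n -scaler_nat.
have fixP z : braid0 (P0 z) = P0 z.
  by rewrite /P0 (linZ _ _ ls) (linD _ _ ls) braid0K addrC.
have fix0 z : braid0 z = z -> P0 z = z by move=> sz; rewrite /P0 sz half.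
have ker0 z : P0 z = 0 -> braid0 z = - z.
  move=> /eqP; rewrite scaler_eq0 invr_eq0 (negPf two_neq0) /= addrC addr_eq0.
  by move/eqP.
have lP : linear P0 by rewrite /P0; lin.
have P0P : is_symproj (E := E') P0.
  split.
  - exact: lP.
  - by move=> z; rewrite fix0.
  - move=> z; rewrite braiding0E; split=> [[v ->]|sz]; first exact: fixP.
    by exists z; rewrite fix0.
  move=> z; split=> [/ker0 sz|[s sP ->]].
    exists [:: (-1, z)]; last by rewrite big_seq1.
    move=> p; rewrite inE => /eqP -> /=; split; last by rewrite braiding0E sz scaleN1r.
    by rewrite eq_sym -subr_eq0 opprK; exact: two_neq0.
  rewrite (lin_sumE _ _ lP) big_seq big1 // => p /sP[p1].
  rewrite braiding0E => /scaler_invol/(_ p1) sp.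
  by rewrite /P0 sp subrr scaler0.
have : is_symproj (E := E') (symproj (E := E')).
  by apply: (@xgetPex _ (@id (linv2 E')) [set P | is_symproj P]%classic); exists P0.
case: P0P => _ _ rP nP [lS iS rS nS].
have PS z : P0 (symproj (E := E') z) = symproj (E := E') z.
  apply: fix0; rewrite -braiding0E; apply/rS; by exists z.
rewrite -PS; apply/eqP; rewrite -subr_eq0 -/(P0 w) -(linB _ _ lP); apply/eqP.
apply/nP; have /nS : symproj (E := E') (symproj (E := E') w - w) = 0.
  by rewrite (linB _ _ lS) iS subrr.
by [].
Qed.

(** * Coactions on the twisted tensor square *)

Definition lcoact2T (x : C) : A ⊠ C := @lcoact2 k (twist_hopf Om) E' x.
Definition rcoact2T (x : C) : C ⊠ A := @rcoact2 k (twist_hopf Om) E' x.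

Local Notation tmul := (@twist_mul k A Om).

Let lcf (e f : E) : A ⊠ C := btlift (fun a e0 => btlift (fun b f0 =>
    tmul a b ⊗ (e0 ⊗A f0)) (lcoact E f)) (lcoact E e).

Let rcf (e f : E) : C ⊠ A := btlift (fun e0 a => btlift (fun f0 b =>
    (e0 ⊗A f0) ⊗ tmul a b) (rcoact E f)) (rcoact E e).

Let btm : bilinear_map tmul.
Proof.
have [l r] : bilinear_map (twist2 (biA Om) (biA Om) (@hmul k A)).
  exact: bil_twist2 (@bil_hmul _ _ G).
by split=> z c x y; rewrite !twist_mulE; [exact: l | exact: r].
Qed.

Let pairC (h : D) : bilinear_map (fun (a : A) (y : C) => rdual_val h a *: xi2 y).
Proof.
split=> z; first exact: lin_scalel (lin_rdual h).
by apply: lin_scale; exact: lin_xi2.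
Qed.

Let pairC' (h : D) : bilinear_map (fun (y : C) (a : A) => rdual_val h a *: xi2 y).
Proof.
split=> z; last exact: lin_scalel (lin_rdual h).
by apply: lin_scale; exact: lin_xi2.
Qed.

Let lcfE (h : D) e f :
  btlift (fun (a : A) (y : C) => rdual_val h a *: xi2 y) (lcf e f) = lamT h (Xi e f).
Proof.
rewrite -(xi_lcoact Om hE lin_incl inj_incl incl_coinv incl_surj).
rewrite /lcf (btlift_comp _ _ (btlift_tlinear (pairC h))).
apply: eq_btlift => a e0; rewrite (btlift_comp _ _ (btlift_tlinear (pairC h))).
by apply: eq_btlift => b f0; rewrite (btlift_tpure _ _ (pairC h)) xi2E.
Qed.

Let rcfE (h : D) e f :
  btlift (fun (y : C) (a : A) => rdual_val h a *: xi2 y) (rcf e f) = rT h (Xi e f).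
Proof.
rewrite -(xi_rcoact Om hE lin_incl inj_incl incl_coinv incl_surj).
rewrite /rcf (btlift_comp _ _ (btlift_tlinear (pairC' h))).
apply: eq_btlift => a e0; rewrite (btlift_comp _ _ (btlift_tlinear (pairC' h))).
by apply: eq_btlift => b f0; rewrite (btlift_tpure _ _ (pairC' h)) xi2E.
Qed.

Lemma xi2_sep_l (t t' : A ⊠ C) :
  (forall x : lag_pt G, btlift (fun (a : A) (y : C) => rdual_val (ev x) a *: xi2 y) t =
    btlift (fun (a : A) (y : C) => rdual_val (ev x) a *: xi2 y) t') -> t = t'.
Proof.
move=> tt'; apply: pairl_sep => x; apply: xi2_inj.
rewrite !(btlift_comp _ _ lin_xi2); have := tt' x; congr (_ = _);
  by apply: eq_btlift => a y; rewrite (linZ _ _ lin_xi2).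
Qed.

Lemma xi2_sep_r (t t' : C ⊠ A) :
  (forall x : lag_pt G, btlift (fun (y : C) (a : A) => rdual_val (ev x) a *: xi2 y) t =
    btlift (fun (y : C) (a : A) => rdual_val (ev x) a *: xi2 y) t') -> t = t'.
Proof.
move=> tt'; apply: pairr_sep => x; apply: xi2_inj.
rewrite !(btlift_comp _ _ lin_xi2); have := tt' x; congr (_ = _);
  by apply: eq_btlift => a y; rewrite (linZ _ _ lin_xi2).
Qed.

Let blcf : bilinear_map lcf.
Proof.
have ll := @lin_lcoact _ _ _ E; have bt := btm.
have b2 : bilinear_map (@pure2 k (twist_hopf Om) E') := bp2.
by split=> z; rewrite /lcf; lin.
Qed.

Let brcf : bilinear_map rcf.
Proof.
have ll := @lin_rcoact _ _ _ E; have bt := btm.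
have b2 : bilinear_map (@pure2 k (twist_hopf Om) E') := bp2.
by split=> z; rewrite /rcf; lin.
Qed.

(** The coaction formula descends to the quotient: after pairing with a point and applying [xi2] it
    becomes [lamT] of [Xi], which is balanced. *)
Let ballcf m a n : lcf (tract m a) n = lcf m (tlact a n).
Proof. by apply: xi2_sep_l => x; rewrite !lcfE Xi_bal. Qed.

Let balrcf m a n : rcf (tract m a) n = rcf m (tlact a n).
Proof. by apply: xi2_sep_r => x; rewrite !rcfE Xi_bal. Qed.

Let lin_lcf : linear (fun x : C => btlift lcf x).
Proof. exact: (btlift_linear blcf ballcf). Qed.
Let lin_rcf : linear (fun x : C => btlift rcf x).
Proof. exact: (btlift_linear brcf balrcf). Qed.

Lemma lin_lcoact2T : linear lcoact2T. Proof. exact: lin_lcf. Qed.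
Lemma lin_rcoact2T : linear rcoact2T. Proof. exact: lin_rcf. Qed.

Lemma lcoact2_xi2 (h : D) x :
  btlift (fun (a : A) (y : C) => rdual_val h a *: xi2 y) (lcoact2T x) = lamT h (xi2 x).
Proof.
apply: (tens2_ext (lin_comp (btlift_tlinear (pairC h)) lin_lcoact2T)
  (lin_comp (@lin_lamT _ _ G V h) lin_xi2)) x => e f.
by rewrite xi2E -lcfE; congr (btlift _ _); exact: (btlift_pure blcf ballcf).
Qed.

Lemma rcoact2_xi2 (h : D) x :
  btlift (fun (y : C) (a : A) => rdual_val h a *: xi2 y) (rcoact2T x) = rT h (xi2 x).
Proof.
have [bT _ _] := is_action_rhoT Om hE lin_incl inj_incl incl_coinv incl_surj.
apply: (tens2_ext (lin_comp (btlift_tlinear (pairC' h)) lin_rcoact2T)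
  (lin_comp (bT.2 h) lin_xi2)) x => e f.
by rewrite xi2E -rcfE; congr (btlift _ _); exact: (btlift_pure brcf balrcf).
Qed.

Lemma lcoact2_incl2 (z : V ⊠ V) : lcoact2T (inc z) = (hone : A) ⊗ inc z.
Proof.
apply: xi2_sep_l => x; rewrite lcoact2_xi2 (btlift_tpure _ _ (pairC _)) xi2_incl2.
by rewrite lamT_hone.
Qed.

Lemma lcoact2_coinv x : lcoact2T x = (hone : A) ⊗ x -> exists z : V ⊠ V, x = inc z.
Proof.
(* Coinvariance makes [xi2 x] fixed by every [lamT (ev y)], so its $A$-leg is constant and the
   counit on that leg recovers its component in $V\otimes V$. *)
move=> cx; pose z := btlift (fun (a : A) (z : V ⊠ V) => hcounit a *: z) (xi2 x).
suff E0 : xi2 x = (hone : A) ⊗ z by exists (kV z); rewrite -xi2_inv_hone -E0 xi2K.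
apply: pairl_sep => y; have bz := bil_pairl (V ⊠ V) (ev y).
rewrite (btlift_tpure _ _ bz) -[rdual_val _ _]/(1 : k) scale1r /z.
have := lcoact2_xi2 (ev y) x; rewrite cx (btlift_tpure _ _ (pairC _)).
rewrite -[rdual_val _ _]/(1 : k) scale1r => {2}->.
have b1 : bilinear_map (fun (a : A) (z : V ⊠ V) => hcounit a *: z).
  split=> w; first exact: (lin_scalel w (@lin_hcounit _ _ G)).
  by lin.
rewrite /lamT /tmap (btlift_comp _ _ (btlift_tlinear b1)); apply: eq_btlift => a w.
rewrite (btlift_tpure _ _ b1); congr (_ *: _).
by rewrite -[RHS]/(regular_val (lamA (ev y) a) (lag_e G)) lamA_ev lag_mul1.
Qed.

(** * Metric and connection on coinvariants *)

Variables (g : {linear C -> twist_hopf Om}) (nabla : {linear E' -> C}).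
Hypotheses (gP : is_metric g) (g_inv : is_biinvariant g).
Hypothesis nabla_cov : is_bicovariant_map nabla.

Let lg : linear (g : C -> A).
Proof. by move=> c x y; rewrite linearP. Qed.

Let lnabla : linear (nabla : E -> C).
Proof. by move=> c x y; rewrite linearP. Qed.

Let linc := lin_incl2.

Definition g0 (z : V ⊠ V) : k^o := hcounit (g (inc z) : A).

Lemma lin_g0 : linear g0.
Proof. exact: (lin_comp (@lin_hcounit _ _ G) (lin_comp lg linc)). Qed.

Lemma g_incl2 z : g (inc z) = g0 z *: (hone : A).
Proof.
have [gl _] := g_inv; rewrite -[LHS]gl.
have b : bilinear_map (fun (a : A) (y : C) => hcounit (g y : A) *: a).
  split=> w; first by lin.
  exact: (lin_scalel w (lin_comp (@lin_hcounit _ _ G) lg)).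
by rewrite [lcoact2 _]lcoact2_incl2 (btlift_tpure _ _ b).
Qed.

Definition gJ (z : V ⊠ V) : k^o := g0 (kV z).

Lemma lin_gJ : linear gJ.
Proof. exact: (lin_comp lin_g0 lkV). Qed.

(** [E1] is right invariance of the metric at $J^{-1}z$, paired with [h]; [E2] evaluates the same
    contraction through [xi2], which replaces the deformed coaction by the plain right action. *)
Lemma gJ_rho (h : D) z : gJ (rVV h z) = rdual_val h hone * gJ z.
Proof.
have [_ gr] := g_inv.
have := congr1 (rdual_val h) (gr (inc (kV z))).
rewrite g_incl2 (linZ _ _ (lin_rdual h)) -/(gJ z) => E1.
rewrite mulrC -[RHS]/(gJ z *: (rdual_val h hone : k^o)) -E1.
have L : linear (fun t : T => hcounit (g (xi2_inv t) : A) : k^o).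
  exact: (lin_comp (@lin_hcounit _ _ G) (lin_comp lg lin_xi2_inv)).
have := congr1 (fun t : T => hcounit (g (xi2_inv t) : A) : k^o) (rcoact2_xi2 h (inc (kV z))).
rewrite xi2_incl2 jkV (rhoT_hone Om hE lin_incl inj_incl incl_coinv incl_surj) xi2_inv_hone => E2.
rewrite -[LHS]/(hcounit (g (inc (kV (rVV h z))) : A)) -E2.
rewrite (btlift_comp _ _ L) (btlift_comp _ _ (lin_rdual h)).
apply: eq_btlift => y a; rewrite (linZ _ _ L) (linZ _ _ (lin_rdual h)) xi2K.
exact: mulrC.
Qed.

Lemma gJ_flip z : gJ (flip z) = gJ z.
Proof.
have [_ gs _] := gP; rewrite /gJ /g0 -[in RHS](gs (inc (kV z))).
by rewrite braiding_incl2 /braid0 jkV.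
Qed.

Definition nablaJ (v : V) : V ⊠ V := jV (coinv2 (nabla (incl v))).

(** Left covariance makes $\nabla(v)$ a coinvariant of the tensor square, hence an element of
    $V\otimes V$; [nablaJ] is its image under $J$. *)
Lemma nabla_incl2 v : nabla (incl v) = inc (kV (nablaJ v)).
Proof.
have [nl _] := nabla_cov.
have : lcoact2T (nabla (incl v)) = (hone : A) ⊗ nabla (incl v).
  rewrite [LHS]nl [lcoact _ _]incl_coinv btlift_tpure //.
  split=> z; first exact: lin_tensl.
  exact: (lin_comp (lin_tensr z) lnabla).
by case/lcoact2_coinv => z zE; rewrite /nablaJ zE coinv2_incl2 kjV.
Qed.

Lemma xi2_nabla v : xi2 (nabla (incl v)) = (hone : A) ⊗ nablaJ v.
Proof. by rewrite nabla_incl2 xi2_incl2 jkV. Qed.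

Lemma lin_nablaJ : linear nablaJ.
Proof.
move=> c v w; apply: hone_tens_inj; rewrite -xi2_nabla lin_incl lnabla lin_xi2 !xi2_nabla.
by rewrite tpureDr tpureZr.
Qed.

Lemma nablaJ_rho (h : D) v : nablaJ (rV h v) = rVV h (nablaJ v).
Proof.
have [_ nr] := nabla_cov; apply: hone_tens_inj.
rewrite -xi2_nabla (incl_rhoV hE).
rewrite -(rhoT_hone Om hE lin_incl inj_incl incl_coinv incl_surj) -xi2_nabla.
rewrite -rcoact2_xi2 [rcoact2T _]nr (btlift_comp _ _ (btlift_tlinear (pairC' h))).
rewrite /rhoE (btlift_comp _ _ (lin_comp lin_xi2 lnabla)).
apply: eq_btlift => e a; rewrite (btlift_tpure _ _ (pairC' h)).
by rewrite (linZ _ _ (lin_comp lin_xi2 lnabla)).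
Qed.

Let bV : bilinear_map rV.
Proof. by have [] := is_action_rhoV Om hE lin_incl inj_incl incl_coinv incl_surj. Qed.

Let aV : is_action (twr Om) rV := is_action_rhoV Om hE lin_incl inj_incl incl_coinv incl_surj.

(* $(g \otimes id)(v \otimes z)$ and $(id \otimes g)(z \otimes v)$. *)
Definition g_l (v : V) (z : V ⊠ V) : V := btlift (fun v1 v2 => g0 (v ⊗ v1) *: v2) z.
Definition g_r (z : V ⊠ V) (v : V) : V := btlift (fun v1 v2 => g0 (v2 ⊗ v) *: v1) z.

Let bgl v : bilinear_map (fun v1 v2 : V => g0 (v ⊗ v1) *: v2).
Proof.
split=> w; last by lin.
exact: (lin_scalel w (lin_comp lin_g0 (lin_tensr v))).
Qed.

Let bgr v : bilinear_map (fun v1 v2 : V => g0 (v2 ⊗ v) *: v1).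
Proof.
split=> w; first by lin.
exact: (lin_scalel w (lin_comp lin_g0 (lin_tensl v))).
Qed.

Lemma bil_g_l : bilinear_map g_l.
Proof.
split=> z; last exact: btlift_tlinear (bgl z).
by apply: lin_btlift => v1 v2; exact: (lin_scalel v2 (lin_comp lin_g0 (lin_tensl v1))).
Qed.

Lemma bil_g_r : bilinear_map g_r.
Proof.
split=> z; first exact: btlift_tlinear (bgr z).
by apply: lin_btlift => v1 v2; exact: (lin_scalel v1 (lin_comp lin_g0 (lin_tensr v2))).
Qed.

Let kVE v w : kV (v ⊗ w) = \sum_(p <- seqO Om) rV p.1 v ⊗ rV p.2 w.
Proof. exact: (tw_opE aV aV). Qed.

(* Both identities move the twist off the tensor carrying [g] by the cocycle
   identity, where it acts trivially because [gJ] is invariant. *)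
Lemma g_l_twist v a b :
  \sum_(p <- seqO Om) g_l (rV p.1 v) (kV (rVV p.2 (b ⊗ a))) = gJ (v ⊗ b) *: a.
Proof.
have [_ rM rone] := aV; have bg := bil_g_l; have lq := lin_g0.
pose F x y z : V := g0 (rV x v ⊗ rV y b) *: rV z a.
have tF : trilinear F.
  rewrite /F; split=> x y.
  - exact: (lin_scalel _ (lin_comp lq (lin_comp (lin_tensl _) (bV.1 v)))).
  - exact: (lin_scalel _ (lin_comp lq (lin_comp (lin_tensr _) (bV.1 b)))).
  by lin.
transitivity (\sum_(q <- seqO Om) \sum_(p <- seqO Om)
    btlift (fun h1 h2 => F q.1 (dmul p.1 h1) (dmul p.2 h2)) (dcop q.2)).
  apply: eq_bigr => q _; rewrite -btlift_sumf [rVV _ _](tens_actE aV aV).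
  rewrite (btlift_comp _ _ (lin_comp (bg.2 _) lkV)); apply: eq_btlift => h1 h2.
  rewrite kVE (lin_sumE _ _ (bg.2 _)); apply: eq_bigr => p _.
  by rewrite /g_l (btlift_tpure _ _ (bgl _)) -!rM.
rewrite -(seqO_cocycle Om tF).
transitivity (\sum_(q <- seqO Om) gJ (rVV q.1 (v ⊗ b)) *: rV q.2 a).
  apply: eq_bigr => q _.
  have L : linear (fun c : k^o => c *: rV q.2 a).
    by move=> c x y; rewrite scalerDl -scalerA.
  rewrite [rVV _ _](tens_actE aV aV) (btlift_comp _ _ (lin_comp L lin_gJ)) -btlift_sumf.
  apply: eq_btlift => h1 h2; rewrite /gJ kVE (lin_sumE _ _ lq) (lin_sumE _ _ L).
  by apply: eq_bigr => p _; rewrite /F -!rM.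
have -> : gJ (v ⊗ b) *: a = gJ (v ⊗ b) *: rV (dunit G) a by rewrite rone.
rewrite -(seqO_unitl Om) (lin_sumE _ _ (bV.1 a)) scaler_sumr; apply: eq_bigr => q _.
by rewrite gJ_rho (linZ _ _ (bV.1 a)) scalerA mulrC.
Qed.

Lemma g_r_twist v a b :
  \sum_(p <- seqO Om) g_r (kV (rVV p.1 (a ⊗ b))) (rV p.2 v) = gJ (b ⊗ v) *: a.
Proof.
have [_ rM rone] := aV; have bg := bil_g_r; have lq := lin_g0.
pose F x y z : V := g0 (rV y b ⊗ rV z v) *: rV x a.
have tF : trilinear F.
  rewrite /F; split=> x y.
  - by lin.
  - exact: (lin_scalel _ (lin_comp lq (lin_comp (lin_tensl _) (bV.1 b)))).
  exact: (lin_scalel _ (lin_comp lq (lin_comp (lin_tensr _) (bV.1 v)))).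
transitivity (\sum_(q <- seqO Om) \sum_(p <- seqO Om)
    btlift (fun h1 h2 => F (dmul p.1 h1) (dmul p.2 h2) q.2) (dcop q.1)).
  apply: eq_bigr => q _; rewrite -btlift_sumf [rVV _ _](tens_actE aV aV).
  rewrite (btlift_comp _ _ (lin_comp (bg.1 _) lkV)); apply: eq_btlift => h1 h2.
  rewrite kVE (lin_sumE _ _ (bg.1 _)); apply: eq_bigr => p _.
  by rewrite /g_r (btlift_tpure _ _ (bgr _)) -!rM.
rewrite (seqO_cocycle Om tF).
transitivity (\sum_(q <- seqO Om) gJ (rVV q.2 (b ⊗ v)) *: rV q.1 a).
  apply: eq_bigr => q _.
  have L : linear (fun c : k^o => c *: rV q.1 a).
    by move=> c x y; rewrite scalerDl -scalerA.
  rewrite [rVV _ _](tens_actE aV aV) (btlift_comp _ _ (lin_comp L lin_gJ)) -btlift_sumf.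
  apply: eq_btlift => h1 h2; rewrite /gJ kVE (lin_sumE _ _ lq) (lin_sumE _ _ L).
  by apply: eq_bigr => p _; rewrite /F -!rM.
have -> : gJ (b ⊗ v) *: a = gJ (b ⊗ v) *: rV (dunit G) a by rewrite rone.
rewrite -(seqO_unitr Om) (lin_sumE _ _ (bV.1 a)) scaler_sumr; apply: eq_bigr => q _.
by rewrite gJ_rho (linZ _ _ (bV.1 a)) scalerA mulrC.
Qed.

Let tlact_scalar c (e : E) : tlact (c *: (hone : A)) e = c *: e.
Proof. by rewrite (linZ _ _ (bl.1 e)) (twist_lact1 Om hE). Qed.

Let tract_scalar c (e : E) : tract e (c *: (hone : A)) = c *: e.
Proof. by rewrite (linZ _ _ (br.2 e)) (twist_ract1 Om hE). Qed.

Lemma g_idE (v : V) (z : V ⊠ V) : g_id g v (inc z) = incl (g_l v z).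
Proof.
rewrite /g_id coinv2_incl2 /g_l (btlift_comp _ _ lin_incl); apply: eq_btlift => v1 v2.
have -> : pure2 (linv_val v) (linv_val v1) = inc (v ⊗ v1) by rewrite incl2_pure.
by rewrite g_incl2 [LHS]tlact_scalar (linZ _ _ lin_incl).
Qed.

(** Left linearity of the metric and associativity of the deformed right action make the contraction
    balanced, so it can be computed on pure tensors, where the metric is scalar. *)
Lemma id_gE (z : V ⊠ V) (w : V) : id_g g (inc z) (incl w) = incl (g_r z w).
Proof.
have [gl _ _] := gP.
have b : bilinear_map (fun e1 e2 : E => tract e1 (g (e2 ⊗A incl w))).
  split=> y; first exact: br.1.
  exact: (lin_comp (br.2 y) (lin_comp lg (bp2.1 (incl w)))).
have bal m a n : tract (tract m a) (g (n ⊗A incl w)) = tract m (g (tlact a n ⊗A incl w)).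
  by rewrite -lact2_pure gl (twist_ractM Om hE ractE).
have L : linear (fun x => id_g g x (incl w)) by exact: (btlift_linear b bal).
have bg := bil_g_r.
apply: (tens_ext (lin_comp L linc) (lin_comp lin_incl (bg.1 w))) z => v1 v2.
rewrite incl2_pure /g_r (btlift_tpure _ _ (bgr w)).
transitivity (tract (incl v1) (g (incl v2 ⊗A incl w))); first exact: (btlift_pure b bal).
by rewrite -incl2_pure g_incl2 tract_scalar (linZ _ _ lin_incl).
Qed.

Let bT1 : bilinear_map (fun v w : V => incl (g_l v (kV (flip (nablaJ w))))).
Proof.
have bg := bil_g_l; split=> z; first exact: (lin_comp lin_incl (bg.1 _)).
exact: (lin_comp lin_incl (lin_comp (bg.2 z) (lin_comp lkV (lin_comp (@lin_flip _ _) lin_nablaJ)))).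
Qed.

Let bT2 : bilinear_map (fun v w : V => incl (g_r (kV (nablaJ v)) w)).
Proof.
have bg := bil_g_r; split=> z; last exact: (lin_comp lin_incl (bg.2 _)).
exact: (lin_comp lin_incl (lin_comp (bg.1 z) (lin_comp lkV lin_nablaJ))).
Qed.

(** * Comparison of the two compatibility conditions *)

Local Notation T1 := (@g_sigma_nabla k (twist_hopf Om) E' g nabla).
Local Notation T2 := (@g_nabla k (twist_hopf Om) E' g nabla).

Lemma g_sigma_nablaE (w : V ⊠ V) :
  T1 w = btlift (fun v v' => incl (g_l v (kV (flip (nablaJ v'))))) w.
Proof.
apply: eq_btlift => v v'; rewrite [nabla _]nabla_incl2 braiding_incl2 g_idE.
by rewrite /braid0 jkV.
Qed.

Lemma g_nablaE (w : V ⊠ V) :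
  T2 w = btlift (fun v v' => incl (g_r (kV (nablaJ v)) v')) w.
Proof. by apply: eq_btlift => v v'; rewrite [nabla _]nabla_incl2 id_gE. Qed.

Lemma lin_g_sigma_nabla : linear T1.
Proof.
have l := btlift_tlinear bT1; move=> c x y; rewrite !g_sigma_nablaE; exact: l.
Qed.

(** Substituting $w=J^{-1}z$ turns $\sigma$ into the flip and puts the cocycle sum on the arguments.
    Equivariance of [nablaJ] carries it onto the tensor $\nabla_J v$, where [g_l_twist] and
    [g_r_twist] apply. *)
Lemma g_nabla_braiding (w : V ⊠ V) : T1 (braid0 w) = T2 w.
Proof.
rewrite -{2}(kjV w) /braid0; move: (jV w) => {w} z.
have L1 : linear (fun z => T1 (kV (flip z))).
  exact: (lin_comp lin_g_sigma_nabla (lin_comp lkV (@lin_flip _ _))).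
have L2 : linear (fun z => T2 (kV z)).
  move=> c x y; rewrite !g_nablaE; exact: (lin_comp (btlift_tlinear bT2) lkV).
apply: (tens_ext L1 L2) z => v w.
rewrite flipE g_sigma_nablaE g_nablaE !kVE.
rewrite (btlift_tsum _ _ _ bT1) (btlift_tsum _ _ _ bT2).
rewrite -!(lin_sumE _ _ lin_incl); congr (incl _).
under eq_bigr => p _ do
  rewrite nablaJ_rho (flip_rhoVV Om hE lin_incl inj_incl incl_coinv incl_surj).
under [RHS]eq_bigr => p _ do rewrite nablaJ_rho.
have [s ->] := tens_sum (nablaJ v).
have [bVV _ _] := is_action_rhoVV Om hE lin_incl inj_incl incl_coinv incl_surj.
have [bgl' bgr'] := (bil_g_l, bil_g_r).
rewrite (lin_sumE _ _ (@lin_flip _ _)).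
(* Both sides are the contraction of [w] with the second leg of [nablaJ v] by [gJ]; only the order
   of the arguments of [gJ] differs. *)
transitivity (\sum_(q <- s) gJ (w ⊗ q.2) *: q.1).
  under eq_bigr => p _ do rewrite
    (lin_sumE _ _ (lin_comp (bgl'.2 _) (lin_comp lkV (bVV.2 _)))).
  rewrite exchange_big; apply: eq_bigr => q _ /=.
  by rewrite -g_l_twist; apply: eq_bigr => p _; rewrite flipE.
under [RHS]eq_bigr => p _ do rewrite
    (lin_sumE _ _ (lin_comp (bgr'.1 _) (lin_comp lkV (bVV.2 _)))).
rewrite [RHS]exchange_big; apply: eq_bigr => q _ /=.
by rewrite g_r_twist -gJ_flip flipE.
Qed.

Lemma g_nabla_sum (w : V ⊠ V) :
  T2 w + T1 w = Pi0 g nabla w.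
Proof.
have l1 := lin_g_sigma_nabla.
rewrite /Pi0 symprojE (linZ _ _ l1) scalerA mulfV // scale1r (linD _ _ l1).
by rewrite g_nabla_braiding addrC.
Qed.

Local Notation pi0 := (@Pi0 k (twist_hopf Om) E' g nabla).

Lemma lin_Pi0 : linear pi0.
Proof.
have l1 := lin_g_sigma_nabla; have ls := lin_braid0.
have L : linear (fun w : V ⊠ V => 2 *: T1 (2^-1 *: (w + braid0 w))) by lin.
move=> c x y; have := L c x y.
by rewrite /Pi0 !symprojE.
Qed.

(** On coinvariants the metric is a scalar multiple of 1, so the scalar passes through $d$. *)
Lemma dif_g (a : A) (z : V ⊠ V) :
  dif E (g (l2 a (inc z)) : A) = tract (dif E a) (g (inc z)).
Proof.
have [gl _ _] := gP; have ld : linear (dif E : A -> E) by move=> c x y; rewrite linearP.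
rewrite gl g_incl2 tract_scalar -[hmul _ _]/(tmul a (g0 z *: (hone : A))).
by rewrite (linZ _ _ (btm.2 a)) twist_mul1 (linZ _ _ ld).
Qed.

Let Fth (a : A) (z : V ⊠ V) : E := tlact a (pi0 z) + tract (dif E a) (g (inc z)).

Let bFth : bilinear_map Fth.
Proof.
have ld : linear (dif E : A -> E) by move=> c x y; rewrite linearP.
have lp := lin_Pi0; split=> z; apply: lin_add.
- exact: bl.1.
- exact: (lin_comp (br.1 _) ld).
- exact: (lin_comp (bl.2 z) lp).
exact: (lin_comp (br.2 _) (lin_comp lg linc)).
Qed.

Lemma is_Pi_ext F F' : is_Pi g nabla F -> is_Pi g nabla F' -> forall x, F x = F' x.
Proof.
move=> [lF FE] [lF' F'E] x; have [t ->] := of_free_surj x.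
apply: (tens_ext (lin_comp lF lin_of_free) (lin_comp lF' lin_of_free)) t => a z.
have L := lin_comp lin_of_free (@lin_tensr k A (V ⊠ V) a).
apply: (tens_ext (lin_comp lF L) (lin_comp lF' L)) z => v w.
by rewrite of_freeE -lact2_pure [LHS]FE [RHS]F'E.
Qed.

(** Existence of the map selected by [Pi]: the prescription [Fth] on $A\otimes(V\otimes V)$ is
    transported through the inverse of [of_free], which makes it well defined on the quotient. *)
Lemma is_Pi_Pi : is_Pi g nabla (Pi g nabla).
Proof.
apply: (@xgetPex _ ((fun=> 0) : C -> E') [set F | is_Pi g nabla F]%classic).
exists (fun x => btlift Fth (tmap id kV (kT (xi2 x)))); split.
  exact: (lin_comp (btlift_tlinear bFth) (lin_comp lid_kV (lin_comp lkT lin_xi2))).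
move=> a v w /=; rewrite [lact2 a _]lact2_pure -of_freeE xi2_of_free kjT tmap_kjV.
by rewrite (btlift_tpure _ _ bFth) /Fth incl2_pure.
Qed.

Lemma Pi_eq_dif :
  (forall x : C, Pi g nabla x = dif E' (g x)) <-> (forall w : V ⊠ V, pi0 w = 0).
Proof.
have ld : linear (dif E : A -> E) by move=> c x y; rewrite linearP.
split=> [H w|H].
  apply: (tens_ext lin_Pi0 (@lin_cst0 _ _ _)) w => v w.
  (* At $a=1$ the term $(d1)\,g(v\otimes w)$ occurs on both sides, on the right by [dif_g], and
     cancels. *)
  have [_ PE] := is_Pi_Pi; have := PE hone v w => /=.
  rewrite H -incl2_pure [dif _ _]dif_g => /eqP; rewrite eq_sym -subr_eq0 addrK => /eqP X0.
  by rewrite -[LHS](twist_lact1 Om hE); exact: X0.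
apply: is_Pi_ext is_Pi_Pi _; split; first exact: (lin_comp ld lg).
move=> a v w /=; rewrite H -incl2_pure [LHS]dif_g.
by rewrite (lin0 (bl.2 a)) add0r.
Qed.

Lemma Pi_compatible_iff :
  (forall x : C, Pi g nabla x = dif E' (g x)) <->
  (forall w : V ⊠ V, T2 w + T1 w = 0).
Proof. by rewrite Pi_eq_dif; split=> H w; rewrite ?g_nabla_sum // -g_nabla_sum. Qed.
End TwistedTensor.

Theorem proposition6p9 (R : realType) (n : nat)
  (G : linear_algebraic_group R[i] n)
  (E : calculus (OG G)) (hE : is_classical_calculus E)
  (Om : dual_cocycle (OG G))
  (g' : {linear tens2 (twist_calculus Om E) -> twist_hopf Om})
  (hg' : is_metric g') (hg'inv : is_biinvariant g')
  (nabla' : {linear twist_calculus Om E -> tens2 (twist_calculus Om E)})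
  (hnabla' : is_left_connection nabla')
  (hnabla'cov : is_bicovariant_map nabla') :
  (forall x : tens2 (twist_calculus Om E),
     Pi g' nabla' x = dif (twist_calculus Om E) (g' x)) <->
  (forall w : linv2 (twist_calculus Om E),
     g_nabla g' nabla' w + g_sigma_nabla g' nabla' w = 0).
Proof.
have [[_ bicov _ _] ractE _] := hE.
have two0 : (2 : R[i]) != 0 by rewrite Num.Theory.pnatr_eq0.
exact: (Pi_compatible_iff bicov ractE two0 hg' hg'inv hnabla'cov).
Qed.
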